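(* Let $H\subset\mathbb{C}$ be a (compact) rectangle with sides parallel to the axes, let $\mu\in\mathcal{M}(H)$, let $\phi>0$ be a continuous function on $H$ and put $S=-\log\phi$. Let $\tau$ be a finite positive Borel measure on $H$ for which there are constants $T>0$ and $r_0>0$ such that $\tau(D(z_0,r))\ge r^{T}$ for all $z_0\in H$ and all $0<r\le r_0$. For $k\in\mathbb{N}$, $\epsilon>0$ and $d=1,2,\dots$ set $$J^{\phi}_d(\mu,k,\epsilon):=\int_{\tilde G_d(\mu,k,\epsilon)}|\mathrm{VDM}^{\phi}_d(\lambda)|^2\,d\tau(\lambda),$$ where $d\tau(\lambda)=d\tau(\lambda_1)\cdots d\tau(\lambda_d)$ is the product measure on $H^d$. Then $$\inf_{k,\epsilon}\Big\{\lim_{d\to\infty}\frac1{d^2}\log J^{\phi}_d(\mu,k,\epsilon)\Big\}=\Sigma(\mu)-2\int S\,d\mu ,$$ where the infimum is over all $k\in\mathbb{N}$ and $\epsilon>0$.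
   Context: $\mathbb{C}$ is identified with $\mathbb{R}^2$ via $z=x+iy$. $\mathcal{M}(H)$ is the set of Borel probability measures on $H$ (with the weak* topology). $D(z_0,r)$ is the disc with center $z_0$ and radius $r$. For $\mu\in\mathcal{M}(H)$, $k\in\mathbb{N}$, $\epsilon>0$: $$G(\mu,k,\epsilon):=\Big\{\nu\in\mathcal{M}(H): \Big|\int_H x^{n_1}y^{n_2}(d\mu-d\nu)\Big|<\epsilon \text{ for all integers } n_1,n_2\ge 0 \text{ with } n_1+n_2\le k\Big\}.$$ For $\lambda=(\lambda_1,\dots,\lambda_d)\in\mathbb{C}^d$, $\kappa_d(\lambda):=\frac1d\sum_{j=1}^d\delta(\lambda_j)$, where $\delta(\lambda_j)$ is the Dirac measure at $\lambda_j$, and $$\tilde G_d(\mu,k,\epsilon):=\{\lambda\in H^d:\kappa_d(\lambda)\in G(\mu,k,\epsilon)\}.$$ The VanDerMonde determinant is $\mathrm{VDM}_d(\lambda)=\prod_{1\le i<j\le d}(\lambda_i-\lambda_j)$ and its weighted version is $\mathrm{VDM}^{\phi}_d(\lambda)=\mathrm{VDM}_d(\lambda)\prod_{i=1}^d\phi(\lambda_i)^d$. The free entropy is $\Sigma(\mu)=\int\!\!\int\log|z-t|\,d\mu(z)\,d\mu(t)$, which may equal $-\infty$ (with $\log 0=-\infty$). *)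

(* Defs.v *)
From HB Require Import structures.
From mathcomp Require Import all_boot all_order all_algebra.
From mathcomp Require Import all_classical all_reals all_analysis.
From mathcomp Require Import complex.

Set Implicit Arguments.
Unset Strict Implicit.
Unset Printing Implicit Defensive.
Import Order.TTheory GRing.Theory Num.Theory.
Import numFieldNormedType.Exports.

Local Open Scope classical_set_scope.
Local Open Scope ring_scope.

Section product_measure_step.
Local Open Scope ereal_scope.
Context d (T : measurableType d) (R : realType) (n : nat).
Variable P : {measure set (n.-tuple T) -> \bar R}.
Variable tau : {sigma_finite_measure set T -> \bar R}.

Let cons_pair (p : n.-tuple T * T) : n.+1.-tuple T := [tuple of p.2 :: p.1].

Let measurable_cons_pair : measurable_fun setT cons_pair.
Proof. exact: measurable_cons. Qed.

Definition tuple_measureS : set (n.+1.-tuple T) -> \bar R :=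
  pushforward (P \x tau) cons_pair.

Let tuple_measureS0 : tuple_measureS set0 = 0.
Proof. by rewrite /tuple_measureS /pushforward preimage_set0 measure0. Qed.

Let tuple_measureS_ge0 A : 0 <= tuple_measureS A.
Proof. exact: measure_ge0. Qed.

Let tuple_measureS_sigma_additive : semi_sigma_additive tuple_measureS.
Proof. exact: measure_semi_sigma_additive. Qed.

HB.instance Definition _ := isMeasure.Build _ _ _ tuple_measureS
  tuple_measureS0 tuple_measureS_ge0 tuple_measureS_sigma_additive.

End product_measure_step.

(* The n-fold product measure tau x ... x tau on n-tuples; the empty product
   is the Dirac mass at the empty tuple. *)
Fixpoint tuple_measure d (T : measurableType d) (R : realType)
    (tau : {sigma_finite_measure set T -> \bar R}) n :
    {measure set (n.-tuple T) -> \bar R} :=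
  if n is m.+1 return {measure set (n.-tuple T) -> \bar R}
  then tuple_measureS (tuple_measure tau m) tau
  else \d_ [tuple].

Section planar_measures.
Context {R : realType}.
Implicit Types (H : set (R * R)) (mu : {measure set (R * R) -> \bar R}).

Definition to_complex (z : R * R) : R[i] := Complex z.1 z.2.

Definition cmod (w : R[i]) : R := ComplexField.Normc.normc w.

Definition disc (z0 : R * R) (r : R) : set (R * R) :=
  [set z | cmod (to_complex z - to_complex z0) < r].

(* Borel measures on H are represented as measures on the plane that vanish on
   the complement of H. *)
Definition prob_on H : set {measure set (R * R) -> \bar R} :=
  [set mu | mu setT = 1%E /\ mu (~` H) = 0%E].

Definition G H mu (k : nat) (eps : R) : set {measure set (R * R) -> \bar R} :=
  [set nu | prob_on H nu /\
    forall n1 n2 : nat, (n1 + n2 <= k)%N ->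
      `| \int[mu]_(z in H) (z.1 ^+ n1 * z.2 ^+ n2)
         - \int[nu]_(z in H) (z.1 ^+ n1 * z.2 ^+ n2) | < eps].

(* Null for the empty tuple, a probability measure otherwise. *)
Definition kappa d (lam : d.-tuple (R * R)) :
    {measure set (R * R) -> \bar R} :=
  mscale (d%:R^-1)%:nng (msum (fun j => \d_(nth (0, 0) lam j)) d).

Definition Gtilde H mu d (k : nat) (eps : R) : set (d.-tuple (R * R)) :=
  [set lam | (forall j, H (tnth lam j)) /\ G H mu k eps (kappa lam)].

Definition VDM d (lam : d.-tuple (R * R)) : R[i] :=
  \prod_(i < d) \prod_(j < d | (i < j)%N)
    (to_complex (tnth lam i) - to_complex (tnth lam j)).

Definition wVDM (phi : R * R -> R) d (lam : d.-tuple (R * R)) : R[i] :=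
  VDM lam * \prod_(i < d) (phi (tnth lam i))%:C%C ^+ d.

Definition J H mu (phi : R * R -> R)
    (tau : {finite_measure set (R * R)%type -> \bar R}) d (k : nat) (eps : R)
    : \bar R :=
  (\int[tuple_measure tau d]_(lam in @Gtilde H mu d k eps)
     (cmod (wVDM phi lam) ^+ 2)%:E)%E.

Definition free_entropy mu : \bar R :=
  (\int[mu]_t \int[mu]_z lne (cmod (to_complex z - to_complex t))%:E)%E.

End planar_measures.

(* Main.v *)
Require Import Defs.
From HB Require Import structures.
From mathcomp Require Import all_boot all_order all_algebra.
From mathcomp Require Import all_classical all_reals all_analysis.
From mathcomp Require Import measurable_realfun complex ring lra.

(** Write S = - ln phi and C for an upper bound of ln|z - t| on H x H.  If lam is
an n-tuple of distinct points, then ln |VDM^phi(lam)|^2 is, up to a term linear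
in n, the sum over i != j of ln|lam_i - lam_j| - S(lam_i) - S(lam_j), i.e. n^2
times a discrete version of the weighted energy
I(mu) = Sigma(mu) - 2 \int S dmu.  Three statements about the integrals J
compare it with I(mu).

Upper bound ([eventually_le_J]): if A > I(mu), then J <= exp(n^2 A) eventually,
for suitable k and eps.  The singular kernel is replaced by
ln(|z - t|^2 + e)/2, which is larger and whose energies decrease to Sigma(mu)
as e tends to 0 ([reg_log_energy_cvg]); together with S it is uniformly close
to a polynomial in the coordinates of z and t.  On the set of tuples whose
moments are close to those of mu, the double sum of such a polynomial is close
to n^2 times its double integral, so the integrand of J is uniformly bounded by
exp(n^2 A), up to factors exp(O(n)).

Lower bound ([eventually_ge_J]): let a finitely supported probability measure,
with masses m_i at points c_i of H, have moments strictly within eps of those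
of mu.  Replace each c_i by about n m_i copies and move these copies by at most
a small length l so that they become separated.  This is possible with mutual
distances of order l/n^2 and without loss of energy, if in the energy of (c, m)
the logarithm is truncated at scale l ([spread_points]): a point of an
interval of length l at which a sum of functions |x - q_j|^(-1/2) is not above
its mean is far, in mean, from all the q_j.  All tuples in small discs around
the new points have the right moments and almost the same energy, and the hypothesis on tau makes the
product of the masses of these discs at least exp(-O(n ln n)).  Hence J is at
least exp(n^2 A) for every A below the truncated energy of (c, m).

The lower bound is used twice.  Applied to the centers of a fine partition of
H, weighted by mu, it gives J >= exp(n^2 A) eventually, for every A < I(mu) and
all k and eps ([eventually_ge_J_of_lt_free_entropy]); the truncated energy is
compared with the free entropy by lower Riemann sums, because truncation at
scale l costs little when both points move by at most l ([trunc_ln_ge]).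
Applied to a tuple lam at which the integrand of J for some large d exceeds
exp(d^2 A - O(d)), mixed with a mass 1/d of a partition measure that brings the
moments strictly inside the eps-neighbourhood, it shows that J_d > exp(d^2 A)
for infinitely many d implies J_n >= exp(n^2 A') for all large n and all A' < A
([J_frequently_eventually]).  So the limit superior of (1/d^2) ln J_d is at most
its limit inferior, and the limit exists. *)

Set Implicit Arguments.
Unset Strict Implicit.
Unset Printing Implicit Defensive.
Import Order.TTheory GRing.Theory Num.Theory.
Import numFieldNormedType.Exports.
Local Open Scope classical_set_scope.
Local Open Scope ring_scope.

(** * Points of an interval far in mean from given points *)

(** The right side is the mean of the decreasing function 1/sqrt over
[u - h, u]. *)
Lemma inv_sqrt_le_increment (R : realType) (u h : R) : 0 < h -> h <= u ->
  (Num.sqrt u)^-1 <= 2 / h * (Num.sqrt u - Num.sqrt (u - h)).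
Proof.
move=> h0 hu.
have u0 : 0 < u by apply: lt_le_trans hu.
set a := Num.sqrt u; set b := Num.sqrt (u - h).
have a0 : 0 < a by rewrite sqrtr_gt0.
have b0 : 0 <= b by rewrite sqrtr_ge0.
have ab : b <= a by rewrite ler_sqrt //; lra.
have a2 : a ^+ 2 = u by rewrite sqr_sqrtr // ltW.
have b2 : b ^+ 2 = u - h by rewrite sqr_sqrtr // subr_ge0.
have hE : h = a ^+ 2 - b ^+ 2 by rewrite a2 b2; ring.
rewrite -(ler_pM2r a0) mulVf ?gt_eqF // -(ler_pM2r h0).
have -> : 2 / h * (a - b) * a * h = 2 * (a - b) * a.
  by field; rewrite gt_eqF.
rewrite hE; nra.
Qed.

Lemma sqrt_increment_le (R : realType) (u l : R) : 0 <= l ->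
  Num.sqrt (u + l) - Num.sqrt u <= Num.sqrt l.
Proof.
move=> l0; have [u0|u0] := leP 0 u; last first.
  rewrite (ltr0_sqrtr u0) subr0; have [ul|ul] := leP 0 (u + l).
    by rewrite ler_sqrt //; lra.
  by rewrite (ltr0_sqrtr ul) sqrtr_ge0.
rewrite lerBlDl -ler_sqr ?nnegrE ?addr_ge0 ?sqrtr_ge0 // sqrrD.
rewrite !sqr_sqrtr ?addr_ge0 //.
have := mulr_ge0 (sqrtr_ge0 u) (sqrtr_ge0 l); lra.
Qed.

(** A Riemann sum for the integral of (|x - q| + s)^(-1/2) over an interval of
length l, which is at most 4 sqrt l whatever q is.  Each term is bounded by an
increment of x |-> sqrt(x - q + s) to the right of q and of
x |-> - sqrt(q - x + s - h) to its left, and both families telescope.  Since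
square roots of negative numbers are 0, both functions are nondecreasing
everywhere, and the increments on the wrong side only add to the bound. *)
Lemma sum_inv_sqrt_le (R : realType) (al l s q : R) (M : nat) : 0 < l -> (0 < M)%N ->
  l / M%:R <= s ->
  \sum_(a < M) (Num.sqrt (`|al + l / M%:R * a.+1%:R - q| + s))^-1
    <= 4 * M%:R / Num.sqrt l.
Proof.
move=> l0 M0 hs; set h := l / M%:R.
have Mr : 0 < M%:R :> R by rewrite ltr0n.
have h0 : 0 < h by rewrite divr_gt0.
pose x (a : nat) := al + h * a%:R.
have xS a : x a.+1 = x a + h by rewrite /x -natr1; ring.
have step (a : 'I_M) : (Num.sqrt (`|al + h * a.+1%:R - q| + s))^-1 <=
   2 / h * ((Num.sqrt (x a.+1 - q + s) - Num.sqrt (x a - q + s)) +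
            (Num.sqrt (q - x a + s - h) - Num.sqrt (q - x a.+1 + s - h))).
  rewrite -/(x a.+1).
  have up : 0 <= Num.sqrt (x a.+1 - q + s) - Num.sqrt (x a - q + s).
    by rewrite subr_ge0 ler_wsqrtr // xS; lra.
  have down : 0 <= Num.sqrt (q - x a + s - h) - Num.sqrt (q - x a.+1 + s - h).
    by rewrite subr_ge0 ler_wsqrtr // xS; lra.
  have h2 : 0 <= 2 / h by rewrite divr_ge0 // ltW.
  have [xq|xq] := leP q (x a.+1).
    rewrite ger0_norm ?subr_ge0 //.
    have hu : h <= x a.+1 - q + s by rewrite /h; lra.
    apply: (le_trans (inv_sqrt_le_increment h0 hu)).
    have -> : x a.+1 - q + s - h = x a - q + s by rewrite xS; ring.
    by rewrite ler_wpM2l // lerDl.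
  rewrite ltr0_norm ?subr_lt0 // opprB.
  have hu : h <= q - x a.+1 + s by rewrite /h; lra.
  apply: (le_trans (inv_sqrt_le_increment h0 hu)).
  have -> : q - x a.+1 + s = q - x a + s - h by rewrite xS; ring.
  have -> : q - x a + s - h - h = q - x a.+1 + s - h by rewrite xS; ring.
  by rewrite ler_wpM2l // lerDr.
apply: le_trans; first by apply: ler_sum => a _; exact: step.
rewrite -mulr_sumr big_split /=.
rewrite -(big_mkord xpredT (fun a => Num.sqrt (x a.+1 - q + s) - Num.sqrt (x a - q + s))).
rewrite -(big_mkord xpredT (fun a => Num.sqrt (q - x a + s - h) - Num.sqrt (q - x a.+1 + s - h))).
rewrite telescope_sumr //.
have -> : \sum_(0 <= i < M) (Num.sqrt (q - x i + s - h) - Num.sqrt (q - x i.+1 + s - h))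
  = - \sum_(0 <= i < M) (Num.sqrt (q - x i.+1 + s - h) - Num.sqrt (q - x i + s - h)).
  by rewrite -sumrN; apply: eq_bigr => i _; rewrite opprB.
rewrite (telescope_sumr (fun a => Num.sqrt (q - x a + s - h))) // opprB.
have xM : x M = x 0%N + l by rewrite /x /h; field; rewrite gt_eqF.
have -> : x M - q + s = (x 0%N - q + s) + l by rewrite xM; ring.
have -> : q - x 0%N + s - h = (q - x M + s - h) + l by rewrite xM; ring.
have b1 := sqrt_increment_le (x 0%N - q + s) (ltW l0).
have b2 := sqrt_increment_le (q - x M + s - h) (ltW l0).
have sl : 0 < Num.sqrt l by rewrite sqrtr_gt0.
apply: (@le_trans _ _ (2 / h * (Num.sqrt l + Num.sqrt l))).
  by rewrite ler_wpM2l ?lerD // divr_ge0 // ltW.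
have hE : h * M%:R = Num.sqrt l ^+ 2.
  by rewrite sqr_sqrtr ?ltW // /h; field; rewrite gt_eqF.
rewrite ler_pdivlMr //.
have -> : 2 / h * (Num.sqrt l + Num.sqrt l) * Num.sqrt l = 4 * Num.sqrt l ^+ 2 / h.
  by field; rewrite gt_eqF.
rewrite ler_pdivrMr //.
by rewrite -[4 * _ * h]mulrA [M%:R * h]mulrC hE; lra.
Qed.

(** Some point of a fine grid of the interval does at least as well as the
average over the grid; the step of the grid has to be below the shift s for the
Riemann sums to be controlled. *)
Lemma exists_weighted_sum_inv_sqrt_le (R : realType) (n : nat) (w q : 'I_n -> R)
    (al l s : R) : 0 < l -> 0 < s -> (forall j, 0 <= w j) ->
  exists2 x, al <= x <= al + l &
    \sum_(j < n) w j * (Num.sqrt (`|x - q j| + s))^-1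
      <= 4 / Num.sqrt l * \sum_(j < n) w j.
Proof.
move=> l0 s0 w0.
have ls0 : 0 <= l / s by rewrite divr_ge0 // ltW.
pose M := (Num.trunc (l / s)).+1.
have Mr : 0 < M%:R :> R by rewrite ltr0n.
have hs : l / M%:R <= s.
  rewrite ler_pdivrMr // mulrC -ler_pdivrMr //.
  by rewrite ltW // truncnS_gt.
pose x (a : 'I_M) := al + l / M%:R * a.+1%:R.
pose f y := \sum_(j < n) w j * (Num.sqrt (`|y - q j| + s))^-1.
suff [a ha] : exists a : 'I_M, f (x a) <= 4 / Num.sqrt l * \sum_(j < n) w j.
  exists (x a) => //; rewrite /x; apply/andP; split.
    by rewrite lerDl mulr_ge0 // divr_ge0 // ltW.
  rewrite lerD2l -mulrA; apply: ler_piMr; first exact: ltW.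
  by rewrite [_^-1 * _]mulrC ler_pdivrMr // mul1r ler_nat.
apply: contrapT => H.
have : \sum_(a < M) (4 / Num.sqrt l * \sum_(j < n) w j) < \sum_(a < M) f (x a).
  apply: ltr_sum; last first.
    by move=> i _; rewrite ltNge; apply/negP => hi; apply: H; exists i.
  by apply/hasP; exists ord0; rewrite ?mem_index_enum.
rewrite /f exchange_big /= sumr_const card_ord ltNge => /negP; apply.
have le1 (j : 'I_n) : \sum_(a < M) w j * (Num.sqrt (`|x a - q j| + s))^-1
    <= w j * (4 * M%:R / Num.sqrt l).
  by rewrite -mulr_sumr ler_wpM2l // sum_inv_sqrt_le.
apply: le_trans; first by apply: ler_sum => j _; exact: le1.
rewrite -mulr_suml -mulr_natr.
by rewrite le_eqVlt; apply/orP; left; apply/eqP; ring.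
Qed.

(** * Spreading points of a rectangle *)

Definition cdist (R : realType) (z t : R * R) : R :=
  cmod (to_complex z - to_complex t).

Lemma cdistE (R : realType) (z t : R * R) :
  cdist z t = Num.sqrt ((z.1 - t.1) ^+ 2 + (z.2 - t.2) ^+ 2).
Proof. by []. Qed.

Lemma cdistC (R : realType) (z t : R * R) : cdist z t = cdist t z.
Proof. by rewrite !cdistE -sqrrN opprB -[(z.2 - t.2) ^+ 2]sqrrN opprB. Qed.

Lemma cdist_ge0 (R : realType) (z t : R * R) : 0 <= cdist z t.
Proof. by rewrite cdistE sqrtr_ge0. Qed.

Lemma cdistxx (R : realType) (z : R * R) : cdist z z = 0.
Proof. by rewrite cdistE !subrr expr0n /= addr0 sqrtr0. Qed.

Lemma cdist_triangle (R : realType) (y x z : R * R) :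
  cdist x z <= cdist x y + cdist y z.
Proof.
rewrite /cdist; have -> : to_complex x - to_complex z =
  (to_complex x - to_complex y) + (to_complex y - to_complex z).
  by rewrite addrA subrK.
exact: le_normcD.
Qed.

Lemma ler_norm1_cdist (R : realType) (z t : R * R) : `|z.1 - t.1| <= cdist z t.
Proof.
rewrite cdistE -sqrtr_sqr ler_wsqrtr // lerDl; exact: sqr_ge0.
Qed.

Lemma ler_norm2_cdist (R : realType) (z t : R * R) : `|z.2 - t.2| <= cdist z t.
Proof.
rewrite cdistE -sqrtr_sqr ler_wsqrtr // lerDr; exact: sqr_ge0.
Qed.

Lemma cdist_le_normD (R : realType) (z t : R * R) :
  cdist z t <= `|z.1 - t.1| + `|z.2 - t.2|.
Proof.
rewrite cdistE -[leRHS]ger0_norm ?addr_ge0 // -[leRHS]sqrtr_sqr ler_wsqrtr //.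
rewrite [leRHS]sqrrD !real_normK ?num_real //.
have := mulr_ge0 (normr_ge0 (z.1 - t.1)) (normr_ge0 (z.2 - t.2)); lra.
Qed.

(** The powers |x - q_j|^(-1/2) serve two purposes at once.  A bound on their
weighted sum bounds each of them, which gives the separation; and it bounds
their mean over the set N, hence the mean of -ln|x - q_j|, because
ln y <= y - 1.  The constant 128 leaves the factor 2 lost in passing from
|x - q_j| to |x - q_j| + s. *)
Lemma separating_point (R : realType) (n k : nat) (q : 'I_k -> R)
    (N : pred 'I_k) (al l : R) : 0 < l -> (0 < n)%N -> (k <= n)%N ->
  exists x, [/\ al <= x <= al + l,
    forall j, l / (128 * n%:R ^+ 2) <= `|x - q j| &
    \sum_(j < k | N j) ln (l / 128) <= \sum_(j < k | N j) ln `|x - q j|].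
Proof.
move=> l0 n0 kn.
have nr : 0 < n%:R :> R by rewrite ltr0n.
set s := l / (128 * n%:R ^+ 2).
have s0 : 0 < s by rewrite divr_gt0 // mulr_gt0 // exprn_gt0.
(* The term 1/n forces the separation from each q_j; the other one takes the
   mean over N.  The total weight is at most 2. *)
pose c : R := (#|[pred j | N j]|)%:R.
pose w (j : 'I_k) : R := n%:R^-1 + (N j)%:R / c.
have c0 : 0 <= c by rewrite ler0n.
have w0 j : 0 <= w j by rewrite addr_ge0 // ?invr_ge0 ?divr_ge0 // ltW.
have cE (y : R) : \sum_(j < k | N j) y = c * y.
  by rewrite sumr_const -[_ *+ _]mulr_natl.
have sw : \sum_(j < k) w j <= 2.
  rewrite big_split /= sumr_const card_ord.
  have -> : \sum_(i < k) (N i)%:R / c = c * c^-1.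
    by rewrite -cE [RHS]big_mkcond; apply: eq_bigr => j _; case: (N j); rewrite ?mul1r ?mul0r.
  have h1 : n%:R^-1 *+ k <= 1 :> R.
    by rewrite -[_ *+ k]mulr_natl ler_pdivrMr // mul1r ler_nat.
  have h2 : c * c^-1 <= 1.
    by have [->|cn] := eqVneq c 0; rewrite ?mul0r ?ler01 // divff.
  lra.
have sl : 0 < Num.sqrt l by rewrite sqrtr_gt0.
have l2 : Num.sqrt l ^+ 2 = l by rewrite sqr_sqrtr // ltW.
have [x xI Hx] := exists_weighted_sum_inv_sqrt_le q al l0 s0 w0.
pose g j := (Num.sqrt (`|x - q j| + s))^-1.
have us0 j : 0 < `|x - q j| + s by rewrite ltr_wpDl.
have g0 j : 0 < g j by rewrite invr_gt0 sqrtr_gt0.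
have g2 j : (g j) ^+ 2 = (`|x - q j| + s)^-1 by rewrite exprVn sqr_sqrtr // ltW.
have {}Hx : \sum_(j < k) w j * g j <= 8 / Num.sqrt l.
  apply: (le_trans Hx); rewrite -[8 / _]/(8 * _).
  have -> : 8 / Num.sqrt l = 4 / Num.sqrt l * 2 by ring.
  by rewrite ler_wpM2l // divr_ge0 // ltW.
have wg0 j : 0 <= w j * g j by rewrite mulr_ge0 // ltW.
have gap j : s <= `|x - q j|.
  have h : n%:R^-1 * g j <= 8 / Num.sqrt l.
    apply: le_trans Hx; rewrite (bigD1 j) //=.
    rewrite -[leLHS]addr0 lerD ?sumr_ge0 // ler_wpM2r ?(ltW (g0 _)) //.
    by rewrite lerDl divr_ge0.
  have h3 : (n%:R^-1 * g j) ^+ 2 <= (8 / Num.sqrt l) ^+ 2.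
    by rewrite ler_sqr ?nnegrE // ?mulr_ge0 ?divr_ge0 ?invr_ge0 // ltW.
  have E1 : (n%:R^-1 * g j) ^+ 2 = (n%:R ^+ 2 * (`|x - q j| + s))^-1.
    by rewrite exprMn g2 exprVn [RHS]invfM.
  have E2 : (8 / Num.sqrt l) ^+ 2 = (l / 64)^-1.
    by rewrite expr_div_n l2 invf_div; congr (_ / _); ring.
  move: h3; rewrite E1 E2 lef_pV2 ?posrE ?mulr_gt0 ?exprn_gt0 ?divr_gt0 //.
  move=> h4.
  have hs : s = l / 128 / n%:R ^+ 2 by rewrite /s; field; rewrite gt_eqF.
  have : l / 64 / n%:R ^+ 2 <= `|x - q j| + s.
    by rewrite ler_pdivrMr ?exprn_gt0 // [leRHS]mulrC.
  have -> : l / 64 / n%:R ^+ 2 = 2 * s by rewrite hs; field; rewrite gt_eqF.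
  lra.
exists x; split=> //.
have d0 j : 0 < `|x - q j| by apply: lt_le_trans (gap j).
have key j : ln (l / 128) - ln `|x - q j| <= 2 * (Num.sqrt l / 8 * g j - 1).
  set y := Num.sqrt l / 8 * g j.
  have y0 : 0 < y by rewrite mulr_gt0 // divr_gt0.
  have y2 : y ^+ 2 = l / 64 / (`|x - q j| + s).
    by rewrite exprMn g2 expr_div_n l2; field; rewrite gt_eqF.
  have l1 : ln y <= y - 1.
    have -> : y = 1 + (y - 1) by ring.
    by rewrite (le_trans (le_ln1Dx _)) //; lra.
  have : ln (l / 128 / `|x - q j|) <= ln (y ^+ 2).
    rewrite ler_ln ?posrE ?exprn_gt0 // ?divr_gt0 // y2.
    have -> : l / 128 / `|x - q j| = l / 64 / (2 * `|x - q j|).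
      by field; rewrite gt_eqF.
    rewrite ler_pM2l ?divr_gt0 // lef_pV2 ?posrE // ?mulr_gt0 //.
    by have := gap j; lra.
  rewrite [ln (_ / `|_|)]ln_div ?posrE ?divr_gt0 // lnXn // mulr2n; lra.
rewrite -subr_le0 -sumrB.
apply: le_trans; first by apply: ler_sum => j _; exact: key.
rewrite -mulr_sumr pmulr_rle0 // sumrB -mulr_sumr cE mulr1 subr_le0.
rewrite mulrAC ler_pdivrMr // mulrC -ler_pdivlMr //.
have [c00|cn] := eqVneq c 0.
  have : \sum_(i < k | N i) g i = 0.
    apply: big_pred0 => j; apply/negbTE/negP => Nj.
    move/eqP: c00; rewrite pnatr_eq0 => /eqP /card0_eq /(_ j).
    by rewrite inE Nj.
  by move=> ->; rewrite c00 mul0r mul0r.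
have cp : 0 < c by rewrite lt_def cn.
rewrite -mulrA -ler_pdivrMl //.
apply: le_trans Hx; rewrite mulr_sumr [leLHS]big_mkcond; apply: ler_sum => j _.
have := wg0 j; rewrite /w; case: (N j) => //= _.
by rewrite ler_wpM2r ?(ltW (g0 _)) // mul1r lerDr invr_ge0 ltW.
Qed.

(** For |c - c'| large with respect to l this is the least value of ln|p - p'|
when both points move by at most l.  For neighbouring points no such bound
holds for each pair; ln(l/128) is what [separating_point] guarantees on
average. *)
Definition trunc_ln (R : realType) (l : R) (c c' : R * R) : R :=
  if cdist c c' < 4 * l then ln (l / 128) else ln (cdist c c' - 2 * l).

Definition box (R : realType) (a1 b1 a2 b2 : R) (z : R * R) : Prop :=
  a1 <= z.1 <= b1 /\ a2 <= z.2 <= b2.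

(** The points are placed one after the other.  The k-th one moves only along
the first coordinate, in an interval of length l that contains c_k and stays in
the rectangle, to a point given by [separating_point] for the first coordinates
of the points already placed; the average bound is required only for the j
with c_j near c_k, and the other pairs are controlled by the triangle
inequality. *)
Lemma spread_points (R : realType) (a1 b1 a2 b2 l : R) (n : nat) (c : nat -> R * R) :
  0 < l -> l <= b1 - a1 -> (forall k, (k < n)%N -> box a1 b1 a2 b2 (c k)) ->
  exists p : nat -> R * R, forall k, (k < n)%N ->
  [/\ box a1 b1 a2 b2 (p k), cdist (p k) (c k) <= l,
      forall j, (j < k)%N -> l / (128 * n%:R ^+ 2) <= cdist (p k) (p j) &
      \sum_(j < k) trunc_ln l (c k) (c j) <= \sum_(j < k) ln (cdist (p k) (p j))].
Proof.
move=> l0 lb cH.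
suff gen m : (m <= n)%N -> exists p : nat -> R * R, forall k, (k < m)%N ->
  [/\ box a1 b1 a2 b2 (p k), cdist (p k) (c k) <= l,
      forall j, (j < k)%N -> l / (128 * n%:R ^+ 2) <= cdist (p k) (p j) &
      \sum_(j < k) trunc_ln l (c k) (c j) <= \sum_(j < k) ln (cdist (p k) (p j))].
  exact: gen.
elim: m => [|m IH] mn; first by exists c => k.
have [p Hp] := IH (ltnW mn).
pose N (j : 'I_m) := cdist (c m) (c j) < 4 * l.
(* Left end of an interval of length l inside [a1, b1] containing the first
   coordinate of c_m. *)
pose al := Num.min (c m).1 (b1 - l).
have [/andP[c1 c2] c3] := cH m mn.
have n0 : (0 < n)%N by apply: leq_trans mn.
have [x [xI xg xN]] := separating_point (fun j : 'I_m => (p j).1) N al l0 n0 (ltnW mn).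
have al1 : al <= (c m).1 by rewrite ge_min lexx.
have al2 : al <= b1 - l by rewrite ge_min lexx orbT.
have al3 : a1 <= al by rewrite le_min c1 /=; lra.
have al4 : (c m).1 <= al + l.
  by rewrite -lerBlDr le_min; apply/andP; split; lra.
have {xI} /andP[x1 x2] := xI.
pose z := (x, (c m).2).
have zc : cdist z (c m) <= l.
  apply: (le_trans (cdist_le_normD _ _)); rewrite /= subrr normr0 addr0.
  by rewrite ler_norml; lra.
exists (fun j => if j == m then z else p j) => k; rewrite ltnS leq_eqVlt.
have d0 : 0 < l / (128 * n%:R ^+ 2).
  by rewrite divr_gt0 // mulr_gt0 // exprn_gt0 // ltr0n.
have zg (j : 'I_m) : l / (128 * n%:R ^+ 2) <= cdist z (p j).
  by apply: (le_trans (xg j)); exact: (ler_norm1_cdist z).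
case/predU1P => [->|km]; last first.
  rewrite ltn_eqF //; have [h1 h2 h3 h4] := Hp k km; split => // [j jk|].
    by rewrite ltn_eqF ?(ltn_trans jk) //; apply: h3.
  rewrite (le_trans h4) // le_eqVlt; apply/orP; left; apply/eqP.
  by apply: eq_bigr => j _; rewrite ltn_eqF // (ltn_trans _ km).
rewrite eqxx; split => // [|j jm|].
- by split => //=; apply/andP; split; lra.
- by rewrite ltn_eqF //; exact: (zg (Ordinal jm)).
have -> : \sum_(j < m) ln (cdist z (if j == m :> nat then z else p j)) =
          \sum_(j < m) ln (cdist z (p j)).
  by apply: eq_bigr => j _; rewrite ltn_eqF.
rewrite (bigID N) /= [leRHS](bigID N) /=; apply: lerD.
  have -> : \sum_(i < m | N i) trunc_ln l (c m) (c i) = \sum_(i < m | N i) ln (l / 128).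
    by apply: eq_bigr => j Nj; rewrite /trunc_ln ifT.
  apply: (le_trans xN); apply: ler_sum => j _.
  rewrite ler_ln ?posrE ?(ler_norm1_cdist z) //; first exact: lt_le_trans (xg j).
  exact: lt_le_trans (zg j).
apply: ler_sum => j Nj; rewrite /trunc_ln ifN //.
have {}Nj : 4 * l <= cdist (c m) (c j) by rewrite leNgt.
have [_ h _ _] := Hp j (ltn_ord j).
have t1 := cdist_triangle z (c m) (c j).
have t2 := cdist_triangle (p j) z (c j).
rewrite cdistC in zc; clear -zc Nj h t1 t2 l0.
by rewrite ler_ln ?posrE //; lra.
Qed.

(** * Integral bounds and products of measures *)

Section constant_bounds.
Import HBNNSimple.

(** From the definition of the integral of a nonnegative function as a supremum
over simple functions, hence valid also for integrands of unknown
measurability, such as those restricted to the tuples that enter J. *)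
Lemma ge0_integral_ge_cst d (T : measurableType d) (R : realType)
    (mu : {measure set T -> \bar R}) (D A : set T) (f : T -> \bar R) (m : R) :
  0 <= m -> measurable A -> A `<=` D -> (forall x, D x -> (0 <= f x)%E) ->
  (forall x, A x -> (m%:E <= f x)%E) ->
  (m%:E * mu A <= \int[mu]_(x in D) f x)%E.
Proof.
move=> m0 mA AD f0 fm; rewrite integral_mkcond ge0_integralTE; last first.
  exact: erestrict_ge0.
apply: ereal_sup_ubound => /=.
exists (scale_nnsfun (indic_nnsfun R mA) m0).
  move=> x; rewrite (_ : scale_nnsfun _ _ x = m * \1_A x) // indicE /patch.
  have [xA|xA] := boolP (x \in A).
    rewrite mulr1 mem_set; last by apply: AD; exact: set_mem.
    by apply: fm; exact: set_mem.
  by rewrite mulr0; case: ifPn => // xD; apply: f0; exact: set_mem.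
by rewrite (sintegralrM mu m (indic_nnsfun R mA)) sintegral_indic.
Qed.

Lemma ge0_integral_le_cst d (T : measurableType d) (R : realType)
    (mu : {measure set T -> \bar R}) (D : set T) (f : T -> \bar R) (M : R) :
  0 <= M -> (forall x, D x -> (0 <= f x)%E) ->
  (forall x, D x -> (f x <= M%:E)%E) ->
  (\int[mu]_(x in D) f x <= M%:E * mu setT)%E.
Proof.
move=> M0 f0 fM; rewrite integral_mkcond ge0_integralTE; last first.
  exact: erestrict_ge0.
apply: ge_ereal_sup => /= _ [h hf <-].
have -> : (M%:E * mu setT = sintegral mu (cst_nnsfun T (NngNum M0)))%E.
  have := sintegralrM mu M (indic_nnsfun R (@measurableT _ T)).
  rewrite sintegral_indic => <-; apply: eq_sintegral => x.
  rewrite (_ : (cst M \* _)%R x = M * \1_setT x) // indicE in_setT mulr1 //.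
apply: le_sintegral => x /=; rewrite -lee_fin; apply: (le_trans (hf x)).
rewrite /patch; case: ifPn => xD; last by rewrite lee_fin.
by apply: fM; exact: set_mem.
Qed.

End constant_bounds.

Section tuple_boxes.
Context d (T : measurableType d) (R : realType).
Variable tau : {sigma_finite_measure set T -> \bar R}.

Definition tuple_box (n : nat) (B : nat -> set T) : set (n.-tuple T) :=
  [set q | forall i : 'I_n, B i (tnth q i)].

Lemma measurable_tuple_box n (B : nat -> set T) :
  (forall i, measurable (B i)) -> measurable (@tuple_box n B).
Proof.
move=> mB; elim: n B mB => [|n IH] B mB.
  rewrite (_ : tuple_box B = setT) //; apply/seteqP; split => // q _ [] //.
rewrite (_ : tuple_box B = ((fun q : n.+1.-tuple T => tnth q ord0) @^-1` (B 0%N)) `&`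
  ((fun q : n.+1.-tuple T => [tuple of behead q]) @^-1` (@tuple_box n (B \o S)))).
  apply: measurableI; rewrite -[X in measurable X]setTI.
    exact: measurable_tnth.
  by apply: measurable_behead => //; apply: IH => i; apply: mB.
apply/seteqP; split => q /=.
  move=> qB; split; first exact: (qB ord0).
  move=> i /=; have := qB (lift ord0 i).
  by case/tupleP: q {qB} => x q; by rewrite tnthS (tnth_nth x) /= [in X in _ -> X](tnth_nth x); apply.
case/tupleP: q => x q [qB0 qB] i.
case: (unliftP ord0 i) => [j ->|->]; last exact: qB0.
have := qB j; by rewrite tnthS (tnth_nth x) /= [in X in _ -> X](tnth_nth x); apply.
Qed.

Lemma tuple_measure_box n (B : nat -> set T) : (forall i, measurable (B i)) ->
  tuple_measure tau n (tuple_box B) = (\prod_(i < n) tau (B i))%E.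
Proof.
elim: n B => [|n IH] B mB /=.
  rewrite big_ord0 diracE mem_set //; by case.
rewrite /tuple_measureS /pushforward big_ord_recl.
rewrite (_ : _ @^-1` _ = (@tuple_box n (B \o S)) `*` B 0%N).
  rewrite product_measure1E //; last by apply: measurable_tuple_box => i; apply: mB.
  rewrite muleC; congr (_ * _)%E; apply: (IH (B \o S)) => i; apply: mB.
apply/seteqP; split => -[q x] /=.
  move=> qB; split; last by have := qB ord0; rewrite tnth0.
  by move=> i; have := qB (lift ord0 i); rewrite tnthS.
move=> [qB xB] i; case: (unliftP ord0 i) => [j ->|->]; rewrite ?tnth0 // tnthS.
exact: qB.
Qed.

Lemma tuple_measure_setT n :
  tuple_measure tau n setT = (tau setT ^+ n)%E.
Proof.
have -> : [set: n.-tuple T] = tuple_box (fun=> setT) by apply/seteqP; split.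
rewrite tuple_measure_box //; elim: n => [|n IH]; first by rewrite big_ord0.
by rewrite big_ord_recl expeS IH.
Qed.
End tuple_boxes.

(** * The logarithm of the Vandermonde product *)

Section vandermonde.
Variable R : realType.
Implicit Types (phi : R * R -> R).

Lemma cmodM (x y : R[i]) : cmod (x * y) = cmod x * cmod y.
Proof. exact: ComplexField.Normc.normcM. Qed.

Lemma cmod1 : cmod (1 : R[i]) = 1.
Proof. exact: ComplexField.Normc.normc1. Qed.

Lemma cmod_ge0 (w : R[i]) : 0 <= cmod w.
Proof. by case: w => x y; exact: sqrtr_ge0. Qed.

Lemma cmod_real (x : R) : cmod x%:C%C = `|x|.
Proof. by rewrite /cmod /= expr0n /= addr0 sqrtr_sqr. Qed.

Lemma cmod_prod I (r : seq I) (P : pred I) (F : I -> R[i]) :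
  cmod (\prod_(i <- r | P i) F i) = \prod_(i <- r | P i) cmod (F i).
Proof. exact: (big_morph _ cmodM cmod1). Qed.

Lemma cmod_wVDM phi d (lam : d.-tuple (R * R)) :
  cmod (wVDM phi lam) =
    (\prod_(i < d) \prod_(j < d | (i < j)%N) cdist (tnth lam i) (tnth lam j)) *
    \prod_(i < d) `|phi (tnth lam i)| ^+ d.
Proof.
rewrite /wVDM cmodM !cmod_prod; congr (_ * _).
  by apply: eq_bigr => i _; rewrite cmod_prod.
apply: eq_bigr => i _; elim: d {lam i} (tnth lam i) => [|d IH] x.
  by rewrite !expr0 cmod1.
by rewrite !exprS cmodM IH cmod_real.
Qed.

(** The Vandermonde product runs over i < j, while the points are placed in
order, each one after those with smaller index. *)
Lemma sum_upper_pairs n (F : 'I_n -> 'I_n -> R) : (forall i j, F i j = F j i) ->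
  \sum_(i < n) \sum_(j < n | (i < j)%N) F i j =
  \sum_(i < n) \sum_(j < n | (j < i)%N) F i j.
Proof.
move=> Fs; rewrite (exchange_big_dep xpredT) //=; apply: eq_bigr => i _.
by apply: eq_bigr => j _; rewrite Fs.
Qed.

Lemma sum_pairs n (F : 'I_n -> 'I_n -> R) : (forall i j, F i j = F j i) ->
  \sum_(i < n) \sum_(j < n) F i j =
  2 * (\sum_(i < n) \sum_(j < n | (j < i)%N) F i j) + \sum_(i < n) F i i.
Proof.
move=> Fs; rewrite mulr_natl mulr2n -{1}sum_upper_pairs // -!big_split /=.
apply: eq_bigr => i _.
rewrite (bigID (fun j : 'I_n => (i < j)%N)) /= -addrA; congr (_ + _).
rewrite (bigID (fun j : 'I_n => (j < i)%N)) /=; congr (_ + _).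
  by apply: eq_bigl => j; rewrite -leqNgt andb_idl // => /ltnW.
rewrite (big_pred1 i) // => j /=.
by rewrite -!leqNgt -eqn_leq.
Qed.

Lemma sum_off_diag n (F : 'I_n -> 'I_n -> R) : (forall i j, F i j = F j i) ->
  \sum_(i < n) \sum_(j < n | j != i) F i j =
  2 * (\sum_(i < n) \sum_(j < n | (j < i)%N) F i j).
Proof.
move=> Fs; apply: (addIr (\sum_(i < n) F i i)); rewrite -sum_pairs // -big_split /=.
by apply: eq_bigr => i _; rewrite [RHS](bigD1 i) //= addrC.
Qed.

Lemma ln_prod (I : eqType) (r : seq I) (P : pred I) (F : I -> R) :
  (forall i, P i -> 0 < F i) ->
  ln (\prod_(i <- r | P i) F i) = \sum_(i <- r | P i) ln (F i).
Proof.
move=> F0; have [] // : ln (\prod_(i <- r | P i) F i) = \sum_(i <- r | P i) ln (F i)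
  /\ 0 < \prod_(i <- r | P i) F i.
elim: r => [|x r [IH1 IH2]]; first by rewrite !big_nil ln1.
rewrite !big_cons; case: ifPn => // Px.
by split; rewrite ?mulr_gt0 ?F0 // lnM ?posrE ?F0 // IH1.
Qed.

Lemma ln_cmod_wVDM phi d (lam : d.-tuple (R * R)) :
  (forall i j, i != j -> 0 < cdist (tnth lam i) (tnth lam j)) ->
  (forall i, 0 < phi (tnth lam i)) ->
  0 < cmod (wVDM phi lam) /\
  ln (cmod (wVDM phi lam) ^+ 2) =
    2 * (\sum_(i < d) \sum_(j < d | (j < i)%N) ln (cdist (tnth lam i) (tnth lam j)))
    + 2 * (d%:R * \sum_(i < d) ln (phi (tnth lam i))).
Proof.
move=> dl p0; rewrite cmod_wVDM.
have h1 (i j : 'I_d) : (i < j)%N -> 0 < cdist (tnth lam i) (tnth lam j).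
  by move=> ij; apply: dl; rewrite neq_ltn ij.
have h2 (i : 'I_d) : 0 < \prod_(j < d | (i < j)%N) cdist (tnth lam i) (tnth lam j).
  by apply: prodr_gt0 => j; exact: h1.
have h3 (i : 'I_d) : 0 < `|phi (tnth lam i)| ^+ d.
  by rewrite exprn_gt0 // normr_gt0 gt_eqF.
have P1 : 0 < \prod_(i < d) \prod_(j < d | (i < j)%N) cdist (tnth lam i) (tnth lam j).
  by apply: prodr_gt0.
have P2 : 0 < \prod_(i < d) `|phi (tnth lam i)| ^+ d by apply: prodr_gt0.
split; first exact: mulr_gt0.
rewrite lnXn ?mulr_gt0 // -[_ *+ 2]mulr_natl lnM // mulrDr; congr (2 * _ + 2 * _).
  rewrite ln_prod // -sum_upper_pairs; last by move=> i j; rewrite cdistC.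
  by apply: eq_bigr => i _; rewrite ln_prod // => j; exact: h1.
rewrite ln_prod // mulr_sumr; apply: eq_bigr => i _.
by rewrite lnXn ?normr_gt0 ?gt_eqF // gtr0_norm // mulr_natl.
Qed.

Lemma wVDM_eq0 phi d (lam : d.-tuple (R * R)) i j : i != j ->
  cdist (tnth lam i) (tnth lam j) = 0 -> cmod (wVDM phi lam) = 0.
Proof.
wlog ij : i j / (i < j)%N => [H ij d0|_ d0].
  move: (ij); rewrite neq_ltn => /orP[] h; first exact: (H i j).
  by apply: (H j i h); [rewrite eq_sym | rewrite cdistC].
by rewrite cmod_wVDM (bigD1 i) //= (bigD1 j) //= d0 !mul0r.
Qed.

End vandermonde.

(** * Rounding finitely supported probability measures *)

(** Greedy choice: the counts after n steps have total n < n + 1, so some i is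
below its share for n + 1 steps, and it is served next.  Upper bounds n m_i + 1
for all counts give lower bounds because the totals agree. *)
Lemma balanced_assignment (R : realType) (I : finType) (m : I -> R) (n : nat) :
  (forall i, 0 <= m i) -> \sum_i m i = 1 ->
  exists s : nat -> I,
    forall i, `|\sum_(k < n) (s k == i)%:R - n%:R * m i| <= #|I|%:R.
Proof.
move=> m0 m1.
have c1 (s : nat -> I) : \sum_i \sum_(k < n) (s k == i)%:R = n%:R :> R.
  rewrite exchange_big /= (eq_bigr (fun=> 1)) ?sumr_const ?card_ord // => k _.
  by rewrite (bigD1 (s k)) //= eqxx big1 ?addr0 // => i /negbTE; rewrite eq_sym => ->.
suff [s sm] : exists s : nat -> I,
    forall i, \sum_(k < n) (s k == i)%:R <= n%:R * m i + 1.
  have I1 : 1 <= #|I|%:R :> R.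
    by rewrite ler1n; apply/card_gt0P; exists (s 0%N).
  exists s => i; rewrite ler_norml; apply/andP; split; last by have := sm i; lra.
  have : \sum_(j | j != i) \sum_(k < n) (s k == j)%:R
      <= \sum_(j | j != i) (n%:R * m j + 1) by apply: ler_sum.
  rewrite big_split /= -mulr_sumr.
  have mi : m i + \sum_(j | j != i) m j = 1 by rewrite -m1 [RHS](bigD1 i).
  have cI : 1 + \sum_(j : I | j != i) 1 = #|I|%:R :> R.
    have -> : (#|I|%:R : R) = \sum_(j : I) 1 by rewrite sumr_const.
    by rewrite [RHS](bigD1 i).
  have -> : \sum_(j | j != i) m j = 1 - m i by lra.
  have := c1 s; rewrite (bigD1 i) //=.
  set A := \sum_(k < n) _; set B := \sum_(j | _) \sum_(k < n) _.
  by move=> AB h; nra.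
elim: n {c1} => [|n [s IH]].
  have [i _] : exists i : I, True.
    apply: contrapT => H; move: m1; rewrite big1 => [/esym/eqP|i]; first by rewrite oner_eq0.
    by exfalso; apply: H; exists i.
  by exists (fun=> i) => j; rewrite big_ord0 mul0r add0r.
have [i hi] : exists i, \sum_(k < n) (s k == i)%:R < n.+1%:R * m i.
  apply: contrapT => H.
  have : \sum_i n.+1%:R * m i <= \sum_i \sum_(k < n) (s k == i)%:R.
    by apply: ler_sum => i _; rewrite leNgt; apply/negP => h; apply: H; exists i.
  rewrite -mulr_sumr m1 mulr1 exchange_big /= (eq_bigr (fun=> 1)); last first.
    move=> k _.
    by rewrite (bigD1 (s k)) //= eqxx big1 ?addr0 // => i /negbTE; rewrite eq_sym => ->.
  by rewrite sumr_const card_ord ler_nat ltnn.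
exists (fun k => if k == n then i else s k) => j.
rewrite big_ord_recr /= eqxx.
rewrite (eq_bigr (fun k : 'I_n => (s k == j)%:R)); last first.
  by move=> k _; rewrite ltn_eqF.
case: eqVneq => [<-|_].
  by rewrite lerD2r ltW.
have := IH j; have := m0 j; rewrite -natr1 mulrDl mul1r /= addr0; lra.
Qed.

Lemma assignment_sum (R : realType) (I : finType) (n : nat) (s : nat -> I) (f : I -> R) :
  \sum_(k < n) f (s k) = \sum_i (\sum_(k < n) (s k == i)%:R) * f i.
Proof.
under [RHS]eq_bigr do rewrite mulr_suml.
rewrite exchange_big /=; apply: eq_bigr => k _.
rewrite (bigD1 (s k)) //= eqxx mul1r big1 ?addr0 // => i /negbTE.
by rewrite eq_sym => ->; rewrite mul0r.
Qed.

(** One assignment serves all functions bounded by K, since only the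
frequencies enter: they differ from m_i by at most |I| / n. *)
Lemma weighted_sum_approx (R : realType) (I : finType) (m : I -> R) (e : R) :
  (forall i, 0 <= m i) -> \sum_i m i = 1 -> 0 < e -> forall (K : R),
  exists N0 : nat, forall n, (N0 <= n)%N -> exists s : nat -> I,
    (forall f : I -> R, (forall i, `|f i| <= K) ->
       `|n%:R^-1 * (\sum_(k < n) f (s k)) - \sum_i m i * f i| <= e) /\
    (forall F : I -> I -> R, (forall i j, `|F i j| <= K) ->
       \sum_(k < n) \sum_(l < n) F (s k) (s l)
         <= n%:R ^+ 2 * (\sum_i \sum_j m i * m j * F i j + e)).
Proof.
move=> m0 m1 e0 K.
pose c : R := #|I|%:R.
have c0 : 0 <= c by rewrite ler0n.
pose K1 : R := `|K| + 1.
have K10 : 0 < K1 by rewrite ltr_wpDl.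
pose L : R := 2 * c ^+ 3 * K1 + c ^+ 2 * K1 + 1.
have L0 : 0 < L.
  by rewrite ltr_wpDl // addr_ge0 // !mulr_ge0 // ?exprn_ge0 // ltW.
exists (Num.trunc (L / e)).+1 => n hn.
have nL : L / e <= n%:R.
  apply: ltW; apply: lt_le_trans (truncnS_gt _) _.
  by rewrite ler_nat.
have n0 : 0 < n%:R :> R by apply: lt_le_trans nL; rewrite divr_gt0.
have nn0 : n%:R != 0 :> R by rewrite gt_eqF.
have {}nL : L / n%:R <= e.
  by rewrite ler_pdivrMr // mulrC -ler_pdivrMr.
have [s sP] := balanced_assignment n m0 m1.
pose v i : R := n%:R^-1 * \sum_(k < n) (s k == i)%:R.
pose d : R := c / n%:R.
have d0 : 0 <= d by rewrite divr_ge0 // ltW.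
have vm i : `|v i - m i| <= d.
  have -> : v i - m i = n%:R^-1 * (\sum_(k < n) (s k == i)%:R - n%:R * m i).
    by rewrite /v mulrBr mulKf.
  by rewrite normrM ger0_norm ?invr_ge0 ?ler0n // mulrC ler_wpM2r // invr_ge0 ler0n.
have v0 i : 0 <= v i.
  by rewrite mulr_ge0 ?invr_ge0 ?ler0n // sumr_ge0.
have v1 i : v i <= 1.
  rewrite /v mulrC ler_pdivrMr // mul1r.
  apply: (@le_trans _ _ (\sum_(k < n) 1)); last by rewrite sumr_const card_ord.
  by apply: ler_sum => k _; case: (_ == _).
have mle1 i : m i <= 1.
  by rewrite -m1 (bigD1 i) //= lerDl sumr_ge0.
have sumc (y : R) : \sum_(i : I) y = c * y by rewrite sumr_const -[_ *+ _]mulr_natl.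
exists s; split => [f fK|F FK].
  have -> : n%:R^-1 * (\sum_(k < n) f (s k)) = \sum_i v i * f i.
    by rewrite (assignment_sum n s f) mulr_sumr; apply: eq_bigr => i _; rewrite mulrA.
  rewrite -sumrB; apply: (le_trans (ler_norm_sum _ _ _)).
  apply: (@le_trans _ _ (\sum_(i : I) d * K1)).
    apply: ler_sum => i _; rewrite -mulrBl normrM ler_pM //.
    by apply: (le_trans (fK i)); rewrite (le_trans (ler_norm K)) // lerDl.
  rewrite sumc; apply: le_trans nL; rewrite /d /L.
  rewrite ler_pdivlMr //.
  have -> : c * (c / n%:R * K1) * n%:R = c ^+ 2 * K1 by field.
  have : 0 <= 2 * c ^+ 3 * K1 by rewrite !mulr_ge0 ?exprn_ge0 // ltW.
  lra.
have -> : \sum_(k < n) \sum_(l < n) F (s k) (s l) =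
    n%:R ^+ 2 * \sum_i \sum_j v i * v j * F i j.
  rewrite (assignment_sum n s (fun i => \sum_(l < n) F i (s l))).
  rewrite mulr_sumr; apply: eq_bigr => i _.
  rewrite (assignment_sum n s (F i)) !mulr_sumr; apply: eq_bigr => j _.
  by rewrite /v; field.
rewrite ler_wpM2l ?exprn_ge0 ?ler0n // -lerBlDl -sumrB.
apply: (@le_trans _ _ (\sum_(i : I) \sum_(j : I) (2 * d) * K1)).
  apply: ler_sum => i _; rewrite -sumrB; apply: ler_sum => j _.
  rewrite -mulrBl; apply: (le_trans (ler_norm _)); rewrite normrM.
  have -> : v i * v j - m i * m j = (v i - m i) * v j + m i * (v j - m j) by ring.
  rewrite ler_pM //; last first.
    by apply: (le_trans (FK i j)); rewrite (le_trans (ler_norm K)) // lerDl.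
  apply: (le_trans (ler_normD _ _)); rewrite (normrM (_ - _)) (normrM (m i)).
  rewrite (ger0_norm (v0 j)) (ger0_norm (m0 i)).
  have := vm i; have := vm j; have := normr_ge0 (v i - m i).
  have := normr_ge0 (v j - m j); have := v1 j; have := v0 j; have := m0 i; have := mle1 i.
  nra.
rewrite !sumc; apply: le_trans nL; rewrite ler_pdivlMr // /d /L.
have -> : c * (c * (2 * (c / n%:R) * K1)) * n%:R = 2 * c ^+ 3 * K1 by field.
have : 0 <= c ^+ 2 * K1 by rewrite !mulr_ge0 ?exprn_ge0 // ltW.
lra.
Qed.

(** Absorbs the terms of order n ln n in the exponent: the logarithm of the
masses of the discs, and the energy of nearby points at scale 1/n^2. *)
Lemma log_sublinear (R : realType) (a b e : R) : 0 <= b -> 0 < e ->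
  exists N0 : nat, forall n, (N0 <= n)%N -> a + b * ln n%:R <= e * n%:R.
Proof.
move=> b0 e0.
pose th := e / (2 * (b + 1)).
have b1 : 0 < b + 1 by lra.
have th0 : 0 < th by rewrite divr_gt0 // mulr_gt0.
pose X := 2 * (a - b * ln th) / e.
exists (Num.trunc X).+1 => n hn.
have nX : X <= n%:R.
  apply: ltW; apply: lt_le_trans (truncnS_gt _) _.
  by rewrite ler_nat.
have n0 : 0 < n%:R :> R by rewrite ltr0n (leq_trans _ hn).
have h1 : ln n%:R <= th * n%:R - ln th.
  rewrite lerBrDr -lnM ?posrE // mulrC; apply: ltW; apply: ln_sublinear.
  exact: mulr_gt0.
have h2 : 2 * (a - b * ln th) <= e * n%:R.
  by move: nX; rewrite /X ler_pdivrMr // [_ * e]mulrC.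
have h3 : b * (th * n%:R) <= e / 2 * n%:R.
  rewrite mulrA ler_pM2r // /th.
  have -> : b * (e / (2 * (b + 1))) = (e / 2) * (b / (b + 1)) by field; lra.
  by rewrite ler_piMr ?divr_ge0 ?(ltW e0) // ler_pdivrMr // mul1r lerDl.
have h4 : b * ln n%:R <= b * (th * n%:R - ln th) by rewrite ler_wpM2l.
lra.
Qed.

(** * Moments of empirical measures *)

Section measurability.
Variable R : realType.

Lemma measurable_fun_cdist : measurable_fun setT
  (fun p : (R * R) * (R * R) => cdist p.1 p.2).
Proof.
rewrite (_ : (fun p => _) = Num.sqrt \o (fun p : (R * R) * (R * R) =>
  (p.1.1 - p.2.1) ^+ 2 + (p.1.2 - p.2.2) ^+ 2)); last first.
  by apply/funext => p; rewrite cdistE.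
apply: measurableT_comp.
  apply: continuous_measurable_fun; exact: sqrt_continuous.
by apply: measurable_funD; apply: measurable_funX; apply: measurable_funB;
  repeat first [apply: measurable_fst | apply: measurable_snd | apply: measurableT_comp].
Qed.

Lemma measurable_fun_cdistl (t : R * R) : measurable_fun setT (fun z => cdist z t).
Proof.
have := @measurableT_comp _ _ _ _ _ _ _ _ (fun z : R * R => (z, t)) measurable_fun_cdist.
by apply; apply: measurable_fun_pair.
Qed.

Lemma measurable_disc (z0 : R * R) (r : R) : measurable (disc z0 r).
Proof.
rewrite -[disc _ _]setTI.
rewrite (_ : disc z0 r = (fun z => cdist z z0) @^-1` `]-oo, r[).
  exact: measurable_fun_cdistl.
by apply/seteqP; split => z; rewrite /= /disc /= in_itv.
Qed.

Definition monomial (n1 n2 : nat) (z : R * R) : R := z.1 ^+ n1 * z.2 ^+ n2.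

Lemma measurable_monomial n1 n2 : measurable_fun setT (monomial n1 n2).
Proof. by apply: measurable_funM; apply: measurable_funX. Qed.

Lemma measurable_box (a1 b1 a2 b2 : R) :
  measurable (`[a1, b1] `*` `[a2, b2] : set (R * R)).
Proof. exact: measurableX. Qed.

Lemma boxP (a1 b1 a2 b2 : R) (z : R * R) :
  (`[a1, b1] `*` `[a2, b2]) z <-> box a1 b1 a2 b2 z.
Proof. by rewrite /setX /= !in_itv. Qed.

Variable H : set (R * R).
Hypothesis mH : measurable H.

Lemma ge0_integral_kappa d (lam : d.-tuple (R * R)) (f : R * R -> \bar R) :
  measurable_fun setT f -> (forall z, 0 <= f z)%E -> (forall i, H (tnth lam i)) ->
  (\int[kappa lam]_(z in H) f z = (d%:R^-1)%:E * \sum_(i < d) f (tnth lam i))%E.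
Proof.
move=> mf f0 lH.
have mfH : measurable_fun H f by apply: measurable_funTS.
rewrite /kappa ge0_integral_mscale // ge0_integral_measure_sum //; congr (_ * _)%E.
apply: eq_bigr => i _; rewrite integral_dirac //.
rewrite -(tnth_nth (0, 0)) diracE mem_set ?mul1e //; exact: lH.
Qed.

Lemma Rintegral_kappa d (lam : d.-tuple (R * R)) (f : R * R -> R) :
  measurable_fun setT f -> (forall i, H (tnth lam i)) ->
  \int[kappa lam]_(z in H) f z = d%:R^-1 * \sum_(i < d) f (tnth lam i).
Proof.
move=> mf lH; rewrite /Rintegral integralE.
rewrite !ge0_integral_kappa //; first last.
- exact/measurable_funepos/measurable_EFinP.
- exact/measurable_funeneg/measurable_EFinP.
rewrite (eq_bigr (fun i => (Num.max (f (tnth lam i)) 0)%:E)); last first.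
  by move=> i _; rewrite funeposE EFin_max.
rewrite [X in (_ - _ * X)%E](eq_bigr (fun i => (Num.max (- f (tnth lam i)) 0)%:E)); last first.
  by move=> i _; rewrite funenegE EFin_max.
rewrite !sumEFin -!EFinM -EFinB /= -mulrBr -sumrB; congr (_ * _).
apply: eq_bigr => i _; rewrite /Num.max; case: ltP => h1; case: ltP => h2; lra.
Qed.

Lemma prob_on_kappa d (lam : d.-tuple (R * R)) : (0 < d)%N ->
  (forall i, H (tnth lam i)) -> prob_on H (kappa lam).
Proof.
move=> d0 lH; rewrite /prob_on /kappa /= /mscale /= /msum /=.
split.
  rewrite (eq_bigr (fun=> 1%E)); last by move=> i _; rewrite diracE in_setT.
  by rewrite sumEFin -EFinM sumr_const card_ord mulVf // pnatr_eq0 -lt0n.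
rewrite big1 ?mule0 // => i _; rewrite -(tnth_nth (0, 0)) diracE memNset //.
by move=> /(_ (lH i)).
Qed.
End measurability.

(** * Lower bound from a finitely supported measure *)

Lemma expr_le_prode (R : realType) (x : R) n (F : 'I_n -> \bar R) : 0 <= x ->
  (forall i, x%:E <= F i)%E -> ((x ^+ n)%:E <= \prod_(i < n) F i)%E.
Proof.
move=> x0; elim: n F => [|n IH] F xF; first by rewrite big_ord0 expr0.
by rewrite big_ord_recl exprS EFinM lee_pmul ?lee_fin ?exprn_ge0 // IH.
Qed.

(** The pair interaction C0 - ln|c - c'| + S(c) + S(c') with truncated logarithm;
C0 is chosen large enough to make it nonnegative. *)
Definition trunc_cost (R : realType) (S : R * R -> R) (C0 l : R) (c c' : R * R) : R :=
  C0 - trunc_ln l c c' + S c + S c'.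

(** Here cc are the points with multiplicity, p their separated version and q a
perturbation of p that shrinks distances by at most exp(-eta).  The diagonal of
the double sum of the truncated cost, absent on the right, helps:
its logarithms are nonpositive. *)
Lemma energy_ge_trunc_cost (R : realType) (S : R * R -> R) (C0 l om eta : R)
    (n : nat) (cc p q : nat -> R * R) : 0 < l -> l <= 128 -> 0 <= eta ->
  (forall i j : 'I_n, (j < i)%N -> 0 < cdist (p i) (p j) /\
     expR (- eta) * cdist (p i) (p j) <= cdist (q i) (q j)) ->
  (forall i : 'I_n, \sum_(j < i) trunc_ln l (cc i) (cc j) <=
     \sum_(j < i) ln (cdist (p i) (p j))) ->
  (forall i : 'I_n, S (q i) <= S (cc i) + om) ->
  n%:R ^+ 2 * (C0 - eta - 2 * om)
    - \sum_(i < n) \sum_(j < n) trunc_cost S C0 l (cc i) (cc j) <=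
  2 * (\sum_(i < n) \sum_(j < n | (j < i)%N) ln (cdist (q i) (q j)))
    + 2 * (n%:R * \sum_(i < n) - S (q i)).
Proof.
move=> l0 l128 eta0 hpq htr hS.
have n2 (y : R) : \sum_(i < n) \sum_(j < n) y = n%:R ^+ 2 * y.
  by rewrite !sumr_const card_ord -[y *+ n]mulr_natl -[(_ * y) *+ n]mulr_natl mulrA.
have lowE (F : nat -> nat -> R) (i : 'I_n) :
    \sum_(j < n | (j < i)%N) F i j = \sum_(j < i) F i j.
  by rewrite (big_ord_widen _ (F i) (ltnW (ltn_ord i))).
set Q := \sum_(i < n) \sum_(j < n | _) ln (cdist (q i) (q j)).
pose P := \sum_(i < n) \sum_(j < n | (j < i)%N) ln (cdist (p i) (p j)).
pose D := \sum_(i < n) \sum_(j < n | (j < i)%N) trunc_ln l (cc i) (cc j).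
pose E := \sum_(i < n) \sum_(j < n | (j < i)%N) eta.
pose SS := \sum_(i < n) S (cc i).
have QP : P - E <= Q.
  rewrite /P /E /Q -sumrB; apply: ler_sum => i _; rewrite -sumrB; apply: ler_sum => j ji.
  have [h1 h2] := hpq i j ji.
  have h3 : 0 < expR (- eta) * cdist (p i) (p j) by rewrite mulr_gt0 // expR_gt0.
  have : ln (expR (- eta) * cdist (p i) (p j)) <= ln (cdist (q i) (q j)).
    by rewrite ler_ln ?posrE // (lt_le_trans h3).
  by rewrite lnM ?posrE ?expR_gt0 // expRK; lra.
have PD : D <= P.
  rewrite /P /D; apply: ler_sum => i _.
  rewrite (lowE (fun i j => trunc_ln l (cc i) (cc j))).
  by rewrite (lowE (fun i j => ln (cdist (p i) (p j)))).
have hE : 2 * E <= n%:R ^+ 2 * eta.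
  rewrite -n2 (@sum_pairs _ _ (fun _ _ => eta)) // lerDl.
  by apply: sumr_ge0.
have hSq : \sum_(i < n) - S (q i) >= - SS - n%:R * om.
  rewrite /SS sumrN -opprD lerN2.
  have -> : n%:R * om = \sum_(i < n) om by rewrite sumr_const card_ord mulr_natl.
  by rewrite -big_split /=; apply: ler_sum => i _.
have hD : \sum_(i < n) \sum_(j < n) trunc_ln l (cc i) (cc j) <= 2 * D.
  rewrite (@sum_pairs _ _ (fun i j : 'I_n => trunc_ln l (cc i) (cc j))).
    rewrite gerDl; apply: sumr_le0 => i _; rewrite /trunc_ln cdistxx.
    rewrite mulr_gt0 // ln_le0 // ler_pdivrMr // mul1r //.
  by move=> i j; rewrite /trunc_ln cdistC.
have hW : \sum_(i < n) \sum_(j < n) trunc_cost S C0 l (cc i) (cc j) =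
   n%:R ^+ 2 * C0 - \sum_(i < n) \sum_(j < n) trunc_ln l (cc i) (cc j) + 2 * (n%:R * SS).
  rewrite -n2 -sumrB.
  have -> : 2 * (n%:R * SS) = \sum_(i < n) \sum_(j < n) (S (cc i) + S (cc j)).
    rewrite (eq_bigr (fun i : 'I_n => n%:R * S (cc i) + SS)); last first.
      by move=> i _; rewrite big_split /= sumr_const card_ord mulr_natl.
    by rewrite big_split /= -mulr_sumr -/SS sumr_const card_ord -[SS *+ n]mulr_natl; ring.
  rewrite -big_split /=; apply: eq_bigr => i _.
  rewrite -sumrB -big_split /=; apply: eq_bigr => j _.
  by rewrite /trunc_cost; ring.
rewrite hW.
have hSq2 : n%:R * (- SS - n%:R * om) <= n%:R * \sum_(i < n) - S (q i).
  by rewrite ler_wpM2l // ler0n.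
set X := \sum_(i < n) \sum_(j < n) trunc_ln _ _ _ in hD *.
set Y := n%:R * \sum_(i < n) _ in hSq2 *.
nra.
Qed.

Section lower_bound.
Variables (R : realType) (a1 b1 a2 b2 : R) (H : set (R * R)).
Variables (mu : {measure set (R * R) -> \bar R}) (phi : R * R -> R).
Variables (tau : {finite_measure set (R * R)%type -> \bar R}) (T r0 : R).
Hypothesis hH : H = `[a1, b1] `*` `[a2, b2].
Hypothesis hphi0 : forall z, H z -> 0 < phi z.
Hypothesis htau : tau (~` H) = 0%E.
Hypotheses (hT : 0 < T) (hr0 : 0 < r0).
Hypothesis hdisc : forall z0 r, H z0 -> 0 < r -> r <= r0 ->
  ((r `^ T)%:E <= tau (disc z0 r))%E.

Let mH : measurable H.
Proof. by rewrite hH; exact: measurable_box. Qed.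

Let HP z : H z <-> box a1 b1 a2 b2 z.
Proof. by rewrite hH; exact: boxP. Qed.

Let S z := - ln (phi z).

Ltac drop_local_hyps := clear - hphi0 htau hT hr0 hdisc mH HP S.

(** The mass of tau outside H vanishes, and so the discs may be cut by H, as
membership in H is required from the tuples over which J integrates. *)
Lemma tau_disc_ge z0 r : H z0 -> 0 < r -> r <= r0 ->
  ((r `^ T)%:E <= tau (disc z0 r `&` H))%E.
Proof.
move=> Hz r1 r2; apply: (le_trans (hdisc Hz r1 r2)).
have mD := measurable_disc z0 r.
rewrite -{1}(setIT (disc z0 r)) -(setUv H) setIUr.
apply: (le_trans (measureU2 tau (measurableI _ _ mD mH)
  (measurableI _ _ mD (measurableC mH)))).
rewrite -[leRHS]adde0 leeD2l // -htau le_measure ?inE //.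
  exact: (measurableI _ _ mD (measurableC mH)).
exact: measurableC.
Qed.

(** The constants: l is the distance by which points move, om the oscillation of
S at distance 2 l, Mk a common Lipschitz constant of the monomials of degree at
most k, and sl > 0 the slack left in the moment conditions, which absorbs the
rounding of the masses. *)
Lemma eventually_ge_J (I : finType) (m : I -> R) (c : I -> R * R)
    (C0 l om Mk sl A : R) (k : nat) (eps : R) :
  (forall i, 0 <= m i) -> \sum_i m i = 1 -> (forall i, H (c i)) ->
  0 < l -> l <= 1 -> l <= b1 - a1 ->
  (forall z t, H z -> H t -> cdist z t <= 2 * l -> `|S z - S t| <= om) ->
  (forall i j, 0 <= trunc_cost S C0 l (c i) (c j)) ->
  (forall n1 n2 z t, (n1 + n2 <= k)%N -> H z -> H t ->
     `|monomial n1 n2 z - monomial n1 n2 t| <= Mk * cdist z t) -> 0 <= Mk ->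
  0 < sl -> (forall n1 n2, (n1 + n2 <= k)%N ->
    `|\int[mu]_(z in H) monomial n1 n2 z - \sum_i m i * monomial n1 n2 (c i)|
       + 2 * Mk * l + sl <= eps) ->
  A < C0 - \sum_i \sum_j m i * m j * trunc_cost S C0 l (c i) (c j) - 2 * om ->
  exists N0 : nat, forall n, (N0 <= n)%N ->
    ((expR (n%:R ^+ 2 * A))%:E <= J H mu phi tau n k eps)%E.
Proof.
move=> m0 m1 Hc l0 l1 lb hom cost0 hMk Mk0 sl0 hmom hA.
pose W := trunc_cost S C0 l.
pose e := (C0 - \sum_i \sum_j m i * m j * W (c i) (c j) - 2 * om - A) / 4.
have e0 : 0 < e by rewrite divr_gt0 // subr_gt0.
pose e' := Num.min e (sl / 2).
have e'0 : 0 < e' by rewrite lt_min e0 divr_gt0.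
have e'e : e' <= e by rewrite ge_min lexx.
have e'sl : e' < sl by rewrite gt_min; apply/orP; right; lra.
pose K1 : R := \sum_i \sum_j `|W (c i) (c j)|.
pose K2 : R := \sum_(n1 < k.+1) \sum_(n2 < k.+1) \sum_i `|monomial n1 n2 (c i)|.
have K10 : 0 <= K1 by apply: sumr_ge0 => i _; apply: sumr_ge0.
have K20 : 0 <= K2.
  by apply: sumr_ge0 => i _; apply: sumr_ge0 => j _; apply: sumr_ge0.
have KW i j : `|W (c i) (c j)| <= K1 + K2.
  rewrite -[leLHS]addr0 lerD // /K1 (bigD1 i) //= (bigD1 j) //= -addrA lerDl.
  by rewrite addr_ge0 ?sumr_ge0 // => i' _; apply: sumr_ge0.
have Km n1 n2 i : (n1 + n2 <= k)%N -> `|monomial n1 n2 (c i)| <= K1 + K2.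
  move=> nk; rewrite -[leLHS]add0r lerD // /K2.
  have h1 : (n1 < k.+1)%N by rewrite ltnS (leq_trans (leq_addr _ _) nk).
  have h2 : (n2 < k.+1)%N by rewrite ltnS (leq_trans (leq_addl _ _) nk).
  rewrite (bigD1 (Ordinal h1)) //= (bigD1 (Ordinal h2)) //= (bigD1 i) //=.
  rewrite -!addrA lerDl !addr_ge0 ?sumr_ge0 // => j _.
    by apply: sumr_ge0.
  by apply: sumr_ge0 => j' _; apply: sumr_ge0.
have [N1 HN1] := weighted_sum_approx m0 m1 e'0 (K1 + K2).
(* Discs of radius ka times the gap: the distance between points of two discs
   is at least exp(-e) times the distance of the centers. *)
pose ka : R := (1 - expR (- e)) / 2.
have ex1 : expR (- e) < 1 by rewrite expR_lt1 oppr_lt0.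
have ex0 : 0 < expR (- e) by exact: expR_gt0.
have ka0 : 0 < ka by rewrite divr_gt0 // subr_gt0.
have ka1 : ka <= 1 / 2 by rewrite /ka; lra.
have kaE : 1 - 2 * ka = expR (- e) by rewrite /ka; lra.
have T2 : 0 <= T * 2 by rewrite mulr_ge0 // ltW.
have [N2 HN2] := log_sublinear (- T * ln (ka * l / 128)) T2 e0.
exists (maxn (maxn N1 N2) (Num.trunc r0^-1).+1) => n.
rewrite !geq_max => /andP[/andP[nN1 nN2] nN3].
have n0 : (0 < n)%N by apply: leq_trans nN3.
have nr : 1 <= n%:R :> R by rewrite ler1n.
have nr0 : 0 < n%:R :> R by rewrite ltr0n.
have rn : r0^-1 <= n%:R.
  by apply: ltW; apply: lt_le_trans (truncnS_gt _) _; rewrite ler_nat.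
have [s [s1 s2]] := HN1 n nN1.
pose cc j := c (s j).
pose g : R := l / (128 * n%:R ^+ 2).
have g0 : 0 < g by rewrite divr_gt0 // mulr_gt0 // exprn_gt0.
have gl : g <= l.
  rewrite ler_pdivrMr ?mulr_gt0 ?exprn_gt0 // ler_peMr ?(ltW l0) //.
  have : 1 <= n%:R ^+ 2 :> R by rewrite exprn_ege1.
  by drop_local_hyps; lra.
have gn : g <= n%:R^-1.
  have h : n%:R <= 128 * n%:R ^+ 2 :> R by move: nr; drop_local_hyps; nra.
  rewrite /g -[leRHS]mul1r ler_pM ?invr_ge0 ?(ltW l0) ?mulr_ge0 ?exprn_ge0 ?(ltW nr0) //.
  by rewrite lef_pV2 // posrE // mulr_gt0 // exprn_gt0.
pose rho : R := ka * g.
have rho0 : 0 < rho by rewrite mulr_gt0.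
have rhog : rho <= g by rewrite /rho ler_piMl ?(ltW g0) //; move: ka1; drop_local_hyps; lra.
have rhol : rho <= l by apply: le_trans gl.
have rhor : rho <= r0.
  apply: (le_trans rhog); apply: (le_trans gn).
  by rewrite -[r0]invrK lef_pV2 // posrE // invr_gt0.
have [p Hp] := spread_points (c := cc) l0 lb (fun j _ => (HP _).1 (Hc (s j))) (n := n) (a2 := a2) (b2 := b2).
pose B j := disc (p j) rho `&` H.
have mB j : measurable (B j) by apply: measurableI => //; exact: measurable_disc.
have qc q : @tuple_box _ _ n B q -> forall i : 'I_n, cdist (tnth q i) (cc i) <= 2 * l.
  move=> qB i; have [hq _] := qB i; have [_ hp _ _] := Hp i (ltn_ord i).
  have {}hq : cdist (tnth q i) (p i) < rho := hq.
  by have := cdist_triangle (p i) (tnth q i) (cc i); move: hq hp rhol; drop_local_hyps; lra.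
have boxG : @tuple_box _ _ n B `<=` @Gtilde R H mu n k eps.
  move=> q qB; have qH j : H (tnth q j) by have [] := qB j.
  split => //; split; first exact: prob_on_kappa.
  move=> n1 n2 nk.
  rewrite (Rintegral_kappa mH (measurable_monomial n1 n2) qH).
  apply: lt_le_trans (hmom n1 n2 nk).
  pose m1' := \sum_i m i * monomial n1 n2 (c i).
  pose Y := n%:R^-1 * \sum_(i < n) monomial n1 n2 (tnth q i).
  pose Z := n%:R^-1 * \sum_(j < n) monomial n1 n2 (c (s j)).
  have h1 : `|Z - m1'| <= e'.
    by apply: (s1 (fun i => monomial n1 n2 (c i))) => i; exact: Km.
  have h2 : `|Z - Y| <= 2 * Mk * l.
    rewrite -mulrBr -sumrB normrM ger0_norm ?invr_ge0 ?ler0n // ler_pdivrMl //.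
    apply: (le_trans (ler_norm_sum _ _ _)).
    apply: (@le_trans _ _ (\sum_(i < n) (2 * Mk * l))); last first.
      by rewrite sumr_const card_ord [n%:R * _]mulr_natl.
    apply: ler_sum => i _; apply: (le_trans (hMk _ _ _ _ nk (Hc _) (qH i))).
    by have := qc q qB i; rewrite cdistC -/(cc i) => h; move: h Mk0; drop_local_hyps; nra.
  rewrite -/(monomial n1 n2) -/Y -/m1'; set X := Rintegral _ _ _.
  have -> : X - Y = (X - m1') + - (Z - m1') + (Z - Y) by ring.
  apply: (le_lt_trans (ler_normD _ _)).
  have := ler_normD (X - m1') (- (Z - m1')); rewrite normrN; move: h1 h2 e'sl; drop_local_hyps; lra.
have L q : @tuple_box _ _ n B q ->
    expR (n%:R ^+ 2 * (A + e)) <= cmod (wVDM phi q) ^+ 2.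
  move=> qB; have qH j : H (tnth q j) by have [] := qB j.
  have pg (i j : 'I_n) : (j < i)%N -> g <= cdist (p i) (p j).
    by have [_ _ h _] := Hp i (ltn_ord i); exact: h.
  have qp (i j : 'I_n) : (j < i)%N ->
      expR (- e) * cdist (p i) (p j) <= cdist (tnth q i) (tnth q j).
    move=> ji; have [hi _] := qB i; have [hj _] := qB j.
    have {}hi : cdist (tnth q i) (p i) < rho := hi.
    have {}hj : cdist (tnth q j) (p j) < rho := hj.
    have t1 := cdist_triangle (tnth q i) (p i) (p j).
    have t2 := cdist_triangle (tnth q j) (tnth q i) (p j).
    rewrite (cdistC (p i) (tnth q i)) in t1.
    have h := ler_wpM2l (ltW ka0) (pg i j ji).
    by rewrite -kaE; rewrite /rho in hi hj; move: hi hj t1 t2 h; drop_local_hyps; lra.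
  have qd (i j : 'I_n) : i != j -> 0 < cdist (tnth q i) (tnth q j).
    have h (i' j' : 'I_n) : (j' < i')%N -> 0 < cdist (tnth q i') (tnth q j').
      move=> ji; apply: lt_le_trans (qp i' j' ji); rewrite mulr_gt0 //.
      exact: lt_le_trans (pg i' j' ji).
    by rewrite neq_ltn => /orP[] /h //; rewrite cdistC.
  have [w0 wE] := ln_cmod_wVDM (phi := phi) qd (fun i => hphi0 (qH i)).
  rewrite -[leRHS]lnK ?posrE ?exprn_gt0 // ler_expR wE.
  pose q' i := nth (0, 0) q i.
  have q'E (i : 'I_n) : tnth q i = q' i by rewrite (tnth_nth (0, 0)).
  have := @energy_ge_trunc_cost R S C0 l om e n cc p q' l0 _ (ltW e0) _ _ _.
  have sE : \sum_(i < n) - S (q' i) = \sum_(i < n) ln (phi (tnth q i)).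
    by apply: eq_bigr => i _; rewrite /S opprK q'E.
  have lE : \sum_(i < n) \sum_(j < n | (j < i)%N) ln (cdist (q' i) (q' j)) =
    \sum_(i < n) \sum_(j < n | (j < i)%N) ln (cdist (tnth q i) (tnth q j)).
    by apply: eq_bigr => i _; apply: eq_bigr => j _; rewrite !q'E.
  rewrite sE lE => h; apply: le_trans (h _ _ _ _).
  - have h2 := s2 (fun i j => W (c i) (c j)) KW.
    rewrite -[X in _ - X]/(\sum_(k < n) \sum_(l < n) W (c (s k)) (c (s l))).
    rewrite lerBrDl; apply: le_trans (lerD h2 (lexx _)) _.
    rewrite -mulrDr ler_wpM2l ?exprn_ge0 ?ler0n //.
    have : C0 - \sum_i \sum_j m i * m j * W (c i) (c j) - 2 * om - A = 4 * e.
      by rewrite /e; field.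
    by move: e'e e0; drop_local_hyps; lra.
  - by move: l1; drop_local_hyps; lra.
  - move=> i j ji; rewrite -!q'E; split; last exact: qp.
    exact: lt_le_trans (pg i j ji).
  - by move=> i; have [_ _ _ h3] := Hp i (ltn_ord i).
  - move=> i; rewrite -q'E.
    have := hom _ _ (qH i) (Hc (s i)) (qc q qB i).
    by rewrite ler_norml => /andP[_]; rewrite -/(cc i); drop_local_hyps; lra.
rewrite /J; apply: le_trans; last first.
  apply: (@ge0_integral_ge_cst _ _ _ (tuple_measure tau n) _ (@tuple_box _ _ n B) _
    (expR (n%:R ^+ 2 * (A + e)))) => //.
  - exact: measurable_tuple_box.
  - by move=> q _; rewrite lee_fin exprn_ge0 // cmod_ge0.
rewrite tuple_measure_box //.
apply: (@le_trans _ _ ((expR (n%:R ^+ 2 * (A + e)))%:E * ((rho `^ T) ^+ n)%:E)%E).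
  rewrite -EFinM lee_fin.
  have -> : (rho `^ T) ^+ n = expR (n%:R * (T * ln rho)).
    by rewrite expRM_natl -ln_powR lnK // posrE powR_gt0.
  rewrite -expRD ler_expR mulrDr -addrA lerDl.
  have := HN2 n nN2.
  have -> : ln rho = ln (ka * l / 128) - 2 * ln n%:R.
    have -> : rho = (ka * l / 128) / n%:R ^+ 2 by rewrite /rho /g; field; rewrite gt_eqF.
    rewrite ln_div; last 2 first.
    - by rewrite posrE divr_gt0 // mulr_gt0.
    - by rewrite posrE exprn_gt0.
    by rewrite lnXn // [2 * _]mulr_natl.
  set x := ln (ka * _ / _); set y := ln n%:R => h.
  have -> : n%:R ^+ 2 * e + n%:R * (T * (x - 2 * y)) =
    n%:R * (e * n%:R - (- T * x + T * 2 * y)) by ring.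
  by rewrite mulr_ge0 ?(ltW nr0) // subr_ge0.
apply: lee_pmul; [by rewrite lee_fin expR_ge0 | by rewrite lee_fin exprn_ge0 // powR_ge0
  | exact: lexx | ].
apply: expr_le_prode => [|i]; first exact: powR_ge0.
have [h _ _ _] := Hp i (ltn_ord i).
by apply: tau_disc_ge => //; exact/HP.
Qed.
End lower_bound.

(** * Comparison of the logarithm with its truncation *)

(** Three ranges of the distance r between z and t.  If r is much larger than l,
replacing r by |c - c'| - 2 l costs a factor close to 1, i.e. at most de after
taking logarithms.  If r is small, a bounded factor is lost, and its logarithm
is at most de (C - ln r), as r is small.  The square root of l separates the
two cases. *)
Lemma trunc_ln_ge (R : realType) (C de : R) : 0 <= C -> 0 < de ->
  exists2 l0 : R, 0 < l0 & forall l c c' z t, 0 < l -> l <= l0 ->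
    cdist z c <= l -> cdist t c' <= l -> 0 < cdist z t -> ln (cdist z t) <= C ->
    C - trunc_ln l c c' <= de + (1 + de) * (C - ln (cdist z t)).
Proof.
move=> C0 de0.
(* With x = sqrt l: for |c - c'| >= x the loss is a factor 1 - 4 x >= exp(-de);
   below, a factor 768 = 6 * 128 is lost at most, and r <= 2 x makes ln 768 at
   most de (C - ln r); finally x <= 1/4 gives 4 l <= x. *)
pose x0 : R := Num.min ((1 - expR (- de)) / 4) (Num.min (expR (- (ln 768 / de)) / 2) 4^-1).
have e1 : expR (- de) < 1 by rewrite expR_lt1 oppr_lt0.
have x00 : 0 < x0.
  rewrite !lt_min invr_gt0 ltr0n andbT; apply/andP; split; apply: divr_gt0 => //.
    by rewrite subr_gt0.
  exact: expR_gt0.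
exists (x0 ^+ 2); first by rewrite exprn_gt0.
move=> l c c' z t l0 lx zc tc zt lnC.
set x := Num.sqrt l.
have x0' : 0 < x by rewrite sqrtr_gt0.
have lE : l = x ^+ 2 by rewrite sqr_sqrtr // ltW.
have xx0 : x <= x0.
  by rewrite -ler_sqr ?nnegrE ?(ltW x0') ?(ltW x00) // -lE.
have [h1 h2 h3] : [/\ x <= (1 - expR (- de)) / 4, x <= expR (- (ln 768 / de)) / 2 & x <= 4^-1].
  by move: xx0; rewrite !le_min => /andP[? /andP[]].
have {}zc : cdist c z <= l by rewrite cdistC.
set r := cdist z t; set w := cdist c c'.
have wr : w <= r + 2 * l.
  have t1 := cdist_triangle z c c'; have t2 := cdist_triangle t z c'.
  rewrite /w /r; lra.
have rw : r <= w + 2 * l.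
  have t1 := cdist_triangle c z t; have t2 := cdist_triangle c' c t.
  rewrite (cdistC z c) (cdistC c' t) in t1 t2; rewrite /w /r; lra.
have lx4 : 4 * l <= x by rewrite lE; nra.
have lnr (y k : R) : 0 < k -> 0 < y -> r <= k * y -> ln r - ln k <= ln y.
  move=> k0 y0 ry; rewrite lerBlDl -lnM ?posrE // ler_ln ?posrE // mulr_gt0 //.
have Cr : 0 <= C - ln r by rewrite subr_ge0.
have small : r <= 2 * x -> ln 768 <= de * (C - ln r).
  move=> r2; rewrite -ler_pdivrMl // mulrC.
  have : r <= expR (- (ln 768 / de)) by lra.
  rewrite -ler_ln ?posrE ?expR_gt0 // expRK; lra.
rewrite /trunc_ln -/w; case: ifPn => [w4|].
  have r2 : r <= 2 * x by clear -w4 rw lx4 l0 x0'; lra.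
  have := small r2.
  have l128 : 0 < l / 128 by rewrite divr_gt0.
  have n768 : 0 < 768 :> R by rewrite ltr0n.
  have := lnr (l / 128) 768 n768 l128.
  have r6 : r <= 768 * (l / 128) by clear -w4 rw; lra.
  by move=> /(_ r6); clear -de0; lra.
rewrite -leNgt => w4.
have [wx|xw] := ltP w x.
  have r2 : r <= 2 * x by clear -rw lx4 wx x0' l0; lra.
  have := small r2.
  have y0 : 0 < w - 2 * l by clear -w4 l0; lra.
  have n3 : 0 < 3 :> R by rewrite ltr0n.
  have := lnr (w - 2 * l) 3 n3 y0.
  have r3 : r <= 3 * (w - 2 * l) by clear -rw w4; lra.
  have : ln 3 <= ln 768 :> R by rewrite ler_ln ?posrE ?ltr0n ?ler_nat.
  by move=> h /(_ r3); clear -h de0; lra.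
have y0 : 0 < w - 2 * l by clear -w4 l0; lra.
have k0 : 0 < expR de by exact: expR_gt0.
have := lnr (w - 2 * l) (expR de) k0 y0; rewrite expRK.
have rk : r <= expR de * (w - 2 * l).
  have -> : r = expR de * (expR (- de) * r).
    by rewrite mulrA expRxMexpNx_1 mul1r.
  rewrite ler_pM2l //.
  have h : expR (- de) * r <= (1 - 4 * x) * (w + 2 * l).
    by rewrite ler_pM ?(ltW (expR_gt0 _)) ?(ltW zt) //; clear -h1 rw; lra.
  apply: (le_trans h).
  have xw2 : l <= x * w by rewrite lE expr2 ler_pM2l.
  have xl : 0 <= x * l by rewrite mulr_ge0 // ltW.
  by clear -xw2 xl; lra.
by move=> /(_ rk); have := mulr_ge0 (ltW de0) Cr; clear; lra.
Qed.

Lemma trunc_ln_le (R : realType) (C l : R) (c c' : R * R) : 0 <= C -> 0 < l -> l <= 1 ->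
  (0 < cdist c c' -> ln (cdist c c') <= C) -> trunc_ln l c c' <= C.
Proof.
move=> C0 l0 l1 h; rewrite /trunc_ln; case: ifPn => [_|].
  by apply: le_trans C0; apply: ln_le0; lra.
rewrite -leNgt => w4.
have w0 : 0 < cdist c c' by lra.
by apply: le_trans (h w0); rewrite ler_ln ?posrE //; lra.
Qed.

(** * Continuous functions and partitions of a rectangle *)

Section rectangle.
Variables (R : realType) (a1 b1 a2 b2 : R) (H : set (R * R)).
Hypotheses (hab1 : a1 < b1) (hab2 : a2 < b2).
Hypothesis hH : H = `[a1, b1] `*` `[a2, b2].

Let HP z : H z <-> box a1 b1 a2 b2 z.
Proof. by rewrite hH; exact: boxP. Qed.

Lemma measurable_rect : measurable H.
Proof. by rewrite hH; exact: measurable_box. Qed.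

Lemma rect_compact : compact H.
Proof. by rewrite hH; apply: compact_setX; exact: segment_compact. Qed.

Lemma rect_cdist_le z t : H z -> H t -> cdist z t <= (b1 - a1) + (b2 - a2).
Proof.
move=> /HP[/andP[x1 x2] /andP[y1 y2]] /HP[/andP[x3 x4] /andP[y3 y4]].
by apply: (le_trans (cdist_le_normD _ _)); rewrite lerD // ler_norml; lra.
Qed.

(** By compactness: a cluster point of a sequence of bad pairs contradicts
continuity at this point. *)
Lemma rect_unif_continuous (f : R * R -> R) : {within H, continuous f} ->
  forall e : R, 0 < e -> exists2 r : R, 0 < r &
    forall z t, H z -> H t -> cdist z t <= r -> `|f z - f t| <= e.
Proof.
move=> /subspace_continuousP fc e e0; apply: contrapT => no.
have bad (n : nat) : exists zt : (R * R) * (R * R), [/\ H zt.1, H zt.2,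
    cdist zt.1 zt.2 <= n.+1%:R^-1 & e < `|f zt.1 - f zt.2| ].
  apply: contrapT => nb; apply: no; exists n.+1%:R^-1; first by rewrite invr_gt0.
  move=> z t Hz Ht zt; rewrite leNgt; apply/negP => ft; apply: nb.
  by exists (z, t).
have [u uP] := choice bad.
have PF : ProperFilter ((fun n => (u n).1) @ \oo) by exact: fmap_proper_filter.
have [|p [Hp]] := rect_compact PF.
  by exists 0%N => // n _ /=; have [] := uP n.
move=> clp.
have e2 : 0 < e / 2 by rewrite divr_gt0.
have := fc p Hp; move=> /cvgrPdist_lt /(_ _ e2).
rewrite near_withinE => /nbhs_ballP[r /= r0 rP].
have r2 : 0 < r / 2 by rewrite divr_gt0.
pose N := Num.trunc (2 / r).
have FN : ((fun n => (u n).1) @ \oo) [set z | exists2 n, (N <= n)%N & z = (u n).1].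
  by exists N => // n /= Nn; exists n.
have [z [[n Nn zE] zp]] := clp _ _ FN (nbhsx_ballx p _ r2).
have [H1 H2 un fn] := uP n.
have un2 : cdist (u n).1 (u n).2 < r / 2.
  apply: (le_lt_trans un); rewrite -[r / 2]invrK ltf_pV2 ?posrE ?invr_gt0 ?divr_gt0 //.
  rewrite invf_div; apply: lt_le_trans (truncnS_gt _) _.
  by rewrite ler_nat ltnS.
have h1 : `|f p - f (u n).1| < e / 2.
  apply: rP H1; rewrite -zE.
  by apply: le_ball zp; rewrite ler_pdivrMr // ler_peMr ?ltW //; lra.
have h2 : `|f p - f (u n).2| < e / 2.
  apply: rP H2; move: zp; rewrite zE => -[/= p1 p2]; split => /=.
    have := ler_norm1_cdist (u n).1 (u n).2; move: p1; rewrite /ball /= => p1 h.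
    have := ler_normD (p.1 - (u n).1.1) ((u n).1.1 - (u n).2.1).
    rewrite addrA subrK => h'; lra.
  have := ler_norm2_cdist (u n).1 (u n).2; move: p2; rewrite /ball /= => p2 h.
  have := ler_normD (p.2 - (u n).1.2) ((u n).1.2 - (u n).2.2).
  rewrite addrA subrK => h'; lra.
have := ler_normD (f (u n).1 - f p) (f p - f (u n).2).
rewrite addrA subrK (distrC _ (f p)); lra.
Qed.

Lemma cover_1d (a b h : R) : 0 < h -> a <= b -> exists N : nat,
  forall x, a <= x <= b -> exists i : 'I_N, a + i%:R * h <= x < a + i.+1%:R * h.
Proof.
move=> h0 ab; exists (Num.trunc ((b - a) / h)).+1 => x /andP[ax xb].
have q0 : 0 <= (x - a) / h by rewrite divr_ge0 ?subr_ge0 // ltW.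
have iN : (Num.trunc ((x - a) / h) < (Num.trunc ((b - a) / h)).+1)%N.
  by rewrite ltnS le_truncn // ler_pM2r ?invr_gt0 // lerD2r.
exists (Ordinal iN) => /=; apply/andP; split.
  by rewrite -lerBrDl -ler_pdivlMr // truncn_le.
by rewrite -ltrBlDl -ltr_pdivrMr // truncnS_gt.
Qed.

(** Half-open square cells of side l/2, cut by the rectangle; the corner of a
cell is truncated to b1 and b2 so that it lies in H even if the cell is
empty. *)
Lemma fine_partition (l : R) : 0 < l -> exists (I : finType) (A : I -> set (R * R))
    (c : I -> R * R),
  [/\ forall i, measurable (A i), forall i, H (c i),
      forall i z, A i z -> cdist z (c i) <= l,
      trivIset setT A & H = \big[setU/set0]_(i : I) A i].
Proof.
move=> l0; have l2 : 0 < l / 2 by rewrite divr_gt0.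
have [N1 HN1] := cover_1d l2 (ltW hab1).
have [N2 HN2] := cover_1d l2 (ltW hab2).
set h := l / 2 in l2 HN1 HN2.
pose cell a b (i : nat) : set R := `[a, b] `&` `[a + i%:R * h, a + i.+1%:R * h[.
have cellP a b i x : cell a b i x <-> (a <= x <= b) /\ (a + i%:R * h <= x < a + i.+1%:R * h).
  by rewrite /cell /setI /= !in_itv.
have uniq a b i j x : cell a b i x -> cell a b j x -> i = j.
  have le i' j' : cell a b i' x -> cell a b j' x -> (i' <= j')%N.
    move=> /cellP[_ /andP[h1 _]] /cellP[_ /andP[_ h2]].
    have : i'%:R * h < j'.+1%:R * h by lra.
    by rewrite ltr_pM2r // ltr_nat ltnS.
  by move=> h1 h2; apply/eqP; rewrite eqn_leq !le.
exists ('I_N1 * 'I_N2)%type, (fun i : 'I_N1 * 'I_N2 => cell a1 b1 i.1 `*` cell a2 b2 i.2),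
  (fun i : 'I_N1 * 'I_N2 => (Num.min (a1 + i.1%:R * h) b1, Num.min (a2 + i.2%:R * h) b2)).
have ch a b (i : nat) x : cell a b i x -> `|x - Num.min (a + i%:R * h) b| <= h.
  move=> /cellP[/andP[ax xb] /andP[h1 h2]].
  have -> : Num.min (a + i%:R * h) b = a + i%:R * h by apply/min_idPl; lra.
  rewrite ger0_norm ?subr_ge0 //; rewrite -natr1 in h2; lra.
have ih (i : nat) : 0 <= i%:R * h by rewrite mulr_ge0 // ltW.
split.
- by move=> i; apply: measurableX; apply: measurableI.
- move=> i; apply/HP; split; rewrite /= ge_min lexx orbT andbT le_min.
    by rewrite lerDl ih ltW.
  by rewrite lerDl ih ltW.
- move=> i z [/= z1 z2]; apply: (le_trans (cdist_le_normD _ _)) => /=.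
  by have := ch _ _ _ _ z1; have := ch _ _ _ _ z2; rewrite /h; lra.
- move=> [i1 i2] [j1 j2] _ _ [z [[/= z1 z2] [/= z3 z4]]].
  by congr (_, _); apply/val_inj; [exact: uniq z1 z3 | exact: uniq z2 z4].
- apply/seteqP; split => [z Hz|z].
    have /HP[z1 z2] := Hz.
    have [i iP] := HN1 _ z1; have [j jP] := HN2 _ z2.
    rewrite -bigcup_seq; exists (i, j) => /=; first by rewrite mem_index_enum.
    by split; apply/cellP.
  rewrite -bigcup_seq => -[i _ [/= /cellP[z1 _] /cellP[z2 _]]].
  by apply/HP.
Qed.

Lemma bounded_on_rect (f : R * R -> R) : {within H, continuous f} ->
  exists2 M : R, 0 <= M & forall z, H z -> `|f z| <= M.
Proof.
move=> /rect_unif_continuous /(_ 1 ltr01) [r r0 fr].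
have [I [A [c [mA Hc Ac _ HA]]]] := fine_partition r0.
exists (1 + \sum_i `|f (c i)|); first by rewrite addr_ge0 // sumr_ge0.
move=> z Hz; move: (Hz); rewrite {1}HA -bigcup_seq => -[i _ Az].
have h := fr z (c i) Hz (Hc i) (Ac i z Az).
have h2 : `|f (c i)| <= \sum_i `|f (c i)|.
  by rewrite (bigD1 i) //= lerDl sumr_ge0.
have := ler_normD (f z - f (c i)) (f (c i)); rewrite subrK; lra.
Qed.

Lemma lipschitz_monomial (n1 n2 : nat) : exists2 M : R, 0 <= M &
  forall z t, H z -> H t -> `|monomial n1 n2 z - monomial n1 n2 t| <= M * cdist z t
    /\ `|monomial n1 n2 z| <= M.
Proof.
pose B : R := `|a1| + `|b1| + `|a2| + `|b2|.
have B0 : 0 <= B by rewrite !addr_ge0.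
have Bx z : H z -> `|z.1| <= B /\ `|z.2| <= B.
  move=> /HP[/andP[x1 x2] /andP[y1 y2]].
  have := ler_norm (- a1); have := ler_norm b1; have := ler_norm (- a2); have := ler_norm b2.
  rewrite !normrN => q1 q2 q3 q4.
  have := normr_ge0 a1; have := normr_ge0 b1; have := normr_ge0 a2; have := normr_ge0 b2.
  by move=> p1 p2 p3 p4; rewrite !ler_norml /B; split; lra.
have step (f g : R * R -> R) (M : R) : 0 <= M ->
    (forall z t, H z -> H t -> `|f z - f t| <= cdist z t) ->
    (forall z, H z -> `|f z| <= B) ->
    (forall z t, H z -> H t -> `|g z - g t| <= M * cdist z t /\ `|g z| <= M) ->
    forall z t, H z -> H t ->
     `|f z * g z - f t * g t| <= (M + M * B) * cdist z t /\ `|f z * g z| <= M + M * B.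
  move=> M0 f1 fB gM z t Hz Ht.
  have [g1 g2] := gM z t Hz Ht; have [_ g3] := gM t z Ht Hz.
  split.
    have -> : f z * g z - f t * g t = f z * (g z - g t) + (f z - f t) * g t by ring.
    apply: (le_trans (ler_normD _ _)); rewrite !normrM.
    have h1 : `|f z| * `|g z - g t| <= B * (M * cdist z t) by rewrite ler_pM ?fB.
    have h2 : `|f z - f t| * `|g t| <= cdist z t * M by rewrite ler_pM ?f1.
    by lra.
  rewrite normrM.
  have h1 : `|f z| * `|g z| <= B * M by rewrite ler_pM ?fB.
  lra.
elim: n1 => [|n1 [M M0 IH]].
  elim: n2 => [|n2 [M M0 IH]].
    exists 1 => // z t _ _; rewrite /monomial !expr0 mulr1 subrr normr0 normr1.
    by rewrite mul1r cdist_ge0.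
  exists (M + M * B); first by rewrite addr_ge0 // mulr_ge0.
  have -> : monomial 0 n2.+1 = (fun z : R * R => z.2 * monomial 0 n2 z).
    by apply/funext => z; rewrite /monomial expr0 exprS; ring.
  apply: step => //; first by move=> z t _ _; exact: ler_norm2_cdist.
  by move=> z /Bx[].
exists (M + M * B); first by rewrite addr_ge0 // mulr_ge0.
have -> : monomial n1.+1 n2 = (fun z : R * R => z.1 * monomial n1 n2 z).
  by apply/funext => z; rewrite /monomial exprS; ring.
apply: step => //; first by move=> z t _ _; exact: ler_norm1_cdist.
by move=> z /Bx[].
Qed.

Lemma lipschitz_monomials (k : nat) : exists2 M : R, 0 <= M &
  forall n1 n2 z t, (n1 + n2 <= k)%N -> H z -> H t ->
   `|monomial n1 n2 z - monomial n1 n2 t| <= M * cdist z t /\ `|monomial n1 n2 z| <= M.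
Proof.
have h (n : nat * nat) : exists M : R, 0 <= M /\
  forall z t, H z -> H t -> `|monomial n.1 n.2 z - monomial n.1 n.2 t| <= M * cdist z t
    /\ `|monomial n.1 n.2 z| <= M.
  by have [M M0 MP] := lipschitz_monomial n.1 n.2; exists M.
have [M MP] := choice h.
exists (\sum_(i < k.+1) \sum_(j < k.+1) M (val i, val j)).
  by apply: sumr_ge0 => i _; apply: sumr_ge0 => j _; have [] := MP (val i, val j).
move=> n1 n2 z t nk Hz Ht.
have h1 : (n1 < k.+1)%N by rewrite ltnS (leq_trans (leq_addr _ _) nk).
have h2 : (n2 < k.+1)%N by rewrite ltnS (leq_trans (leq_addl _ _) nk).
have MM : M (n1, n2) <= \sum_(i < k.+1) \sum_(j < k.+1) M (val i, val j).
  rewrite (bigD1 (Ordinal h1)) //= (bigD1 (Ordinal h2)) //= -addrA lerDl.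
  rewrite addr_ge0 ?sumr_ge0 // => i _; first by have [] := MP (n1, val i).
  by apply: sumr_ge0 => j _; have [] := MP (val i, val j).
have [_ /(_ z t Hz Ht)[q1 q2]] := MP (n1, n2).
split; last exact: le_trans MM.
by apply: (le_trans q1); rewrite ler_wpM2r // cdist_ge0.
Qed.

End rectangle.

(** * Polynomial approximation of kernels *)

(** The Bernstein polynomial of degree n with values f(0), ..., f(n), by
recursion on the steps of the random walk that moves up with probability x:
this avoids binomial sums, and moments follow by induction. *)
Fixpoint bernstein (R : realType) (n : nat) (f : nat -> R) (x : R) : R :=
  if n is m.+1 then x * bernstein m (f \o S) x + (1 - x) * bernstein m f x else f 0%N.

Section bernstein.
Variable R : realType.
Implicit Types (f g : nat -> R) (x : R).

Lemma eq_bernstein n f g x : f =1 g -> bernstein n f x = bernstein n g x.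
Proof.
by elim: n f g => [|n IH] f g fg /=; rewrite ?fg // !(IH _ _ fg) (IH _ (g \o S)) // => i /=.
Qed.

Lemma bernstein_affine n f (a b : R) x :
  bernstein n (fun i => a + b * f i) x = a + b * bernstein n f x.
Proof.
elim: n f => [|n IH] f //=.
by rewrite IH (@eq_bernstein n _ (fun i => a + b * (f \o S) i) x) // IH; ring.
Qed.

Lemma ler_bernstein n f g x : 0 <= x <= 1 -> (forall i, (i <= n)%N -> f i <= g i) ->
  bernstein n f x <= bernstein n g x.
Proof.
move=> /andP[x0 x1]; elim: n f g => [|n IH] f g fg /=; first exact: fg.
apply: lerD; apply: ler_wpM2l; rewrite ?subr_ge0 //; apply: IH => i ni; apply: fg => //.
exact: ltnW.
Qed.

(** The second moment of a binomial variable around an arbitrary point; the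
shift a makes the induction go through. *)
Lemma bernstein_sqr n (a : R) x : bernstein n (fun i => (i%:R + a) ^+ 2) x =
  (n%:R * x + a) ^+ 2 + n%:R * x * (1 - x).
Proof.
elim: n a => [|n IH] a /=; first by rewrite !mul0r addr0.
rewrite IH (@eq_bernstein n _ (fun i => (i%:R + (a + 1)) ^+ 2) x); last first.
  by move=> i /=; rewrite -natr1; congr (_ ^+ 2); ring.
by rewrite IH -natr1; ring.
Qed.

Lemma bernstein_var_le n (a b : R) x : (0 < n)%N -> 0 <= x <= 1 -> 0 <= b ->
  bernstein n (fun i => a + b * (i%:R / n%:R - x) ^+ 2) x <= a + b / n%:R.
Proof.
move=> n0 /andP[x0 x1] b0.
have nr : 0 < n%:R :> R by rewrite ltr0n.
rewrite (@eq_bernstein n _ (fun i => a + (b / n%:R ^+ 2) * (i%:R + - (n%:R * x)) ^+ 2) x); last first.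
  by move=> i; field; rewrite gt_eqF.
rewrite bernstein_affine bernstein_sqr subrr expr0n /= add0r lerD2l.
have -> : b / n%:R ^+ 2 * (n%:R * x * (1 - x)) = (b / n%:R) * (x * (1 - x)).
  by field; rewrite gt_eqF.
rewrite ler_piMr ?divr_ge0 ?(ltW nr) //; nra.
Qed.

(** The modulus of continuity enters as a quadratic bound on the increments of
f, so that only the variance of the binomial distribution is needed. *)
Lemma bernstein2_approx (f : R -> R -> R) (de K : R) : 0 < de -> 0 <= K ->
  (forall x y u v, 0 <= x <= 1 -> 0 <= y <= 1 -> 0 <= u <= 1 -> 0 <= v <= 1 ->
     `|f u v - f x y| <= de + K * ((u - x) ^+ 2 + (v - y) ^+ 2)) ->
  exists n : nat, forall x y, 0 <= x <= 1 -> 0 <= y <= 1 ->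
    `|bernstein n (fun i => bernstein n (fun j => f (i%:R / n%:R) (j%:R / n%:R)) y) x
      - f x y| <= 2 * de.
Proof.
move=> de0 K0 fK; pose N := (Num.trunc (2 * K / de)).+1; exists N => x y x01 y01.
have N0 : 0 < N%:R :> R by rewrite ltr0n.
have KN : K / N%:R + K / N%:R <= de.
  have : 2 * K / de <= N%:R by apply: ltW; exact: truncnS_gt.
  by rewrite ler_pdivrMr // -mulrDl ler_pdivrMr // [de * _]mulrC; lra.
have i01 i : (i <= N)%N -> 0 <= (i%:R / N%:R : R) <= 1.
  by move=> iN; rewrite divr_ge0 //= ler_pdivrMr // mul1r ler_nat.
pose c := f x y.
have up : bernstein N (fun i => bernstein N (fun j => f (i%:R / N%:R) (j%:R / N%:R)) y) x
    <= c + 2 * de.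
  apply: (@le_trans _ _ (bernstein N (fun i => (c + de + K / N%:R) +
      K * (i%:R / N%:R - x) ^+ 2) x)).
    apply: ler_bernstein => // i iN.
    apply: (@le_trans _ _ (bernstein N (fun j => (c + de + K * (i%:R / N%:R - x) ^+ 2)
       + K * (j%:R / N%:R - y) ^+ 2) y)).
      apply: ler_bernstein => // j jN.
      have := fK x y _ _ x01 y01 (i01 i iN) (i01 j jN).
      by rewrite ler_norml => /andP[_]; rewrite -/c; lra.
    apply: (le_trans (bernstein_var_le _ _ _ _)) => //; lra.
  apply: (le_trans (bernstein_var_le _ _ _ _)) => //; lra.
have dn : c - 2 * de <=
    bernstein N (fun i => bernstein N (fun j => f (i%:R / N%:R) (j%:R / N%:R)) y) x.
  rewrite -lerN2 -mulN1r -[X in X <= _]add0r -bernstein_affine.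
  apply: (@le_trans _ _ (bernstein N (fun i => (- c + de + K / N%:R) +
      K * (i%:R / N%:R - x) ^+ 2) x)).
    apply: ler_bernstein => // i iN; rewrite -bernstein_affine.
    apply: (@le_trans _ _ (bernstein N (fun j => (- c + de + K * (i%:R / N%:R - x) ^+ 2)
       + K * (j%:R / N%:R - y) ^+ 2) y)).
      apply: ler_bernstein => // j jN.
      have := fK x y _ _ x01 y01 (i01 i iN) (i01 j jN).
      by rewrite ler_norml => /andP[+ _]; rewrite -/c; lra.
    apply: (le_trans (bernstein_var_le _ _ _ _)) => //; lra.
  apply: (le_trans (bernstein_var_le _ _ _ _)) => //; lra.
by rewrite ler_norml -/c; lra.
Qed.
End bernstein.

Section bipoly.
Variable R : realType.
Implicit Types (f g : R * R -> R * R -> R).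

Definition biterm (e : R * (nat * nat) * (nat * nat)) (z t : R * R) : R :=
  e.1.1 * (monomial e.1.2.1 e.1.2.2 z * monomial e.2.1 e.2.2 t).

(** Polynomials in the four coordinates of z and t, in the normal form needed to
compute double sums and double integrals from the moments. *)
Definition bipoly f := exists s, forall z t, f z t = \sum_(e <- s) biterm e z t.

Lemma bipoly_term e : bipoly (biterm e).
Proof. by exists [:: e] => z t; rewrite big_seq1. Qed.

Lemma eq_bipoly f g : (forall z t, f z t = g z t) -> bipoly f -> bipoly g.
Proof. by move=> fg [s sP]; exists s => z t; rewrite -fg sP. Qed.

Lemma bipoly_cst (c : R) : bipoly (fun _ _ => c).
Proof.
apply: eq_bipoly (bipoly_term (c, (0, 0)%N, (0, 0)%N)) => z t.
by rewrite /biterm /monomial /= !expr0 !mulr1.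
Qed.

Lemma bipolyD f g : bipoly f -> bipoly g -> bipoly (fun z t => f z t + g z t).
Proof.
by move=> [s sP] [s' sP']; exists (s ++ s') => z t; rewrite big_cat sP sP'.
Qed.

Lemma bipolyM f g : bipoly f -> bipoly g -> bipoly (fun z t => f z t * g z t).
Proof.
move=> [s sP] [s' sP'].
exists [seq (e.1.1 * e'.1.1, (e.1.2.1 + e'.1.2.1, e.1.2.2 + e'.1.2.2)%N,
  (e.2.1 + e'.2.1, e.2.2 + e'.2.2)%N) | e <- s, e' <- s'] => z t.
rewrite big_allpairs_dep sP sP' big_distrlr /=; apply: eq_bigr => e _.
by apply: eq_bigr => e' _; rewrite /biterm /monomial /= !exprD; ring.
Qed.

Lemma bipoly_fst1 : bipoly (fun z _ => z.1).
Proof.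
apply: eq_bipoly (bipoly_term ((1 : R), (1, 0)%N, (0, 0)%N)) => z t.
by rewrite /biterm /monomial /= !expr0 !mulr1 mul1r.
Qed.

Lemma bipoly_fst2 : bipoly (fun z _ => z.2).
Proof.
apply: eq_bipoly (bipoly_term ((1 : R), (0, 1)%N, (0, 0)%N)) => z t.
by rewrite /biterm /monomial /= !expr0 !mulr1 !mul1r.
Qed.

Lemma bipoly_swap f : bipoly f -> bipoly (fun z t => f t z).
Proof.
move=> [s sP]; exists [seq (e.1.1, e.2, e.1.2) | e <- s] => z t.
by rewrite big_map sP; apply: eq_bigr => e _; rewrite /biterm /=; congr (_ * _); ring.
Qed.

Lemma bipolyZ (c : R) f : bipoly f -> bipoly (fun z t => c * f z t).
Proof. by move=> pf; apply: bipolyM => //; exact: bipoly_cst. Qed.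

Lemma bipolyB f g : bipoly f -> bipoly g -> bipoly (fun z t => f z t - g z t).
Proof.
move=> pf pg; apply: (eq_bipoly (f := fun z t => f z t + (-1) * g z t)).
  by move=> z t; rewrite mulN1r.
by apply: bipolyD => //; exact: bipolyZ.
Qed.

Lemma bipoly_bernstein n (F : nat -> R * R -> R * R -> R) f :
  (forall i, bipoly (F i)) -> bipoly f ->
  bipoly (fun z t => bernstein n (fun i => F i z t) (f z t)).
Proof.
move=> + pf; elim: n F => [|n IH] F pF //=.
apply: bipolyD; apply: bipolyM => //.
- by apply: (IH (F \o S)) => i; exact: pF.
- by apply: bipolyB => //; exact: bipoly_cst.
- exact: IH.
Qed.

Lemma bipoly_sqr_cdist : bipoly (fun z t => cdist z t ^+ 2).
Proof.
apply: (eq_bipoly (f := fun z t => (z.1 - t.1) * (z.1 - t.1) + (z.2 - t.2) * (z.2 - t.2))).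
  by move=> z t; rewrite cdistE sqr_sqrtr ?addr_ge0 ?sqr_ge0 // !expr2.
have h1 := bipolyB bipoly_fst1 (bipoly_swap bipoly_fst1).
have h2 := bipolyB bipoly_fst2 (bipoly_swap bipoly_fst2).
by apply: bipolyD; apply: bipolyM.
Qed.

End bipoly.

Lemma ln_increment_le (R : realType) (e a b : R) : 0 < e -> e <= a -> e <= b ->
  `|ln a - ln b| <= `|a - b| / e.
Proof.
move=> e0; wlog ab : a b / b <= a => [H ea eb|ea eb].
  by have [/H|/ltW/H h] := leP b a; [exact|rewrite distrC [`|a - b|]distrC; exact: h].
have a0 : 0 < a by apply: lt_le_trans ea.
have b0 : 0 < b by apply: lt_le_trans eb.
rewrite !ger0_norm ?subr_ge0 ?ler_ln ?posrE // -ln_div ?posrE //.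
have -> : a / b = 1 + (a - b) / b by field; rewrite gt_eqF.
apply: (@le_trans _ _ ((a - b) / b)).
  by apply: le_ln1Dx; rewrite (lt_le_trans (ltrN10 _)) // divr_ge0 ?subr_ge0 // ltW.
by rewrite ler_wpM2l ?subr_ge0 // lef_pV2 ?posrE.
Qed.

(** The kernel is a Lipschitz function of |z - t|^2, which is itself a polynomial
in the coordinates; the second variable of the two-variable approximation
theorem is kept constant. *)
Lemma log_kernel_approx (R : realType) (D e de : R) : 0 < D -> 0 < e -> 0 < de ->
  exists2 P : R * R -> R * R -> R, bipoly P & forall z t, cdist z t ^+ 2 <= D ->
    `|P z t - 2^-1 * ln (cdist z t ^+ 2 + e)| <= de.
Proof.
move=> D0 e0 de0.
pose f (x y : R) := 2^-1 * ln (D * x + e).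
pose L := D / e / 2.
have L0 : 0 <= L by rewrite !divr_ge0 // ltW.
have de2 : 0 < de / 2 by rewrite divr_gt0.
pose K := L ^+ 2 / de.
have K0 : 0 <= K by rewrite divr_ge0 ?exprn_ge0 // ltW.
have fK x y u v : 0 <= x <= 1 -> 0 <= y <= 1 -> 0 <= u <= 1 -> 0 <= v <= 1 ->
     `|f u v - f x y| <= de / 2 + K * ((u - x) ^+ 2 + (v - y) ^+ 2).
  move=> /andP[x0 _] _ /andP[u0 _] _.
  have h : `|f u v - f x y| <= L * `|u - x|.
    rewrite /f -mulrBr normrM ger0_norm ?invr_ge0 // /L.
    have eD q : 0 <= q -> e <= D * q + e by move=> q0; rewrite lerDr mulr_ge0 // ltW.
    have := ln_increment_le e0 (eD u u0) (eD x x0).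
    have -> : D * u + e - (D * x + e) = D * (u - x) by ring.
    rewrite normrM (gtr0_norm D0) => h.
    have -> : D / e / 2 * `|u - x| = 2^-1 * (D * `|u - x| / e) by field; rewrite gt_eqF.
    by rewrite ler_pM2l ?invr_gt0.
  apply: (le_trans h).
  have h2 : L * `|u - x| <= de / 2 + K * (u - x) ^+ 2.
    rewrite -(real_normK (num_real (u - x))); set w := `|u - x|.
    have := sqr_ge0 (de - L * w); rewrite /K => h2.
    have -> : de / 2 + L ^+ 2 / de * w ^+ 2 = (de ^+ 2 / 2 + L ^+ 2 * w ^+ 2) / de.
      by field; rewrite gt_eqF.
    rewrite ler_pdivlMr //; nra.
  apply: (le_trans h2); rewrite lerD2l ler_wpM2l // lerDl; exact: sqr_ge0.
have [n nP] := bernstein2_approx de2 K0 fK.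
exists (fun z t => bernstein n (fun i => bernstein n (fun j => f (i%:R / n%:R) (j%:R / n%:R)) 0)
   (D^-1 * cdist z t ^+ 2)).
  apply: bipoly_bernstein => [i|]; first exact: bipoly_cst.
  apply: bipolyZ; exact: bipoly_sqr_cdist.
move=> z t zt.
have x01 : 0 <= D^-1 * cdist z t ^+ 2 <= 1.
  by rewrite mulr_ge0 ?invr_ge0 ?(ltW D0) ?exprn_ge0 ?cdist_ge0 //= ler_pdivrMl // mulr1.
have y01 : 0 <= (0 : R) <= 1 by rewrite lexx ler01.
have fE : f (D^-1 * cdist z t ^+ 2) 0 = 2^-1 * ln (cdist z t ^+ 2 + e).
  by rewrite /f [D * _]mulrA divff ?gt_eqF // mul1r.
by have := nP _ _ x01 y01; rewrite fE [2 * _]mulrC divfK.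
Qed.

(** * Integrals over the support and Riemann sums *)

Section integration.
Context d (T : measurableType d) (R : realType).
Variables (mu : {measure set T -> \bar R}) (H : set T).
Hypotheses (mH : measurable H) (mu1 : mu setT = 1%E) (muHC : mu (~` H) = 0%E).

(** A measure on H is a measure on the plane that does not charge the complement
of H: the following lemmas pass from integrals over the plane to integrals over
H. *)
Lemma mu_support : mu H = 1%E.
Proof.
have : mu setT = (mu H + mu (~` H))%E.
  by rewrite -[X in mu X = _](setUv H); exact: measureU mH (measurableC mH) (setICr H).
by rewrite mu1 muHC adde0.
Qed.

Lemma ge0_integral_support (f : T -> \bar R) : measurable_fun setT f ->
  (forall x, 0 <= f x)%E -> (\int[mu]_x f x = \int[mu]_(x in H) f x)%E.
Proof.
move=> mf f0; rewrite (@ge0_negligible_integral _ _ _ _ setT (~` H)) //.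
  by rewrite setDE setCK setTI.
exact: measurableC.
Qed.

Lemma integral_support (f : T -> \bar R) : measurable_fun setT f ->
  (\int[mu]_x f x = \int[mu]_(x in H) f x)%E.
Proof.
move=> mf; rewrite integralE [RHS]integralE !ge0_integral_support //.
  exact: measurable_funeneg.
exact: measurable_funepos.
Qed.

Lemma integral_cst_support (c : \bar R) : (\int[mu]_(x in H) cst c x = c)%E.
Proof. by rewrite integral_cst // mu_support mule1. Qed.

(** Stated for functions that may take the value -oo, on which integrals are not
additive without an integrability hypothesis; it holds because f is bounded
above and mu is a probability measure, and it is what turns the free entropy
into an integral of nonnegative functions. *)
Lemma integral_cstB (C : R) (f : T -> \bar R) : 0 <= C -> measurable_fun H f ->
  (forall x, H x -> f x <= C%:E)%E ->
  (\int[mu]_(x in H) f x = C%:E - \int[mu]_(x in H) (C%:E - f x))%E.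
Proof.
move=> C0 mf fC.
have mg : measurable_fun H (fun x => C%:E - f x)%E.
  by apply: emeasurable_funB => //; exact: measurable_cst.
have g0 x : H x -> (0 <= C%:E - f x)%E.
  move=> /fC; case: (f x) => [r h|//|_]; first by rewrite sube_ge0.
  exact: leey.
have mp : measurable_fun H f^\+%E by exact: measurable_funepos.
have mn : measurable_fun H f^\-%E by exact: measurable_funeneg.
have key : (\int[mu]_(x in H) f^\+ x + \int[mu]_(x in H) (C%:E - f x) =
  C%:E + \int[mu]_(x in H) f^\- x)%E.
  rewrite -[X in (_ = X + _)%E](integral_cst_support C%:E).
  rewrite -ge0_integralD // -?ge0_integralD //.
  apply: eq_integral => x; rewrite inE => Hx; have := fC x Hx.
  rewrite funeposE funenegE /=; case: (f x) => [r| |] //=.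
    move=> _; rewrite -!EFin_max -!EFinD; congr EFin.
    by rewrite /Num.max; case: ltP => h1; case: ltP => h2; lra.
  by move=> _; rewrite /maxe /= ?ltNyr ?ltNye ?lt0y //=.
have p0 : (0 <= \int[mu]_(x in H) f^\+ x)%E by apply: integral_ge0.
have pC : (\int[mu]_(x in H) f^\+ x <= C%:E)%E.
  rewrite -(integral_cst_support C%:E); apply: ge0_le_integral => //.
  by move=> x Hx; rewrite funeposE ge_max fC //= lee_fin.
have n0 : (0 <= \int[mu]_(x in H) f^\- x)%E by apply: integral_ge0.
have G0 : (0 <= \int[mu]_(x in H) (C%:E - f x))%E by apply: integral_ge0.
rewrite integralE; move: key p0 pC n0 G0.
set p := (\int[mu]_(x in H) f^\+ x)%E; set n := (\int[mu]_(x in H) f^\- x)%E.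
set g := (\int[mu]_(x in H) _)%E.
case: p => [p| |] //; case: n => [n| |] //; case: g => [g| |] //=.
move=> [h] _ _ _ _; congr EFin; lra.
Qed.

Lemma bounded_integrable (f : T -> R) (M : R) : measurable_fun H f ->
  (forall x, H x -> `|f x| <= M) -> mu.-integrable H (EFin \o f).
Proof.
move=> mf fM; apply: measurable_bounded_integrable => //.
  by rewrite mu_support ltry.
exists M; split; first exact: num_real.
by move=> M' MM' x Hx /=; apply: le_trans (ltW MM'); exact: fM.
Qed.

Section partition.
Variables (I : finType) (A : I -> set T).
Hypotheses (mA : forall i, measurable (A i)) (tA : trivIset setT A).
Hypothesis HA : H = \big[setU/set0]_(i : I) A i.

Let AH i : A i `<=` H.
Proof.
by move=> x Ax; rewrite HA -bigcup_seq; exists i => //=; rewrite mem_index_enum.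
Qed.

Definition weight i : R := fine (mu (A i)).

Let muAfin i : mu (A i) \is a fin_num.
Proof.
rewrite ge0_fin_numE //; apply: (@le_lt_trans _ _ (mu H)); last by rewrite mu_support ltry.
by apply: le_measure; rewrite ?inE //; exact: AH.
Qed.

Lemma weight_ge0 i : 0 <= weight i.
Proof. by rewrite fine_ge0. Qed.

Lemma sum_weight : \sum_i weight i = 1.
Proof.
apply: EFin_inj; rewrite -sumEFin; rewrite (eq_bigr (fun i => mu (A i))); last first.
  by move=> i _; rewrite fineK.
rewrite -mu_support -[mu H]mul1e -integral_cst // {1}HA ge0_integral_bigsetU //.
- by apply: eq_bigr => i _; rewrite integral_cst // mul1e.
- exact: index_enum_uniq.
- exact: sub_trivIset tA.
Qed.

(** The values b i are bounds on the cells, and f may be infinite: this is used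
for the logarithmic cost, which is +oo on the diagonal. *)
Lemma lower_riemann (f : T -> \bar R) (b : I -> R) : measurable_fun H f ->
  (forall x, H x -> (0 <= f x)%E) -> (forall i, 0 <= b i) ->
  (forall i x, A i x -> ((b i)%:E <= f x)%E) ->
  ((\sum_i weight i * b i)%:E <= \int[mu]_(x in H) f x)%E.
Proof.
move=> mf f0 b0 bf.
have -> : (\int[mu]_(x in H) f x = \sum_(i : I) \int[mu]_(x in A i) f x)%E.
  rewrite {1}HA ge0_integral_bigsetU //.
  - exact: index_enum_uniq.
  - exact: sub_trivIset tA.
  - by rewrite -HA.
  - by rewrite -HA.
rewrite -sumEFin; apply: lee_sum => i _.
rewrite EFinM fineK // muleC -integral_cst //.
have mfi : measurable_fun (A i) f by apply: measurable_funS mf.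
apply: ge0_le_integral => //.
- by move=> x _; rewrite lee_fin.
- exact: bf.
Qed.

(** Both inequalities come from [lower_riemann], applied to f and to - f after
adding a constant that makes them nonnegative. *)
Lemma riemann_approx (f : T -> R) (c : I -> T) (M de : R) : measurable_fun H f ->
  (forall x, H x -> `|f x| <= M) -> (forall i, H (c i)) ->
  (forall i x, A i x -> `|f x - f (c i)| <= de) ->
  `|\int[mu]_(x in H) f x - \sum_i weight i * f (c i)| <= de.
Proof.
move=> mf fM Hc fde.
have fint := bounded_integrable mf fM.
pose K := `|M| + `|de|.
have lower (g : T -> R) : measurable_fun H g -> (forall x, H x -> `|g x| <= M) ->
    (forall i x, A i x -> `|g x - g (c i)| <= de) ->
    \sum_i weight i * g (c i) - de <= \int[mu]_(x in H) g x.
  move=> mg gM gde.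
  have gint := bounded_integrable mg gM.
  have hM (x : T) : H x -> - `|M| <= g x <= `|M|.
    by move=> Hx; rewrite -ler_norml; apply: (le_trans (gM x Hx)); exact: ler_norm.
  have KK x : H x -> 0 <= g x + K.
    by move=> /hM /andP[h _]; have := normr_ge0 de; rewrite /K; lra.
  have := @lower_riemann (fun x => (g x + K)%:E) (fun i => g (c i) - de + K) _ _ _ _.
  rewrite -[X in (_ <= X)%E]fineK; last first.
    apply: integrable_fin_num => //.
    apply: (@bounded_integrable _ (M + K)).
      by apply: measurable_funD => //; exact: measurable_cst.
    move=> x Hx; apply: (le_trans (ler_normD _ _)); apply: lerD; first exact: gM.
    by rewrite ger0_norm // addr_ge0.
  rewrite lee_fin -/(Rintegral _ _ _) RintegralD //; last first.
    apply: (@bounded_integrable _ K); first exact: measurable_cst.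
    by move=> x _; rewrite ger0_norm // addr_ge0.
  rewrite Rintegral_cst // mu_support mulr1.
  have -> : \sum_i weight i * (g (c i) - de + K) =
      \sum_i weight i * g (c i) - de + K.
    under eq_bigr do rewrite -addrA mulrDr.
    by rewrite big_split /= -mulr_suml sum_weight mul1r addrA.
  rewrite lerD2r; apply.
  - by apply/measurable_EFinP; apply: measurable_funD => //; exact: measurable_cst.
  - by move=> x Hx; rewrite lee_fin KK.
  - move=> i; have /andP[h _] := hM _ (Hc i); have := ler_norm de; rewrite /K; lra.
  - move=> i x Ax; rewrite lee_fin lerD2r.
    by have := gde i x Ax; rewrite ler_norml => /andP[h _]; lra.
have h1 := lower f mf fM fde.
have := lower (fun x => - f x) _ _ _.
have -> : \int[mu]_(x in H) - f x = - \int[mu]_(x in H) f x.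
  rewrite -mulN1r -RintegralZl //; apply: eq_Rintegral => x _; by rewrite mulN1r.
have -> : \sum_i weight i * - f (c i) = - \sum_i weight i * f (c i).
  by rewrite -sumrN; apply: eq_bigr => i _; rewrite mulrN.
move=> h2; rewrite ler_norml; apply/andP; split; last first.
  have : - (\sum_i weight i * f (c i)) - de <= - \int[mu]_(x in H) f x.
    apply: h2.
    - exact: measurable_funN.
    - by move=> x Hx; rewrite normrN; exact: fM.
    - by move=> i x Ax; rewrite -opprD normrN; exact: fde.
  lra.
lra.
Qed.
End partition.
End integration.

(** * The logarithmic energy *)

Lemma measurable_funl d1 d2 d3 (T1 : measurableType d1) (T2 : measurableType d2)
    (T3 : measurableType d3) (f : T1 -> T2 -> T3) (t : T2) :
  measurable_fun setT (fun p : T1 * T2 => f p.1 p.2) ->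
  measurable_fun setT (fun z : T1 => f z t).
Proof. by move=> mf; exact: (measurable_fun_pair1 (f := fun p => f p.1 p.2) t mf). Qed.

Section log_energy.
Variable R : realType.
Implicit Types (z t : R * R) (C e : R).

(** C - ln|z - t| where it is nonnegative; the maximum matters only outside
H x H, and it makes the cost nonnegative everywhere. *)
Definition log_cost C (z t : R * R) : \bar R :=
  maxe (C%:E - lne (cdist z t)%:E)%E 0%E.

(** The logarithm is made finite on the diagonal by adding e to |z - t|^2. *)
Definition reg_log_cost C e (z t : R * R) : R :=
  Num.max (C - 2^-1 * ln (cdist z t ^+ 2 + e)) 0.

Lemma log_cost_ge0 C z t : (0 <= log_cost C z t)%E.
Proof. by rewrite /log_cost le_max lexx orbT. Qed.

Lemma reg_log_cost_ge0 C e z t : 0 <= reg_log_cost C e z t.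
Proof. by rewrite /reg_log_cost le_max lexx orbT. Qed.

Lemma measurable_lne_cdist :
  measurable_fun setT (fun p : (R * R) * (R * R) => lne (cdist p.1 p.2)%:E).
Proof.
rewrite /lne; apply: measurable_fun_ifT.
- by apply: measurable_fun_ler; [exact: measurable_fun_cdist | exact: measurable_cst].
- exact: measurable_cst.
- apply/measurable_EFinP; apply: measurableT_comp; last exact: measurable_fun_cdist.
  exact: measurable_ln.
Qed.

Lemma measurable_log_cost C :
  measurable_fun setT (fun p : (R * R) * (R * R) => log_cost C p.1 p.2).
Proof.
apply: measurable_maxe; last exact: measurable_cst.
by apply: emeasurable_funB; [exact: measurable_cst | exact: measurable_lne_cdist].
Qed.

Lemma measurable_reg_log_cost C e :
  measurable_fun setT (fun p : (R * R) * (R * R) => reg_log_cost C e p.1 p.2).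
Proof.
apply: measurable_maxr; last exact: measurable_cst.
apply: measurable_funB; first exact: measurable_cst.
apply: measurable_funM; first exact: measurable_cst.
apply: measurableT_comp; first exact: measurable_ln.
apply: measurable_funD; last exact: measurable_cst.
by apply: measurable_funX; exact: measurable_fun_cdist.
Qed.

Lemma reg_log_cost_nd C z t : nondecreasing_seq (fun m => reg_log_cost C m.+1%:R^-1 z t).
Proof.
move=> m n mn; rewrite /reg_log_cost ge_max !le_max lexx orbT andbT.
apply/orP; left; rewrite lerB // ler_pM2l ?invr_gt0 //.
have p k : 0 < cdist z t ^+ 2 + k.+1%:R^-1.
  by rewrite ltr_wpDl ?exprn_ge0 ?cdist_ge0 // invr_gt0.
by rewrite ler_ln ?posrE // lerD2l lef_pV2 ?posrE // ler_nat ltnS.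
Qed.

Lemma half_ln_sqr z t : 0 < cdist z t -> 2^-1 * ln (cdist z t ^+ 2) = ln (cdist z t).
Proof. by move=> z0; rewrite lnXn // -[ln _ *+ 2]mulr_natl mulrA mulVf ?mul1r. Qed.

Lemma reg_log_cost_cvg C z t :
  (reg_log_cost C m.+1%:R^-1 z t)%:E @[m --> \oo] --> log_cost C z t.
Proof.
have := cdist_ge0 z t; rewrite le_eqVlt => /predU1P[d0|d0].
  rewrite /log_cost -d0 /lne lexx /=; apply/cvgeyPge => A.
  near=> m; rewrite lee_fin /reg_log_cost le_max; apply/orP; left.
  rewrite -d0 expr0n add0r lnV ?posrE // mulrN opprK -lerBlDl mulrC ler_pdivlMr //.
  rewrite -[leLHS]expRK ler_ln ?posrE ?expR_gt0 //.
  apply: ltW; apply: lt_le_trans (truncnS_gt _) _; rewrite ler_nat ltnS.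
  near: m; exact: nbhs_infty_ge.
rewrite /log_cost lne_EFin // -half_ln_sqr // -EFinB -EFin_max.
apply: cvg_EFin; first by apply: nearW.
pose h y := Num.max (C - 2^-1 * ln y) 0.
apply: (@continuous_cvg _ _ _ \oo _ (fun m => cdist z t ^+ 2 + m.+1%:R^-1) h).
  apply: (@continuous_max _ _ (fun y => C - 2^-1 * ln y) (fun=> 0)); last exact: cvg_cst.
  apply: cvgB; first exact: cvg_cst.
  apply: cvgM; first exact: cvg_cst.
  by apply: continuous_ln; rewrite exprn_gt0.
rewrite -[X in _ --> X]addr0; apply: cvgD; first exact: cvg_cst.
exact: cvg_harmonic.
Unshelve. all: by end_near. Qed.

Section integrals.
Variables (mu : {measure set (R * R) -> \bar R}) (H : set (R * R)).
Hypotheses (mH : measurable H) (mu1 : mu setT = 1%E) (muHC : mu (~` H) = 0%E).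

(** The same measure, made an instance of the probability structure so that the
measurability statements of the Tonelli theorem apply. *)
Definition as_probability (h : mu setT = 1%E) : set (R * R) -> \bar R := mu.

HB.instance Definition _ (h : mu setT = 1%E) :=
  Measure.copy (as_probability h) mu.

HB.instance Definition _ (h : mu setT = 1%E) :=
  Measure_isProbability.Build _ _ _ (as_probability h) h.

Lemma measurable_inner_integral (f : R * R -> R * R -> \bar R) :
  measurable_fun setT (fun p : (R * R) * (R * R) => f p.1 p.2) ->
  (forall z t, 0 <= f z t)%E ->
  measurable_fun setT (fun t => \int[mu]_z f z t)%E.
Proof.
move=> mf f0.
apply: (@measurable_fun_fubini_tonelli_F _ _ _ _ _ (as_probability mu1) (fun p => f p.2 p.1)) => //.
have ms : measurable_fun setT (fun p : (R * R) * (R * R) => (p.2, p.1)).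
  exact: measurable_fun_pair.
exact: (measurableT_comp mf ms).
Qed.

Definition log_energy C := (\int[mu]_t \int[mu]_z log_cost C z t)%E.

(** Monotone convergence, in z for fixed t, then in t. *)
Lemma reg_log_energy_cvg C :
  (\int[mu]_t \int[mu]_z (reg_log_cost C m.+1%:R^-1 z t)%:E)%E @[m --> \oo] -->
    log_energy C.
Proof.
pose F m t := (\int[mu]_z (reg_log_cost C m.+1%:R^-1 z t)%:E)%E.
have mg m t : measurable_fun setT (fun z => (reg_log_cost C m.+1%:R^-1 z t)%:E).
  by apply/measurable_EFinP; apply: measurable_funl; exact: measurable_reg_log_cost.
have limF t : (\int[mu]_z log_cost C z t = limn (F ^~ t))%E.
  rewrite /F -monotone_convergence //.
  - by apply: eq_integral => z _; apply/esym/cvg_lim => //; exact: reg_log_cost_cvg.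
  - by move=> n z _; rewrite lee_fin reg_log_cost_ge0.
  - by move=> z _ m n mn; rewrite lee_fin; exact: reg_log_cost_nd.
have -> : log_energy C = (\int[mu]_t limn (F ^~ t))%E.
  by apply: eq_integral => t _; rewrite limF.
apply: cvg_monotone_convergence => //.
- move=> n; apply: measurable_inner_integral.
    by apply/measurable_EFinP; exact: measurable_reg_log_cost.
  by move=> z t; rewrite lee_fin reg_log_cost_ge0.
- by move=> n t _; apply: integral_ge0 => z _; rewrite lee_fin reg_log_cost_ge0.
- move=> t _ m n mn; apply: ge0_le_integral => //.
  - by move=> z _; rewrite lee_fin reg_log_cost_ge0.
  - by move=> z _; rewrite lee_fin; exact: reg_log_cost_nd.
Qed.

(** The constant is taken out of the inner and then of the outer integral.  Both
sides may be -oo. *)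
Lemma free_entropyE C : 0 <= C ->
  (forall z t, H z -> H t -> 0 < cdist z t -> ln (cdist z t) <= C) ->
  (free_entropy mu = C%:E - log_energy C)%E.
Proof.
move=> C0 lnC.
pose f z t := lne (cdist z t)%:E.
have mf := measurable_lne_cdist.
have mft t : measurable_fun setT (f ^~ t) by exact: (measurable_funl (f := f) t mf).
have mL t : measurable_fun setT (log_cost C ^~ t).
  exact: (measurable_funl (f := log_cost C) t (measurable_log_cost C)).
have fC z t : H z -> H t -> (f z t <= C%:E)%E.
  move=> Hz Ht; have := cdist_ge0 z t; rewrite /f le_eqVlt => /predU1P[<-|d0].
    by rewrite /lne lexx leNye.
  by rewrite lne_EFin // lee_fin lnC.
have fE z t : H z -> H t -> (C%:E - f z t = log_cost C z t)%E.
  move=> Hz Ht; rewrite /log_cost; apply/esym/max_idPl.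
  have := fC z t Hz Ht; rewrite /f; case: (lne _) => [r h|//|_]; first by rewrite sube_ge0.
  exact: leey.
pose I t := (\int[mu]_z f z t)%E.
pose L t := (\int[mu]_z log_cost C z t)%E.
have mLL : measurable_fun setT L.
  apply: measurable_inner_integral; first exact: measurable_log_cost.
  exact: log_cost_ge0.
have mI : measurable_fun setT I.
  rewrite (_ : I = (fun t => (\int[mu]_z (fun z => f z t)^\+%E z) -
     (\int[mu]_z (fun z => f z t)^\-%E z))%E); last first.
    by apply/funext => t; rewrite /I integralE.
  apply: emeasurable_funB; apply: (@measurable_inner_integral (fun z t => _ z)) => //.
    have := measurable_funepos mf; congr measurable_fun.
    by apply/funext => p; rewrite !funeposE.
  have := measurable_funeneg mf; congr measurable_fun.
  by apply/funext => p; rewrite !funenegE.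
have IE t : H t -> (I t = C%:E - L t)%E.
  move=> Ht; rewrite /I (integral_support mH muHC (mft t)).
  rewrite (integral_cstB mH mu1 muHC C0).
  - congr (_ - _)%E; rewrite /L (ge0_integral_support mH muHC (mL t)); last first.
      by move=> z; exact: log_cost_ge0.
    by apply: eq_integral => z; rewrite inE => Hz; exact: fE.
  - by apply: measurable_funTS.
  - by move=> z Hz; exact: fC.
rewrite /free_entropy -/(I) (integral_support mH muHC mI).
have L0 t : (0 <= L t)%E by apply: integral_ge0 => z _; exact: log_cost_ge0.
rewrite (eq_integral (fun t => C%:E - L t)%E); last first.
  by move=> t; rewrite inE => Ht; exact: IE.
rewrite (integral_cstB mH mu1 muHC C0).
- congr (_ - _)%E; rewrite /log_energy (ge0_integral_support mH muHC mLL L0).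
  apply: eq_integral => t _; rewrite -/(L t).
  by have := L0 t; case: (L t) => [r _|_|//] //=; congr EFin; lra.
- apply: measurable_funTS; apply: emeasurable_funB => //; exact: measurable_cst.
- by move=> t _; have := L0 t; case: (L t) => [r h|_|//]; rewrite ?leNye // leeBlDr // leeDl.
Qed.

End integrals.
End log_energy.

(** * Double integrals of polynomial kernels *)

Section bounded_measurable.
Context d (T : measurableType d) (R : realType).
Variables (mu : {measure set T -> \bar R}) (H : set T).
Hypotheses (mH : measurable H) (mu1 : mu setT = 1%E) (muHC : mu (~` H) = 0%E).

Definition bounded_meas (f : T -> R) :=
  measurable_fun H f /\ exists M, forall x, H x -> `|f x| <= M.

Lemma bounded_meas_integrable f : bounded_meas f -> mu.-integrable H (EFin \o f).
Proof. by move=> [mf [M fM]]; exact: (bounded_integrable mH mu1 muHC mf fM). Qed.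

Lemma bounded_meas_cst (c : R) : bounded_meas (fun=> c).
Proof. by split; [exact: measurable_cst | exists `|c|]. Qed.

Lemma bounded_measD f g : bounded_meas f -> bounded_meas g ->
  bounded_meas (fun x => f x + g x).
Proof.
move=> [mf [M fM]] [mg [N gN]]; split; first exact: measurable_funD.
by exists (M + N) => x Hx; rewrite (le_trans (ler_normD _ _)) // lerD ?fM ?gN.
Qed.

Lemma bounded_measZ (c : R) f : bounded_meas f -> bounded_meas (fun x => c * f x).
Proof.
move=> [mf [M fM]]; split.
  by apply: measurable_funM => //; exact: measurable_cst.
by exists (`|c| * M) => x Hx; rewrite normrM ler_wpM2l // fM.
Qed.

Lemma bounded_meas_sum (I : Type) (s : seq I) (F : I -> T -> R) :
  (forall i, bounded_meas (F i)) -> bounded_meas (fun x => \sum_(i <- s) F i x).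
Proof.
move=> bF; elim: s => [|i s IH].
  by under eq_fun do rewrite big_nil; exact: bounded_meas_cst.
by under eq_fun do rewrite big_cons; exact: bounded_measD.
Qed.

Lemma Rintegral_sum (I : Type) (s : seq I) (F : I -> T -> R) :
  (forall i, bounded_meas (F i)) ->
  \int[mu]_(x in H) (\sum_(i <- s) F i x) = \sum_(i <- s) \int[mu]_(x in H) F i x.
Proof.
move=> bF; elim: s => [|i s IH].
  under eq_Rintegral do rewrite big_nil.
  by rewrite big_nil Rintegral_cst // mul0r.
rewrite big_cons -IH -RintegralD //.
- by apply: eq_Rintegral => x _; rewrite big_cons.
- exact: bounded_meas_integrable.
- by apply: bounded_meas_integrable; exact: bounded_meas_sum.
Qed.

End bounded_measurable.

Section polynomial_approximation.
Variables (R : realType) (a1 b1 a2 b2 : R) (H : set (R * R)).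
Variables (mu : {measure set (R * R) -> \bar R}).
Hypotheses (hab1 : a1 < b1) (hab2 : a2 < b2).
Hypothesis hH : H = `[a1, b1] `*` `[a2, b2].
Hypotheses (mu1 : mu setT = 1%E) (muHC : mu (~` H) = 0%E).

Let mH : measurable H := measurable_rect hH.

Let HP z : H z <-> box a1 b1 a2 b2 z.
Proof. by rewrite hH; exact: boxP. Qed.

(** The rectangle is rescaled to the unit square.  Uniform continuity controls
nearby points, and boundedness of f gives the quadratic bound for distant
ones. *)
Lemma bipoly_approx (f : R * R -> R) (de : R) : {within H, continuous f} -> 0 < de ->
  exists2 p : R * R -> R, bipoly (fun z _ => p z) &
    forall z, H z -> `|p z - f z| <= de.
Proof.
move=> cf de0.
have [M M0 fM] := bounded_on_rect hab1 hab2 hH cf.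
have de2 : 0 < de / 2 by rewrite divr_gt0.
have [r r0 fr] := rect_unif_continuous hH cf de2.
pose L1 := b1 - a1; pose L2 := b2 - a2.
have L10 : 0 < L1 by rewrite subr_gt0.
have L20 : 0 < L2 by rewrite subr_gt0.
pose q (x y : R) : R * R := (a1 + L1 * x, a2 + L2 * y).
have qH x y : 0 <= x <= 1 -> 0 <= y <= 1 -> H (q x y).
  move=> /andP[x0 x1] /andP[y0 y1]; apply/HP; rewrite /q /box /=.
  have h1 : 0 <= L1 * x by rewrite mulr_ge0 // ltW.
  have h2 : L1 * x <= L1 by rewrite ler_piMr // ltW.
  have h3 : 0 <= L2 * y by rewrite mulr_ge0 // ltW.
  have h4 : L2 * y <= L2 by rewrite ler_piMr // ltW.
  by split; apply/andP; split; rewrite /L1 /L2 in h1 h2 h3 h4 *; lra.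
pose K := 2 * M / r ^+ 2 * (L1 ^+ 2 + L2 ^+ 2).
have K0 : 0 <= K.
  by rewrite !mulr_ge0 // ?invr_ge0 ?addr_ge0 ?exprn_ge0 // ltW.
have fK x y u v : 0 <= x <= 1 -> 0 <= y <= 1 -> 0 <= u <= 1 -> 0 <= v <= 1 ->
    `|f (q u v) - f (q x y)| <= de / 2 + K * ((u - x) ^+ 2 + (v - y) ^+ 2).
  move=> x01 y01 u01 v01; have Hu := qH u v u01 v01; have Hx := qH x y x01 y01.
  have sx := sqr_ge0 (u - x); have sy := sqr_ge0 (v - y).
  have [h|h] := leP (cdist (q u v) (q x y)) r.
    apply: (le_trans (fr _ _ Hu Hx h)); rewrite lerDl mulr_ge0 // addr_ge0 //.
  have c2 : cdist (q u v) (q x y) ^+ 2 <= (L1 ^+ 2 + L2 ^+ 2) * ((u - x) ^+ 2 + (v - y) ^+ 2).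
    rewrite cdistE sqr_sqrtr ?addr_ge0 ?sqr_ge0 // /q /=.
    have -> : a1 + L1 * u - (a1 + L1 * x) = L1 * (u - x) by ring.
    have -> : a2 + L2 * v - (a2 + L2 * y) = L2 * (v - y) by ring.
    rewrite !exprMn mulrDl !mulrDr.
    have := mulr_ge0 (sqr_ge0 L1) sy; have := mulr_ge0 (sqr_ge0 L2) sx; lra.
  have h1 : `|f (q u v) - f (q x y)| <= 2 * M.
    by have := ler_normB (f (q u v)) (f (q x y)); have := fM _ Hu; have := fM _ Hx; lra.
  have h2 : 1 <= cdist (q u v) (q x y) ^+ 2 / r ^+ 2.
    by rewrite ler_pdivlMr ?exprn_gt0 // mul1r ler_sqr ?nnegrE ?ltW // (lt_trans r0).
  apply: (le_trans h1); rewrite -[leLHS]mulr1.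
  apply: (@le_trans _ _ (2 * M * (cdist (q u v) (q x y) ^+ 2 / r ^+ 2))).
    by rewrite ler_wpM2l // mulr_ge0.
  apply: (@le_trans _ _ (K * ((u - x) ^+ 2 + (v - y) ^+ 2))); last by rewrite lerDr ltW.
  have -> : K * ((u - x) ^+ 2 + (v - y) ^+ 2) = 2 * M *
     ((L1 ^+ 2 + L2 ^+ 2) * ((u - x) ^+ 2 + (v - y) ^+ 2) / r ^+ 2) by rewrite /K; ring.
  by rewrite ler_wpM2l ?mulr_ge0 // ler_wpM2r // invr_ge0 exprn_ge0 // ltW.
have [n nP] := bernstein2_approx (f := fun x y => f (q x y)) de2 K0 fK.
exists (fun z => bernstein n (fun i => bernstein n (fun j => f (q (i%:R / n%:R) (j%:R / n%:R)))
   (L2^-1 * (z.2 - a2))) (L1^-1 * (z.1 - a1))).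
  apply: (@bipoly_bernstein R n (fun i z _ => bernstein n (fun j =>
    f (q (i%:R / n%:R) (j%:R / n%:R))) (L2^-1 * (z.2 - a2)))
    (fun z _ => L1^-1 * (z.1 - a1))) => [i|].
    apply: (@bipoly_bernstein R n (fun j _ _ => f (q (i%:R / n%:R) (j%:R / n%:R)))
     (fun z _ => L2^-1 * (z.2 - a2))) => [j|]; first exact: bipoly_cst.
    by apply: bipolyZ; apply: bipolyB; [exact: bipoly_fst2 | exact: bipoly_cst].
  by apply: bipolyZ; apply: bipolyB; [exact: bipoly_fst1 | exact: bipoly_cst].
move=> z /HP[/andP[x1 x2] /andP[y1 y2]].
have in01 (l a b x : R) : 0 < l -> l = b - a -> a <= x -> x <= b -> 0 <= l^-1 * (x - a) <= 1.
  move=> l0 lE ax xb; rewrite mulr_ge0 ?invr_ge0 ?(ltW l0) ?subr_ge0 //=.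
  by rewrite ler_pdivrMl // mulr1 lE lerD2r.
have := nP _ _ (in01 L1 a1 b1 z.1 L10 erefl x1 x2) (in01 L2 a2 b2 z.2 L20 erefl y1 y2).
have -> : q (L1^-1 * (z.1 - a1)) (L2^-1 * (z.2 - a2)) = z.
  by rewrite /q !mulVKf ?gt_eqF // !addrA ![_ + _ - _]addrAC !subrr !add0r; case: (z).
by rewrite [2 * _]mulrC divfK.
Qed.

Lemma measurable_bipoly_l (p : R * R -> R) : bipoly (fun z _ => p z) -> measurable_fun setT p.
Proof.
move=> [s sP].
have -> : p = (fun z => \sum_(e <- s) biterm e z (0, 0)).
  by apply/funext => z; exact: (sP z (0, 0)).
apply: measurable_sum => e; rewrite /biterm.
apply: measurable_funM; first exact: measurable_cst.
apply: measurable_funM; last exact: measurable_cst.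
exact: measurable_monomial.
Qed.

(** A uniform limit of polynomials. *)
Lemma measurable_within_continuous (f : R * R -> R) : {within H, continuous f} ->
  measurable_fun H f.
Proof.
move=> cf.
have ex (n : nat) : exists p : R * R -> R, measurable_fun setT p /\
   forall z, H z -> `|p z - f z| <= n.+1%:R^-1.
  have n0 : 0 < n.+1%:R^-1 :> R by rewrite invr_gt0.
  have [p bp pf] := bipoly_approx cf n0.
  by exists p; split => //; exact: measurable_bipoly_l.
have [p pP] := choice ex.
apply: (measurable_fun_cvg (h := p)).
  by move=> n; apply: measurable_funTS; have [] := pP n.
move=> z Hz; apply/cvgrPdist_le => e e0; near=> n.
have [_ /(_ z Hz)] := pP n; rewrite distrC => /le_trans; apply.
rewrite -[leRHS]invrK lef_pV2 ?posrE ?invr_gt0 //.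
apply: ltW; apply: lt_le_trans (truncnS_gt _) _; rewrite ler_nat ltnS.
near: n; exact: nbhs_infty_ge.
Unshelve. all: by end_near. Qed.

Lemma bounded_meas_continuous (f : R * R -> R) : {within H, continuous f} ->
  bounded_meas H f.
Proof.
move=> cf; split; first exact: measurable_within_continuous.
by have [M _ fM] := bounded_on_rect hab1 hab2 hH cf; exists M.
Qed.

Lemma bounded_meas_monomial n1 n2 : bounded_meas H (monomial n1 n2 : R * R -> R).
Proof.
split; first by apply: measurable_funTS; exact: measurable_monomial.
have [M _ hM] := lipschitz_monomial hH n1 n2; exists M => z Hz.
by have [] := hM z z Hz Hz.
Qed.

Definition moment (al : nat * nat) : R := \int[mu]_(z in H) monomial al.1 al.2 z.

Definition bimoment (s : seq (R * (nat * nat) * (nat * nat))) : R :=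
  \sum_(e <- s) e.1.1 * (moment e.1.2 * moment e.2).

(** A pointwise inequality between bounded kernels, integrated twice against mu;
the double integral of the polynomial part is expressed by the moments. *)
Lemma bimoment_le (s : seq (R * (nat * nat) * (nat * nat))) (g : R * R -> R * R -> R)
    (f : R * R -> R) (K B : R) :
  measurable_fun setT (fun p : (R * R) * (R * R) => g p.1 p.2) ->
  (forall z t, 0 <= g z t) -> (forall z t, H z -> H t -> g z t <= B) ->
  bounded_meas H f ->
  (forall z t, H z -> H t -> \sum_(e <- s) biterm e z t + g z t <= K - f z - f t) ->
  ((bimoment s)%:E + \int[mu]_t \int[mu]_z (g z t)%:E <=
    (K - 2 * \int[mu]_(z in H) f z)%:E)%E.
Proof.
move=> mg g0 gB bf hle.
have mgE : measurable_fun setT (fun p : (R * R) * (R * R) => (g p.1 p.2)%:E).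
  exact/measurable_EFinP.
have g0E z t : (0 <= (g z t)%:E)%E by rewrite lee_fin.
have mgt t : measurable_fun setT (g ^~ t) by exact: (measurable_funl (f := g) t mg).
pose ga t := \int[mu]_(z in H) g z t.
have bgt t : H t -> bounded_meas H (g ^~ t).
  move=> Ht; split; first exact: measurable_funTS.
  by exists B => z Hz; rewrite ger0_norm // gB.
have gaE t : H t -> (\int[mu]_z (g z t)%:E = (ga t)%:E)%E.
  move=> Ht; rewrite (ge0_integral_support mH muHC) //; last exact/measurable_EFinP.
  by rewrite /ga /Rintegral fineK // integrable_fin_num // ;
    apply: (bounded_meas_integrable mH mu1 muHC); exact: bgt.
have ga0 t : 0 <= ga t by apply: Rintegral_ge0.
have gaB t : H t -> ga t <= B.
  move=> Ht; rewrite -[B]mulr1 -[X in _ <= _ * X](_ : fine (mu H) = 1); last first.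
    by rewrite (mu_support mH mu1 muHC).
  rewrite -Rintegral_cst //; apply: le_Rintegral => //.
  - by apply: (bounded_meas_integrable mH mu1 muHC); exact: bgt.
  - by apply: (bounded_meas_integrable mH mu1 muHC); exact: bounded_meas_cst.
  - by move=> z Hz; exact: gB.
have bga : bounded_meas H ga.
  split; last by exists B => t Ht; rewrite ger0_norm // gaB.
  apply: (eq_measurable_fun (fun t => fine (\int[mu]_z (g z t)%:E)%E)).
    by move=> t; rewrite inE => Ht; rewrite gaE.
  apply: measurable_funTS; apply: measurableT_comp; first exact: fine_measurable.
  exact: (measurable_inner_integral mu1 mgE).
have -> : (\int[mu]_t \int[mu]_z (g z t)%:E = (\int[mu]_(t in H) ga t)%:E)%E.
  rewrite (ge0_integral_support mH muHC); last 2 first.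
  - exact: (measurable_inner_integral mu1 mgE).
  - by move=> t; apply: integral_ge0.
  rewrite /Rintegral fineK; last first.
    apply: integrable_fin_num => //.
    exact: (bounded_meas_integrable mH mu1 muHC).
  by apply: eq_integral => t; rewrite inE => Ht; rewrite gaE.
pose Ph t := \sum_(e <- s) e.1.1 * (moment e.1.2 * monomial e.2.1 e.2.2 t).
have bPh : bounded_meas H Ph.
  apply: bounded_meas_sum => e; apply: bounded_measZ; apply: bounded_measZ.
  exact: bounded_meas_monomial.
have intc (c : R) : \int[mu]_(z in H) c = c.
  by rewrite Rintegral_cst // (mu_support mH mu1 muHC) mulr1.
have I b := bounded_meas_integrable mH mu1 muHC b.
have bfN : bounded_meas H (fun z => - f z).
  have := bounded_measZ (-1) bf; congr bounded_meas.
  by apply/funext => z; rewrite mulN1r.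
have intN : \int[mu]_(z in H) - f z = - \int[mu]_(z in H) f z.
  rewrite -mulN1r -RintegralZl //; last exact: I.
  by apply: eq_Rintegral => z _; rewrite mulN1r.
pose sf := \int[mu]_(z in H) f z.
have inner t : H t -> Ph t + ga t <= K - sf + - f t.
  move=> Ht.
  have bt e : bounded_meas H (fun z => biterm e z t).
    rewrite /biterm; have := bounded_measZ (e.1.1 * monomial e.2.1 e.2.2 t)
      (bounded_meas_monomial e.1.2.1 e.1.2.2).
    by congr bounded_meas; apply/funext => z; ring.
  have -> : Ph t = \int[mu]_(z in H) \sum_(e <- s) biterm e z t.
    rewrite (Rintegral_sum mH mu1 muHC) //; apply: eq_bigr => e _.
    rewrite /biterm RintegralZl //; last first.
      apply: I; have := bounded_measZ (monomial e.2.1 e.2.2 t)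
        (bounded_meas_monomial e.1.2.1 e.1.2.2).
      by congr bounded_meas; apply/funext => z; ring.
    congr (_ * _); rewrite RintegralZr //; apply: I; exact: bounded_meas_monomial.
  rewrite -RintegralD //; [|apply: I; exact: bounded_meas_sum|apply: I; exact: bgt].
  have -> : K - sf + - f t = \int[mu]_(z in H) ((K - f t) + - f z).
    rewrite RintegralD ?intc ?intN //; last exact: I.
      by rewrite /sf; ring.
    by apply: I; exact: bounded_meas_cst.
  apply: le_Rintegral => //.
  - apply: I; apply: bounded_measD; [exact: bounded_meas_sum | exact: bgt].
  - by apply: I; apply: bounded_measD => //; exact: bounded_meas_cst.
  - by move=> z Hz; have := hle z t Hz Ht; lra.
rewrite -EFinD lee_fin.
have -> : bimoment s = \int[mu]_(t in H) Ph t.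
  rewrite (Rintegral_sum mH mu1 muHC); last first.
    by move=> e; apply: bounded_measZ; apply: bounded_measZ; exact: bounded_meas_monomial.
  apply: eq_bigr => e _; rewrite RintegralZl //; last first.
    by apply: I; apply: bounded_measZ; exact: bounded_meas_monomial.
  rewrite RintegralZl //; apply: I; exact: bounded_meas_monomial.
rewrite -RintegralD //; [|exact: I|exact: I].
have -> : K - 2 * sf = \int[mu]_(t in H) (K - sf + - f t).
  rewrite RintegralD ?intc ?intN //; last exact: I.
    by rewrite /sf; ring.
  by apply: I; exact: bounded_meas_cst.
apply: le_Rintegral => //.
- by apply: I; exact: bounded_measD.
- by apply: I; apply: bounded_measD => //; exact: bounded_meas_cst.
Qed.

End polynomial_approximation.

(** * Upper bound for the integrals *)

(** The weight phi^(2n) contributes - 2 n S(lam_i) for each i.  Splitting this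
over the ordered pairs (i, j) with j != i uses 2 (n - 1) of these terms and
leaves - 2 S(lam_i). *)
Lemma ln_sqr_wVDM (R : realType) (phi : R * R -> R) n (lam : n.-tuple (R * R)) :
  let S z := - ln (phi z) in
  (forall i j, i != j -> 0 < cdist (tnth lam i) (tnth lam j)) ->
  (forall i, 0 < phi (tnth lam i)) ->
  0 < cmod (wVDM phi lam) /\
  ln (cmod (wVDM phi lam) ^+ 2) =
    \sum_(i < n) \sum_(j < n | j != i)
      (ln (cdist (tnth lam i) (tnth lam j)) - S (tnth lam i) - S (tnth lam j))
    - 2 * \sum_(i < n) S (tnth lam i).
Proof.
move=> S dis pos; have [w0 ->] := ln_cmod_wVDM dis pos; split => //.
pose G (i j : 'I_n) := ln (cdist (tnth lam i) (tnth lam j)) - S (tnth lam i) - S (tnth lam j).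
pose SS := \sum_(i < n) S (tnth lam i).
have Gs i j : G i j = G j i by rewrite /G cdistC; ring.
have e2 : \sum_(i < n) ln (phi (tnth lam i)) = - SS.
  by rewrite /SS -sumrN; apply: eq_bigr => i _; rewrite /S opprK.
pose Sij (i j : 'I_n) := S (tnth lam i) + S (tnth lam j).
have h1 : \sum_(i < n) \sum_(j < n | (j < i)%N) ln (cdist (tnth lam i) (tnth lam j)) =
  \sum_(i < n) \sum_(j < n | (j < i)%N) G i j +
  \sum_(i < n) \sum_(j < n | (j < i)%N) Sij i j.
  rewrite -big_split; apply: eq_bigr => i _; rewrite -big_split; apply: eq_bigr => j _.
  by rewrite /G /Sij /=; ring.
have h2 : 2 * (\sum_(i < n) \sum_(j < n | (j < i)%N) Sij i j) = 2 * (n%:R * SS) - 2 * SS.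
  have := @sum_pairs _ _ Sij (fun i j => addrC _ _).
  have -> : \sum_(i < n) Sij i i = 2 * SS.
    by rewrite /SS mulr_sumr; apply: eq_bigr => i _; rewrite /Sij; ring.
  have -> : \sum_(i < n) \sum_(j < n) Sij i j = 2 * (n%:R * SS).
    rewrite (eq_bigr (fun i : 'I_n => n%:R * S (tnth lam i) + SS)); last first.
      by move=> i _; rewrite big_split /= sumr_const card_ord mulr_natl.
    by rewrite big_split /= -mulr_sumr -/SS sumr_const card_ord -[SS *+ n]mulr_natl; ring.
  lra.
have h3 := @sum_off_diag _ _ G Gs.
rewrite e2 h1 -/SS; rewrite /G in h3 *; lra.
Qed.

Lemma wVDM_neq0_distinct (R : realType) (phi : R * R -> R) n (lam : n.-tuple (R * R)) :
  cmod (wVDM phi lam) != 0 ->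
  forall i j, i != j -> 0 < cdist (tnth lam i) (tnth lam j).
Proof.
move=> w0 i j ij; rewrite lt_def cdist_ge0 andbT; apply: contra_neq w0.
exact: (wVDM_eq0 phi ij).
Qed.

Section upper_bound.
Variables (R : realType) (a1 b1 a2 b2 : R) (H : set (R * R)).
Variables (mu : {measure set (R * R) -> \bar R}) (phi : R * R -> R).
Variables (tau : {finite_measure set (R * R)%type -> \bar R}).
Hypotheses (hab1 : a1 < b1) (hab2 : a2 < b2).
Hypothesis hH : H = `[a1, b1] `*` `[a2, b2].
Hypotheses (mu1 : mu setT = 1%E) (muHC : mu (~` H) = 0%E).

Let mH : measurable H := measurable_rect hH.

(** The double sum of a polynomial over a tuple is a polynomial in the moments
of its empirical measure; k is at least all degrees that occur, and eps is
chosen by continuity of the product of two moments. *)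
Lemma bipoly_moments (s : seq (R * (nat * nat) * (nat * nat))) (de : R) : 0 < de ->
  exists (k : nat) (eps : R), 0 < eps /\ forall d (lam : d.-tuple (R * R)),
    @Gtilde R H mu d k eps lam ->
    (d%:R ^+ 2)^-1 *
      (\sum_(i < d) \sum_(j < d) \sum_(e <- s) biterm e (tnth lam i) (tnth lam j))
    <= bimoment H mu s + de.
Proof.
move=> de0.
pose k := (\sum_(e <- s) (e.1.2.1 + e.1.2.2 + e.2.1 + e.2.2))%N.
pose W := \sum_(e <- s) `|e.1.1| * (`|moment H mu e.1.2| + `|moment H mu e.2| + 1).
have W0 : 0 <= W by apply: sumr_ge0 => e _; rewrite mulr_ge0 // !addr_ge0.
pose eps := Num.min 1 (de / (W + 1)).
have W1 : 0 < W + 1 by rewrite ltr_wpDl.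
have eps0 : 0 < eps by rewrite lt_min ltr01 divr_gt0.
have eps1 : eps <= 1 by rewrite ge_min lexx.
have epsW : eps * W <= de.
  apply: (@le_trans _ _ (de / (W + 1) * W)).
    by rewrite ler_wpM2r // ge_min lexx orbT.
  by rewrite mulrAC ler_pdivrMr // ler_pM2l //; lra.
exists k, eps; split => // d lam [lH [[kT _] lG]].
have d0 : (0 < d)%N.
  rewrite lt0n; apply/negP => /eqP d0; move: kT; rewrite /kappa /= /mscale /= /msum.
  rewrite big1 ?mule0; last by move=> i _; have := ltn_ord i; rewrite {2}d0.
  by move=> /eqP; rewrite eqe eq_sym oner_eq0.
have dr : d%:R != 0 :> R by rewrite pnatr_eq0 -lt0n.
pose nu (al : nat * nat) := d%:R^-1 * \sum_(i < d) monomial al.1 al.2 (tnth lam i).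
have close al : (al.1 + al.2 <= k)%N -> `|nu al - moment H mu al| <= eps.
  move=> alk; have := lG al.1 al.2 alk.
  rewrite (Rintegral_kappa mH (measurable_monomial al.1 al.2) lH).
  by rewrite distrC => /ltW.
have -> : (d%:R ^+ 2)^-1 *
    (\sum_(i < d) \sum_(j < d) \sum_(e <- s) biterm e (tnth lam i) (tnth lam j)) =
    \sum_(e <- s) e.1.1 * (nu e.1.2 * nu e.2).
  under eq_bigr do rewrite exchange_big.
  rewrite exchange_big /= mulr_sumr; apply: eq_bigr => e _; rewrite /biterm.
  under eq_bigr do rewrite -mulr_sumr -mulr_sumr.
  by rewrite -mulr_sumr -mulr_suml /nu; field.
rewrite /bimoment -lerBlDl -sumrB; apply: le_trans epsW.
rewrite /W mulr_sumr big_seq [leRHS]big_seq; apply: ler_sum => e es.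
have le1 : (e.1.2.1 + e.1.2.2 + e.2.1 + e.2.2 <= k)%N.
  by rewrite /k (big_rem e) //= leq_addr.
have h1 : `|nu e.1.2 - moment H mu e.1.2| <= eps.
  by apply: close; apply: leq_trans le1; rewrite -addnA leq_addr.
have h2 : `|nu e.2 - moment H mu e.2| <= eps.
  by apply: close; apply: leq_trans le1; rewrite -addnA leq_addl.
rewrite -mulrBr; apply: (le_trans (ler_norm _)); rewrite normrM [leRHS]mulrCA.
rewrite ler_wpM2l //.
set x := nu e.1.2 in h1 *; set y := nu e.2 in h2 *.
set m1 := moment _ _ e.1.2 in h1 *; set m2 := moment _ _ e.2 in h2 *.
have -> : x * y - m1 * m2 = (x - m1) * (y - m2) + (x - m1) * m2 + m1 * (y - m2) by ring.
apply: (le_trans (ler_normD _ _)).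
apply: (le_trans (lerD (ler_normD _ _) (lexx _))); rewrite !normrM.
have q1 : `|x - m1| * `|y - m2| <= eps * 1 by rewrite ler_pM // (le_trans h2).
have q2 : `|x - m1| * `|m2| <= eps * `|m2| by rewrite ler_wpM2r.
have q3 : `|m1| * `|y - m2| <= eps * `|m1| by rewrite mulrC ler_wpM2r.
lra.
Qed.

Hypothesis hphi : {within H, continuous phi}.
Hypothesis hphi0 : forall z, H z -> 0 < phi z.

Let S z := - ln (phi z).

Lemma continuous_weight : {within H, continuous S}.
Proof.
move/subspace_continuousP : hphi => pc; apply/subspace_continuousP => z Hz.
apply: cvgN; apply: continuous_cvg; last exact: pc.
by apply: continuous_ln; exact: hphi0.
Qed.

Let L := (b1 - a1) + (b2 - a2).
Let C := 2^-1 * ln (L ^+ 2 + 1).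

Let diam_gt0 : 0 < L.
Proof. by rewrite addr_gt0 // subr_gt0. Qed.

Ltac drop_local_hyps :=
  clear - hab1 hab2 mu1 muHC hphi hphi0 tau mH S C diam_gt0.

Lemma log_bound_ge0 : 0 <= C.
Proof.
by rewrite mulr_ge0 ?invr_ge0 // ln_ge0 // lerDr exprn_ge0 // ltW // diam_gt0.
Qed.

Lemma cdist_sqr_le z t : H z -> H t -> cdist z t ^+ 2 <= L ^+ 2.
Proof.
move=> Hz Ht; have hL : cdist z t <= L by exact: (rect_cdist_le hH).
by rewrite ler_sqr // nnegrE ?cdist_ge0 // ltW.
Qed.

Lemma ln_cdist_le z t : H z -> H t -> 0 < cdist z t -> ln (cdist z t) <= C.
Proof.
move=> Hz Ht d0; rewrite -half_ln_sqr // /C ler_pM2l ?invr_gt0 //.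
have := cdist_sqr_le Hz Ht => h.
by rewrite ler_ln ?posrE ?exprn_gt0 //; have := exprn_gt0 2 d0; lra.
Qed.

Lemma J_le_bound (M tt : R) n (k : nat) (eps : R) :
  0 <= M -> 0 <= tt -> tau setT = tt%:E ->
  (forall lam, @Gtilde R H mu n k eps lam -> cmod (wVDM phi lam) ^+ 2 <= M) ->
  (J H mu phi tau n k eps <= (M * expR (n%:R * tt))%:E)%E.
Proof.
move=> M0 tt0 ttE MG; rewrite /J; apply: (@le_trans _ _ (M%:E * tuple_measure tau n setT)%E).
  apply: ge0_integral_le_cst; first exact: M0.
  - by move=> lam _; rewrite lee_fin exprn_ge0 // cmod_ge0.
  - by move=> lam lG; rewrite lee_fin; exact: MG.
have -> : tuple_measure tau n setT = (tt ^+ n)%:E.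
  by rewrite EFin_expe -ttE; exact: tuple_measure_setT.
rewrite -EFinM lee_fin ler_wpM2l // expRM_natl.
apply: lerXn2r; rewrite ?nnegrE ?expR_ge0 //.
by have := expR_ge1Dx tt; lra.
Qed.

(** The polynomial F dominates the kernel of the energy on H x H off the
diagonal, so that the sum over pairs of distinct indices is at most the full
double sum of F minus its diagonal; the diagonal contributes O(n). *)
Lemma eventually_le_J (A : R) :
  (free_entropy mu - 2%:E * \int[mu]_(z in H) (S z)%:E < A%:E)%E ->
  exists (k : nat) (eps : R), 0 < eps /\ exists N0 : nat, forall n, (N0 <= n)%N ->
    (J H mu phi tau n k eps <= (expR (n%:R ^+ 2 * A))%:E)%E.
Proof.
have bS := bounded_meas_continuous hab1 hab2 hH continuous_weight.
have iS := bounded_meas_integrable mH mu1 muHC bS.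
pose sS := \int[mu]_(z in H) S z.
have -> : (\int[mu]_(z in H) (S z)%:E = sS%:E)%E.
  by rewrite /sS /Rintegral fineK // integrable_fin_num.
rewrite (free_entropyE mH mu1 muHC log_bound_ge0 ln_cdist_le) => hA.
have [m hm] : exists m : nat, ((C - A - 2 * sS)%:E <
    \int[mu]_t \int[mu]_z (reg_log_cost C m.+1%:R^-1 z t)%:E)%E.
  apply: contrapT => no.
  have cv := @reg_log_energy_cvg R mu mu1 C.
  have : (log_energy mu C <= (C - A - 2 * sS)%:E)%E.
    apply: (cvge_to_le cv); apply: nearW => m; rewrite leNgt; apply/negP => h.
    by apply: no; exists m.
  move=> h; move: hA; rewrite ltNge => /negP; apply.
  move: h; case: (log_energy mu C) => [g| |] //=; last by rewrite leey.
  by rewrite !lee_fin; lra.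
set RE := (\int[mu]_t _)%E in hm.
pose e : R := m.+1%:R^-1.
have e0 : 0 < e by rewrite invr_gt0.
have e1 : e <= 1 by rewrite invf_le1 // ler1n.
have RE0 : (0 <= RE)%E.
  by apply: integral_ge0 => t _; apply: integral_ge0 => z _; rewrite lee_fin reg_log_cost_ge0.
have [y hy hy2] : exists2 y : R, C - A - 2 * sS < y & (y%:E <= RE)%E.
  case: RE hm RE0 => [y h _|_ _|//]; first by exists y.
  by exists (C - A - 2 * sS + 1); rewrite ?leey // ltrDl.
pose gap := y - (C - A - 2 * sS).
have gap0 : 0 < gap by rewrite subr_gt0.
pose de := gap / 16.
have de0 : 0 < de by rewrite divr_gt0.
have L0 : 0 < L ^+ 2 by rewrite exprn_gt0.
have [P [sP sPE] PP] := log_kernel_approx L0 e0 de0.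
have [p [sp spE] pP] := bipoly_approx hab1 hab2 hH continuous_weight de0.
have [s sE] : bipoly (fun z t => P z t - p z - p t + 3 * de).
  apply: bipolyD; last exact: bipoly_cst.
  apply: bipolyB; last by apply: bipoly_swap; exists sp.
  by apply: bipolyB; [exists sP | exists sp].
(* The polynomial P - p - p + 3 de lies above the kernel, since P and the two
   copies of p each err by at most de; it exceeds the regularized kernel by at
   most 6 de. *)
pose F z t := \sum_(e <- s) biterm e z t.
have cE z t : H z -> H t -> reg_log_cost C e z t = C - 2^-1 * ln (cdist z t ^+ 2 + e).
  move=> Hz Ht; apply/max_idPl; rewrite subr_ge0 /C ler_pM2l ?invr_gt0 //.
  have h := cdist_sqr_le Hz Ht; have h0 := exprn_ge0 2 (cdist_ge0 z t).
  by rewrite ler_ln ?posrE; move: h h0 e0 e1; drop_local_hyps; lra.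
have lF z t : H z -> H t -> 0 < cdist z t -> ln (cdist z t) - S z - S t <= F z t.
  move=> Hz Ht d0; rewrite /F -sE.
  have := PP z t (cdist_sqr_le Hz Ht); have := pP z Hz; have := pP t Ht.
  rewrite !ler_norml => /andP[_ h1] /andP[_ h2] /andP[h3 _].
  have : ln (cdist z t) <= 2^-1 * ln (cdist z t ^+ 2 + e).
    rewrite -half_ln_sqr // ler_pM2l ?invr_gt0 // ler_ln ?posrE ?exprn_gt0 ?lerDl ?(ltW e0) //.
    by rewrite addr_gt0 // exprn_gt0.
  lra.
have uF z t : H z -> H t -> F z t + reg_log_cost C e z t <= C + 6 * de - S z - S t.
  move=> Hz Ht; rewrite cE // /F -sE.
  have := PP z t (cdist_sqr_le Hz Ht); have := pP z Hz; have := pP t Ht.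
  rewrite !ler_norml => /andP[h1 _] /andP[h2 _] /andP[_ h3]; lra.
have bi : bimoment H mu s + y <= C + 6 * de - 2 * sS.
  rewrite -lee_fin; apply: le_trans (bimoment_le hH mu1 muHC (B := C - 2^-1 * ln e) _ _ _ bS uF).
  - by rewrite EFinD leeD2l.
  - exact: measurable_reg_log_cost.
  - by move=> z t; exact: reg_log_cost_ge0.
  - move=> z t Hz Ht; rewrite cE // lerB // ler_pM2l ?invr_gt0 //.
    have h0 := exprn_ge0 2 (cdist_ge0 z t).
    by rewrite ler_ln ?posrE //; lra.
have [k [eps [eps0 kP]]] := bipoly_moments s de0.
exists k, eps; split => //.
pose Q := \sum_(e <- s) `|biterm e (0, 0) (0, 0)|.
(* Bound for the diagonal of F and for the terms - 2 S left over. *)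
have [K K0 FK] : exists2 K : R, 0 <= K & forall z, H z -> - F z z - 2 * S z <= K.
  have [_ [M SM]] := bS.
  have [M2 hM2] : exists M2 : R, forall z, H z -> - M2 <= F z z.
    exists (`|2^-1 * ln e| + `|M| * 2 + 3 * de + 3 * de) => z Hz; rewrite /F -sE.
    have := PP z z (cdist_sqr_le Hz Hz); have := pP z Hz.
    rewrite !ler_norml => /andP[_ h1] /andP[h3 _].
    have := SM z Hz; have := ler_norm M; rewrite cdistxx expr0n /= add0r in h3.
    rewrite ler_norml => h4 /andP[h5 h6].
    have := ler_norm (- (2^-1 * ln e)); rewrite normrN; lra.
  exists (`|M2| + 2 * `|M|); first by rewrite addr_ge0 // mulr_ge0.
  move=> z Hz; have := hM2 z Hz; have := SM z Hz; rewrite ler_norml => /andP[h1 h2] h3.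
  have := ler_norm M; have := ler_norm M2; lra.
pose tt := fine (tau setT).
have ttE : tau setT = tt%:E by rewrite fineK // fin_num_measure.
have tt0 : 0 <= tt by rewrite fine_ge0.
(* For these n the factors exp(n K) and tau(H)^n cost at most exp(n^2 de). *)
pose N0 := (Num.trunc ((K + tt) / de)).+1.
exists N0 => n nN.
have nd : K + tt <= de * n%:R.
  rewrite mulrC -ler_pdivrMr //; apply: ltW; apply: lt_le_trans (truncnS_gt _) _.
  by rewrite ler_nat.
have n0 : (0 < n)%N by apply: leq_trans nN.
have nr : 0 < n%:R :> R by rewrite ltr0n.
have pt lam : @Gtilde R H mu n k eps lam ->
    cmod (wVDM phi lam) ^+ 2 <= expR (n%:R ^+ 2 * (A - 2 * de) + n%:R * K) :> R.
  move=> lG; have [lH _] := lG.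
  have [w00|w0] := eqVneq (cmod (wVDM phi lam)) 0; first by rewrite w00 expr0n expR_ge0.
  have dis := wVDM_neq0_distinct w0.
  have [wgt0 wE] := ln_sqr_wVDM dis (fun i => hphi0 (lH i)).
  rewrite -[leLHS]lnK ?posrE ?exprn_gt0 // ler_expR wE -/S.
  pose G (i j : 'I_n) := ln (cdist (tnth lam i) (tnth lam j)) - S (tnth lam i) - S (tnth lam j).
  pose SS := \sum_(i < n) S (tnth lam i).
  have h4 : \sum_(i < n) \sum_(j < n | j != i) G i j <=
      \sum_(i < n) \sum_(j < n) F (tnth lam i) (tnth lam j) -
      \sum_(i < n) F (tnth lam i) (tnth lam i).
    rewrite -sumrB; apply: ler_sum => i _; rewrite [X in _ <= X - _](bigD1 i) //= addrAC subrr add0r.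
    apply: ler_sum => j ji; apply: lF => //; apply: dis; by rewrite eq_sym.
  have h5 : \sum_(i < n) \sum_(j < n) F (tnth lam i) (tnth lam j) <=
      n%:R ^+ 2 * (bimoment H mu s + de).
    have := kP n lam lG; rewrite ler_pdivrMl ?exprn_gt0 //.
  have h6 : - \sum_(i < n) F (tnth lam i) (tnth lam i) - 2 * SS <= n%:R * K.
    have -> : n%:R * K = \sum_(i < n) K by rewrite sumr_const card_ord mulr_natl.
    rewrite -sumrN /SS mulr_sumr -sumrB; apply: ler_sum => i _; exact: FK.
  have h7 : n%:R ^+ 2 * (bimoment H mu s + de) <= n%:R ^+ 2 * (A - 2 * de).
    rewrite ler_wpM2l ?exprn_ge0 ?(ltW nr) //; rewrite /de /gap in bi gap0 *; move: bi gap0; drop_local_hyps; lra.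
  rewrite -/SS; rewrite /G in h4; move: h4 h5 h6 h7; drop_local_hyps; lra.
apply: (le_trans (J_le_bound (expR_ge0 _) tt0 ttE pt)); rewrite lee_fin.
rewrite -expRD ler_expR.
have : n%:R * (K + tt) <= n%:R * (de * n%:R) by rewrite ler_pM2l.
have : 0 <= de * n%:R ^+ 2 by rewrite mulr_ge0 ?exprn_ge0 ?(ltW de0) ?(ltW nr).
by drop_local_hyps; lra.
Qed.

End upper_bound.

(** * Limits in the extended reals *)

Section extended_reals.
Variable R : realType.
Implicit Types (x y : \bar R) (u : nat -> \bar R).
Local Open Scope ereal_scope.

Lemma exists_real_between x y : x < y -> exists2 r : R, x < r%:E & r%:E < y.
Proof.
case: x y => [x| |] [y| |] //=; rewrite ?lte_fin ?ltNyy ?ltyy // => xy.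
- by exists ((x + y) / 2)%R; rewrite lte_fin; lra.
- by exists (x + 1)%R; rewrite ?ltry // lte_fin; lra.
- by exists (y - 1)%R; rewrite ?ltNyr // lte_fin; lra.
- by exists 0%R; rewrite ?ltNyr ?ltry.
Qed.

Lemma lee_of_lt_real x y : (forall r : R, r%:E < x -> r%:E <= y) -> x <= y.
Proof.
move=> h; rewrite leNgt; apply/negP => /exists_real_between[r yr rx].
by have := h r rx; rewrite leNgt yr.
Qed.

(** The hypothesis says that the limit superior is at most the limit
inferior. *)
Lemma cvgn_of_frequently_eventually u :
  (forall A' A : R, (A' < A)%R ->
    (forall N, exists2 n, (N <= n)%N & A%:E < u n) ->
    exists N, forall n, (N <= n)%N -> A'%:E <= u n) -> cvgn u.
Proof.
move=> h.
have [ce cs] := (cvg_einfs_sup (u := u), cvg_esups_inf (u := u)).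
set lo := ereal_sup _ in ce; set hi := ereal_inf _ in cs.
(* A real number strictly below the limit superior is exceeded by u
   infinitely often. *)
have hl : hi <= lo.
  apply: lee_of_lt_real => A' /exists_real_between[A A'A Ahi].
  have [|N hN] := h A' A A'A.
    move=> N; have : A%:E < esups u N.
      by apply: lt_le_trans Ahi _; apply: ereal_inf_lbound; exists N.
    by move=> /ereal_sup_gt[_ [n /= Nn <-] An]; exists n.
  apply: (@le_trans _ _ (einfs u N)); last by apply: ereal_sup_ubound; exists N.
  by apply: le_ereal_inf_tmp => _ [n /= Nn <-]; exact: hN.
have lh : lo = hi.
  apply/eqP; rewrite eq_le hl andbT -(cvg_lim _ ce) // -(cvg_lim _ cs) //.
  apply: lee_lim; [exact: is_cvg_einfs | exact: is_cvg_esups |].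
  by apply: nearW; exact: einfs_le_esups.
apply/cvg_ex; exists hi; apply: (squeeze_cvge (f := einfs u) (h := esups u)) => //.
  apply: nearW => n; apply/andP; split.
    by apply: ereal_inf_lbound; exists n => //=.
  by apply: ereal_sup_ubound; exists n => //=.
by rewrite -lh.
Qed.

Lemma le_scaled_lne (q A : R) x : (0 < q)%R -> 0 <= x ->
  (A%:E <= (q^-1)%:E * lne x) = ((expR (q * A))%:E <= x).
Proof.
move=> q0; have q1 : (0 < q^-1)%R by rewrite invr_gt0.
case: x => [x| |//].
  rewrite !lee_fin le_eqVlt => /predU1P[<-|x0].
    by rewrite le0_lneNy // gt0_muleNy // leeNy_eq leNgt expR_gt0.
  rewrite lne_EFin // -EFinM lee_fin ler_pdivlMl // -[in RHS](lnK x0) ler_expR //.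
by move=> _; rewrite /lne /= gt0_muley // !leey.
Qed.

Lemma lt_scaled_lne (q A : R) x : (0 < q)%R -> 0 <= x ->
  (A%:E < (q^-1)%:E * lne x) = ((expR (q * A))%:E < x).
Proof.
move=> q0; have q1 : (0 < q^-1)%R by rewrite invr_gt0.
case: x => [x| |//].
  rewrite lee_fin le_eqVlt => /predU1P[<-|x0].
    by rewrite le0_lneNy // gt0_muleNy // !ltNge leNye lee_fin expR_ge0.
  rewrite lne_EFin // -EFinM !lte_fin ltr_pdivlMl // -[in RHS](lnK x0) ltr_expR //.
by move=> _; rewrite /lne /= gt0_muley // !ltry.
Qed.

End extended_reals.

(** * Discretization of the measure *)

Section cells.
Variables (R : realType) (a1 b1 a2 b2 : R) (H : set (R * R)).
Variables (mu : {measure set (R * R) -> \bar R}) (S : R * R -> R).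
Hypotheses (hab1 : a1 < b1) (hab2 : a2 < b2).
Hypothesis hH : H = `[a1, b1] `*` `[a2, b2].
Hypotheses (mu1 : mu setT = 1%E) (muHC : mu (~` H) = 0%E).
Hypothesis hS : {within H, continuous S}.

Let mH : measurable H := measurable_rect hH.

(** The pushforward of mu to the centers of a fine partition.  Its truncated
energy is bounded through lower Riemann sums in z and then in t, the comparison
of costs on a pair of cells being [trunc_ln_ge]; where z = t the cost is
infinite and there is nothing to compare. *)
Lemma atomic_approx (k : nat) (C de : R) : 0 <= C -> 0 < de ->
  (forall z t, H z -> H t -> 0 < cdist z t -> ln (cdist z t) <= C) ->
  exists2 l0 : R, 0 < l0 & forall l, 0 < l -> l <= l0 ->
  exists (I : finType) (w : I -> R) (c : I -> R * R),
    [/\ forall i, 0 <= w i, \sum_i w i = 1, forall i, H (c i),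
     ((\sum_i \sum_j w i * w j * (C - trunc_ln l (c i) (c j)))%:E <=
        de%:E + (1 + de)%:E * log_energy mu C)%E &
     `|\int[mu]_(z in H) S z - \sum_i w i * S (c i)| <= de /\
     forall n1 n2, (n1 + n2 <= k)%N ->
       `|\int[mu]_(z in H) monomial n1 n2 z - \sum_i w i * monomial n1 n2 (c i)|
         <= de].
Proof.
move=> C0 de0 lnC.
have [l1 l10 hl1] := trunc_ln_ge C0 de0.
have [r r0 hr] := rect_unif_continuous hH hS de0.
have [M M0 hM] := lipschitz_monomials hH k.
have [mS [B SB]] := bounded_meas_continuous hab1 hab2 hH hS.
exists (Num.min (Num.min l1 1) (Num.min r (de / (M + 1)))).
  by rewrite !lt_min l10 r0 ltr01 divr_gt0 // ltr_wpDl.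
move=> l l0; rewrite !le_min => /andP[/andP[ll1 l_1] /andP[lr lM]].
have [I [A [c [mA Hc Ac tA HA]]]] := fine_partition hab1 hab2 hH l0.
have AH i z : A i z -> H z.
  by move=> Az; rewrite HA -bigcup_seq; exists i => //=; rewrite mem_index_enum.
exists I, (weight mu A), c; split => //.
- exact: weight_ge0.
- exact: (sum_weight mH mu1 muHC mA tA HA).
- pose b i j := C - trunc_ln l (c i) (c j).
  have b0 i j : 0 <= b i j.
    by rewrite subr_ge0; apply: trunc_ln_le => //; exact: lnC.
  have bf i j z t : A i z -> A j t ->
      ((b i j)%:E <= de%:E + (1 + de)%:E * log_cost C z t)%E.
    move=> Az At; have := cdist_ge0 z t; rewrite le_eqVlt => /predU1P[d0|d0].
      rewrite /log_cost -d0 le0_lneNy //= gt0_muley ?leey // lte_fin; lra.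
    rewrite /log_cost lne_EFin // -EFinB -EFin_max -EFinM -EFinD lee_fin.
    have := hl1 l (c i) (c j) z t l0 ll1 (Ac _ _ Az) (Ac _ _ At) d0
      (lnC _ _ (AH _ _ Az) (AH _ _ At) d0).
    move/le_trans; apply; rewrite lerD2l ler_wpM2l //; first lra.
    by rewrite le_max lexx.
  have mL t : measurable_fun setT (log_cost C ^~ t).
    exact: (measurable_funl (f := log_cost C) t (measurable_log_cost C)).
  pose g t := (\int[mu]_z log_cost C z t)%E.
  have g0 t : (0 <= g t)%E by apply: integral_ge0 => z _; exact: log_cost_ge0.
  have mg : measurable_fun setT g.
    apply: (measurable_inner_integral mu1); first exact: measurable_log_cost.
    exact: log_cost_ge0.
  have de1 : (0 <= (1 + de)%:E)%E by rewrite lee_fin; lra.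
  have aff (h : R * R -> \bar R) : measurable_fun setT h -> (forall z, 0 <= h z)%E ->
      (\int[mu]_(z in H) (de%:E + (1 + de)%:E * h z) =
        de%:E + (1 + de)%:E * \int[mu]_z h z)%E.
    move=> mh h0; rewrite ge0_integralD //; last 3 first.
    - by move=> z _; rewrite lee_fin ltW.
    - by move=> z _; exact: mule_ge0.
    - by apply: emeasurable_funM; [exact: measurable_cst | exact: measurable_funTS].
    rewrite (integral_cst_support mH mu1 muHC) ge0_integralZl //.
      by rewrite (ge0_integral_support mH muHC).
    exact: measurable_funTS.
  have maff (h : R * R -> \bar R) : measurable_fun setT h ->
      measurable_fun H (fun z => de%:E + (1 + de)%:E * h z)%E.
    move=> mh; apply: measurable_funTS; apply: emeasurable_funD.
      exact: measurable_cst.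
    by apply: emeasurable_funM => //; exact: measurable_cst.
  have inner j t : A j t ->
      ((\sum_i weight mu A i * b i j)%:E <= de%:E + (1 + de)%:E * g t)%E.
    move=> At; rewrite /g -aff //; last by move=> z; exact: log_cost_ge0.
    apply: (lower_riemann mH mu1 muHC mA tA HA) => //.
    - exact: maff.
    - move=> z _; rewrite adde_ge0 ?lee_fin ?(ltW de0) // mule_ge0 //.
      exact: log_cost_ge0.
    - by move=> i z Az; exact: bf.
  have := aff g mg g0; rewrite -/(log_energy mu C) => <-.
  have -> : \sum_i \sum_j weight mu A i * weight mu A j * (C - trunc_ln l (c i) (c j)) =
      \sum_j weight mu A j * \sum_i weight mu A i * b i j.
    rewrite exchange_big; apply: eq_bigr => j _; rewrite mulr_sumr.
    by apply: eq_bigr => i _; rewrite /b mulrCA mulrA.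
  apply: (lower_riemann mH mu1 muHC mA tA HA) => //.
  - exact: maff.
  - by move=> z _; rewrite adde_ge0 ?lee_fin ?(ltW de0) // mule_ge0.
  - by move=> i; apply: sumr_ge0 => j _; rewrite mulr_ge0 // weight_ge0.
- split.
    apply: (riemann_approx mH mu1 muHC mA tA HA mS SB Hc) => i z Az.
    by apply: hr => //; [exact: AH Az | exact: le_trans (Ac _ _ Az) lr].
  move=> n1 n2 nk.
  have [mm [B' mB]] := bounded_meas_monomial hH n1 n2.
  apply: (riemann_approx mH mu1 muHC mA tA HA mm mB Hc) => i z Az.
  have [h _] := hM n1 n2 z (c i) nk (AH _ _ Az) (Hc i).
  apply: (le_trans h); apply: (@le_trans _ _ (M * (de / (M + 1)))).
    by rewrite ler_wpM2l // (le_trans (Ac _ _ Az)).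
  by rewrite mulrA ler_pdivrMr ?ltr_wpDl //; nra.
Qed.

End cells.

(** * Lower bounds for the integrals and existence of the limit *)

Definition mixture_weight (R : realType) (n : nat) (J : finType) (t : R) (w : J -> R)
    (x : 'I_n + J) : R :=
  match x with inl _ => (1 - t) / n%:R | inr j => t * w j end.

(** The mixture of 1 - t times the uniform measure on n points with t times the
measure w.  Pairs of equal points among the n have total mass 1/n and pairs that
involve w have mass at most 2 t: for these the crude bound B on the cost is
enough. *)
Lemma mixture_cost (R : realType) (n : nat) (J : finType)
    (W : 'I_n + J -> 'I_n + J -> R) (w : J -> R) (t B X : R) :
  (0 < n)%N -> 0 <= t -> t <= 1 -> (forall j, 0 <= w j) -> \sum_j w j = 1 ->
  (forall x y, 0 <= W x y) -> (forall x y, W x y <= B) ->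
  \sum_(i < n) \sum_(j < n | j != i) W (inl i) (inl j) <= n%:R ^+ 2 * X ->
  \sum_x \sum_y mixture_weight t w x * mixture_weight t w y * W x y <= X + (n%:R^-1 + 2 * t) * B.
Proof.
move=> n0 t0 t1 w0 w1 W0 WB WX.
have nr : 0 < n%:R :> R by rewrite ltr0n.
have B0 : 0 <= B by apply: le_trans (W0 (inl (Ordinal n0)) (inl (Ordinal n0))) (WB _ _).
have q0 : 0 <= (1 - t) / n%:R by rewrite divr_ge0 ?subr_ge0 // ltW.
have qn : (1 - t) / n%:R <= n%:R^-1 by rewrite ler_piMl ?invr_ge0 ?(ltW nr) //; lra.
have sq : \sum_(i < n) (1 - t) / n%:R = 1 - t.
  by rewrite sumr_const card_ord -[_ *+ n]mulr_natl mulrC divfK // gt_eqF.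
have sw : \sum_j t * w j = t by rewrite -mulr_sumr w1 mulr1.
have prodB (I1 I2 : finType) (f : I1 -> R) (g : I2 -> R) (V : I1 -> I2 -> R) :
    (forall i, 0 <= f i) -> (forall i, 0 <= g i) -> (forall i j, V i j <= B) ->
    \sum_i \sum_j f i * g j * V i j <= (\sum_i f i) * (\sum_j g j) * B.
  move=> f0 g0 VB; rewrite -mulrA !mulr_suml; apply: ler_sum => i _.
  rewrite mulr_sumr; apply: ler_sum => j _.
  by rewrite -mulrA ler_wpM2l // ler_wpM2l.
rewrite big_sumType /=.
under eq_bigr do rewrite big_sumType /=.
under [X in _ + X]eq_bigr do rewrite big_sumType /=.
rewrite !big_split /=.
have LL : \sum_(i < n) \sum_(j < n) (1 - t) / n%:R * ((1 - t) / n%:R) * W (inl i) (inl j)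
    <= X + n%:R^-1 * B.
  apply: (@le_trans _ _ (n%:R^-1 * n%:R^-1 *
      \sum_(i < n) \sum_(j < n) W (inl i) (inl j))).
    rewrite mulr_sumr; apply: ler_sum => i _; rewrite mulr_sumr; apply: ler_sum => j _.
    by rewrite ler_wpM2r // ler_pM.
  have -> : \sum_(i < n) \sum_(j < n) W (inl i) (inl j) =
      \sum_(i < n) W (inl i) (inl i) + \sum_(i < n) \sum_(j < n | j != i) W (inl i) (inl j).
    by rewrite -big_split; apply: eq_bigr => i _; rewrite (bigD1 i).
  have dB : \sum_(i < n) W (inl i) (inl i) <= n%:R * B.
    by rewrite mulr_natl -[X in _ <= _ *+ X](card_ord n) -sumr_const ler_sum.
  have -> : X + n%:R^-1 * B = n%:R^-1 * n%:R^-1 * (n%:R * B + n%:R ^+ 2 * X).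
    by field; rewrite gt_eqF.
  by rewrite ler_wpM2l ?mulr_ge0 ?invr_ge0 ?(ltW nr) // lerD.
have LR := prodB _ _ (fun=> (1 - t) / n%:R) (fun j => t * w j)
  (fun (i : 'I_n) (j : J) => W (inl i) (inr j)).
have RL := prodB _ _ (fun j => t * w j) (fun=> (1 - t) / n%:R)
  (fun (j : J) (i : 'I_n) => W (inr j) (inl i)).
have RR := prodB _ _ (fun j => t * w j) (fun j => t * w j)
  (fun (i : J) (j : J) => W (inr i) (inr j)).
have tw j : 0 <= t * w j by rewrite mulr_ge0.
have {}LR := LR (fun=> q0) tw (fun i j => WB _ _).
have {}RL := RL tw (fun=> q0) (fun i j => WB _ _).
have {}RR := RR tw tw (fun i j => WB _ _).
rewrite sq sw in LR RL RR.
have : t * t * B + (1 - t) * t * B + t * (1 - t) * B <= 2 * t * B.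
  by have ttB : 0 <= t * t * B; [rewrite !mulr_ge0 | lra].
lra.
Qed.

Section lower_bounds.
Variables (R : realType) (a1 b1 a2 b2 : R) (H : set (R * R)).
Variables (mu : {measure set (R * R) -> \bar R}) (phi : R * R -> R).
Variables (tau : {finite_measure set (R * R)%type -> \bar R}) (T r0 : R).
Hypotheses (hab1 : a1 < b1) (hab2 : a2 < b2).
Hypothesis hH : H = `[a1, b1] `*` `[a2, b2].
Hypotheses (mu1 : mu setT = 1%E) (muHC : mu (~` H) = 0%E).
Hypothesis hphi : {within H, continuous phi}.
Hypothesis hphi0 : forall z, H z -> 0 < phi z.
Hypothesis htau : tau (~` H) = 0%E.
Hypotheses (hT : 0 < T) (hr0 : 0 < r0).
Hypothesis hdisc : forall z0 r, H z0 -> 0 < r -> r <= r0 ->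
  ((r `^ T)%:E <= tau (disc z0 r))%E.

Let S z := - ln (phi z).

Let mH : measurable H := measurable_rect hH.
Let cS : {within H, continuous S} := continuous_weight hphi hphi0.

Ltac drop_local_hyps :=
  clear - hab1 hab2 mu1 muHC hphi hphi0 htau hT hr0 hdisc mH S cS.

Lemma ln_cdist_bounded : exists2 C : R, 0 <= C &
  forall z t, H z -> H t -> 0 < cdist z t -> ln (cdist z t) <= C.
Proof.
exists (2^-1 * ln (((b1 - a1) + (b2 - a2)) ^+ 2 + 1)).
  exact: log_bound_ge0 hab1 hab2.
by move=> z t Hz Ht d0; exact: (ln_cdist_le hab1 hab2 hH).
Qed.

Lemma trunc_cost_ge0 (C s0 l : R) (c c' : R * R) : 0 <= C -> 0 < l -> l <= 1 ->
  (0 < cdist c c' -> ln (cdist c c') <= C) -> `|S c| <= s0 -> `|S c'| <= s0 ->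
  0 <= trunc_cost S (C + 2 * s0) l c c'.
Proof.
move=> C0 l0 l1 h; have := trunc_ln_le C0 l0 l1 h; rewrite /trunc_cost !ler_norml.
by move=> h0 /andP[h1 _] /andP[h2 _]; lra.
Qed.

(** The measure mu is replaced by its discretization on a partition at a scale
l that is small with respect to all the moduli involved. *)
Lemma eventually_ge_J_of_lt_free_entropy (A : R) (k : nat) (eps : R) : 0 < eps ->
  (A%:E < free_entropy mu - 2%:E * \int[mu]_(z in H) (S z)%:E)%E ->
  exists N0 : nat, forall n, (N0 <= n)%N ->
    ((expR (n%:R ^+ 2 * A))%:E <= J H mu phi tau n k eps)%E.
Proof.
move=> eps0.
have [C C0 lnC] := ln_cdist_bounded.
have bS := bounded_meas_continuous hab1 hab2 hH cS.
have iS := bounded_meas_integrable mH mu1 muHC bS.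
pose sS := \int[mu]_(z in H) S z.
have -> : (\int[mu]_(z in H) (S z)%:E = sS%:E)%E.
  by rewrite /sS /Rintegral fineK // integrable_fin_num.
rewrite (free_entropyE mH mu1 muHC C0 lnC).
have e0 : (0 <= log_energy mu C)%E.
  by apply: integral_ge0 => t _; apply: integral_ge0 => z _; exact: log_cost_ge0.
have := @atomic_approx _ _ _ _ _ _ mu S hab1 hab2 hH mu1 muHC cS k C _ C0 _ lnC.
move: e0; case: (log_energy mu C) => [E| |//]; last by rewrite ltNge leNye.
rewrite lee_fin lte_fin => E0 approx hA.
pose gap := C - E - 2 * sS - A.
have gap0 : 0 < gap by rewrite /gap; lra.
(* The energy loses 3 de + de E + 2 om with om = gap / 8, less than gap; the
   moments lose de + 2 Mk l + sl <= 3 eps / 4. *)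
pose de : R := Num.min (eps / 4) (gap / (8 * (E + 4))).
have de0 : 0 < de by rewrite lt_min !divr_gt0 // mulr_gt0 //; lra.
have deE : de * (E + 4) <= gap / 8.
  apply: (@le_trans _ _ (gap / (8 * (E + 4)) * (E + 4))).
    by rewrite ler_wpM2r ?ge_min ?lexx ?orbT //; lra.
  by rewrite le_eqVlt; apply/orP; left; apply/eqP; field; lra.
have de_eps : de <= eps / 4 by rewrite ge_min lexx.
have [l0 l00 hl0] := approx de de0.
have gap8 : 0 < gap / 8 by rewrite divr_gt0.
have [r r1 hr] := rect_unif_continuous hH cS gap8.
have [s0 s00 hs0] := bounded_on_rect hab1 hab2 hH cS.
have [Mk Mk0 hMk] := lipschitz_monomials hH k.
pose l : R := Num.min (Num.min l0 1) (Num.min (Num.min (b1 - a1) (r / 2))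
  (eps / (8 * (Mk + 1)))).
have Mk1 : 0 < 8 * (Mk + 1) by lra.
have l_gt0 : 0 < l by rewrite !lt_min l00 ltr01 subr_gt0 hab1 !divr_gt0.
have : l <= l by [].
rewrite {2}/l !le_min => /andP[/andP[ll0 l1] /andP[/andP[lb lr] lM]].
have {}lM : 8 * Mk * l <= eps.
  have : l * (8 * (Mk + 1)) <= eps by rewrite -ler_pdivlMr.
  by move: l_gt0; drop_local_hyps; lra.
have [I [w [c [w0 w1 Hc en [sw mw]]]]] := hl0 l l_gt0 ll0.
apply: (@eventually_ge_J _ _ _ _ _ H mu phi tau T r0 hH hphi0 htau hT hr0 hdisc
  I w c (C + 2 * s0) l (gap / 8) Mk (eps / 4) A k eps) => //.
- move=> z t Hz Ht zt; apply: hr => //; by apply: (le_trans zt); move: lr; drop_local_hyps; lra.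
- move=> i j; apply: trunc_cost_ge0 => //; [exact: lnC | exact: hs0 | exact: hs0].
- by move=> n1 n2 z t nk Hz Ht; have [] := hMk n1 n2 z t nk Hz Ht.
- by rewrite divr_gt0.
- move=> n1 n2 nk; by have := mw n1 n2 nk; move: de_eps lM eps0; drop_local_hyps; lra.
have -> : \sum_i \sum_j w i * w j * trunc_cost S (C + 2 * s0) l (c i) (c j) =
    \sum_i \sum_j w i * w j * (C - trunc_ln l (c i) (c j)) + 2 * s0 +
    2 * \sum_i w i * S (c i).
  have wS : \sum_i \sum_j w i * w j * S (c i) = \sum_i w i * S (c i).
    apply: eq_bigr => i _; rewrite -mulr_suml -mulr_sumr w1 mulr1 //.
  have wS' : \sum_i \sum_j w i * w j * S (c j) = \sum_i w i * S (c i).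
    rewrite exchange_big; apply: eq_bigr => i _; rewrite -mulr_suml -mulr_suml w1 mul1r //.
  have ws : \sum_i \sum_j w i * w j * (2 * s0) = 2 * s0.
    by under eq_bigr do rewrite -mulr_suml -mulr_sumr w1 mulr1; rewrite -mulr_suml w1 mul1r.
  transitivity (\sum_i \sum_j w i * w j * (C - trunc_ln l (c i) (c j)) +
      \sum_i \sum_j w i * w j * (2 * s0) + \sum_i \sum_j w i * w j * S (c i) +
      \sum_i \sum_j w i * w j * S (c j)); last by rewrite wS wS' ws; ring.
  rewrite -!big_split; apply: eq_bigr => i _; rewrite -!big_split; apply: eq_bigr => j _.
  by rewrite /trunc_cost /=; ring.
move: en; rewrite -EFinM -EFinD lee_fin => en.
move: sw; rewrite ler_norml -/sS => /andP[sw _].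
by rewrite /gap in gap8 deE *; move: gap8 deE en sw E0 de0; drop_local_hyps; lra.
Qed.

(** The truncated logarithm is never below ln(l/128). *)
Lemma trunc_cost_le (C0 s0 l : R) (c c' : R * R) : 0 < l ->
  `|S c| <= s0 -> `|S c'| <= s0 -> trunc_cost S C0 l c c' <= C0 + 2 * s0 - ln (l / 128).
Proof.
move=> l0; rewrite /trunc_cost !ler_norml => /andP[_ h1] /andP[_ h2].
have : ln (l / 128) <= trunc_ln l c c'; last by lra.
rewrite /trunc_ln; case: ifPn => //; rewrite -leNgt => cc.
by rewrite ler_ln ?posrE ?divr_gt0 //; lra.
Qed.

(** The cost of the tuple at its own points: the factor 1 + de and the term de
come from [trunc_ln_ge] with c = z and c' = t, and the rest is
[ln_sqr_wVDM]. *)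
Lemma sum_trunc_cost_le (C s0 de l : R) (n : nat) (lam : n.-tuple (R * R)) :
  0 <= C -> 0 < de -> 0 <= s0 -> (forall i, H (tnth lam i)) ->
  (forall z, H z -> `|S z| <= s0) ->
  (forall z t, H z -> H t -> 0 < cdist z t ->
    C - trunc_ln l z t <= de + (1 + de) * (C - ln (cdist z t))) ->
  cmod (wVDM phi lam) != 0 ->
  \sum_(i < n) \sum_(j < n | j != i)
    trunc_cost S (C + 2 * s0) l (tnth lam i) (tnth lam j) <=
  n%:R ^+ 2 * de + (1 + de) *
    (n%:R ^+ 2 * (C + 2 * s0) - ln (cmod (wVDM phi lam) ^+ 2)).
Proof.
move=> C0 de0 s00 lH hs hl w0.
have dis := wVDM_neq0_distinct w0.
have [_ ->] := ln_sqr_wVDM dis (fun i => hphi0 (lH i)); rewrite -/S.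
pose G (i j : 'I_n) := ln (cdist (tnth lam i) (tnth lam j)) - S (tnth lam i) - S (tnth lam j).
pose SS := \sum_(i < n) S (tnth lam i).
have cst (x : R) : \sum_(i < n) \sum_(j < n | j != i) x = n%:R ^+ 2 * x - n%:R * x.
  rewrite (eq_bigr (fun=> n%:R * x - x)); last first.
    move=> i _; rewrite mulr_natl -[X in _ *+ X](card_ord n) -sumr_const [in RHS](bigD1 i) //=.
    by rewrite addrAC subrr add0r.
  by rewrite sumr_const card_ord -[_ *+ n]mulr_natl; ring.
apply: (@le_trans _ _ (\sum_(i < n) \sum_(j < n | j != i)
    (de + (1 + de) * (C + 2 * s0) - (1 + de) * G i j))).
  apply: ler_sum => i _; apply: ler_sum => j ji; rewrite /trunc_cost /G.
  have := hl _ _ (lH i) (lH j) (dis i j _); rewrite eq_sym => /(_ ji).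
  have := hs _ (lH i); have := hs _ (lH j); rewrite !ler_norml => /andP[h1 _] /andP[h2 _].
  have : 0 <= de * (2 * s0 + S (tnth lam i) + S (tnth lam j)).
    by rewrite mulr_ge0 ?(ltW de0) //; lra.
  lra.
under eq_bigr do rewrite big_split /= sumrN -mulr_sumr.
rewrite big_split /= cst sumrN -mulr_sumr -/SS.
have SSs : - (n%:R * s0) <= SS.
  rewrite mulr_natl -mulNrn -[X in _ *+ X](card_ord n) -sumr_const; apply: ler_sum => i _.
  by have := hs _ (lH i); rewrite ler_norml => /andP[].
have nn : 0 <= n%:R :> R by rewrite ler0n.
have nde : 0 <= n%:R * de by rewrite mulr_ge0 // ltW.
have nC : 0 <= n%:R * C by rewrite mulr_ge0.
have : 0 <= (1 + de) * (n%:R * C + 2 * (n%:R * s0 + SS)).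
  rewrite mulr_ge0 //; first lra.
  by rewrite addr_ge0 // mulr_ge0 //; lra.
set GG := \sum_(i < n) \sum_(j < n | j != i) _; rewrite -/GG; lra.
Qed.

Lemma J_gt_exists (A : R) n (k : nat) (eps tt : R) : 0 <= tt -> tau setT = tt%:E ->
  ((expR (n%:R ^+ 2 * A))%:E < J H mu phi tau n k eps)%E ->
  exists2 lam, @Gtilde R H mu n k eps lam &
    expR (n%:R ^+ 2 * A - n%:R * tt) < cmod (wVDM phi lam) ^+ 2.
Proof.
move=> tt0 ttE hJ; apply: contrapT => no; move: hJ; rewrite ltNge => /negP; apply.
apply: (le_trans (J_le_bound (expR_ge0 (n%:R ^+ 2 * A - n%:R * tt)) tt0 ttE _)).
  by move=> lam lG; rewrite leNgt; apply/negP => h; apply: no; exists lam.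
by rewrite -expRD subrK.
Qed.

(** One large tuple is turned into tuples of all large sizes.  Its moments may
come arbitrarily close to the limit eps, so a mass t = 1/d of a discretization
of mu with moments within eps/2 is mixed in; it gains t eps/2 in the moment
conditions, which beats the displacement at scale l = t^2, while
the cost of the diagonal and of the added mass is of order (ln d) / d. *)
Lemma J_frequently_eventually (A' A : R) (k : nat) (eps : R) : 0 < eps -> A' < A ->
  (forall N, exists2 d, (N <= d)%N & ((expR (d%:R ^+ 2 * A))%:E < J H mu phi tau d k eps)%E) ->
  exists N0 : nat, forall n, (N0 <= n)%N ->
    ((expR (n%:R ^+ 2 * A'))%:E <= J H mu phi tau n k eps)%E.
Proof.
move=> eps0 AA freq.
have [C C0 lnC] := ln_cdist_bounded.
have [s0 s00 hs0] := bounded_on_rect hab1 hab2 hH cS.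
have [Mk Mk0 hMk] := lipschitz_monomials hH k.
pose tt := fine (tau setT).
have ttE : tau setT = tt%:E by rewrite fineK // fin_num_measure.
have tt0 : 0 <= tt by rewrite fine_ge0.
pose gap := A - A'.
have gap0 : 0 < gap by rewrite subr_gt0.
have gap8 : 0 < gap / 8 by rewrite divr_gt0.
have gap4 : 0 < gap / 4 by rewrite divr_gt0.
pose C1 := C + 2 * s0.
(* The errors in the energy: at most de Y = gap / 8 from the truncation,
   gap / 4 from the terms of order (ln d) / d, and 2 om = gap / 4. *)
pose Y := `|C1 - A| + tt + 1.
have Y0 : 0 < Y by rewrite ltr_wpDl // addr_ge0.
pose de : R := gap / (8 * Y).
have de0 : 0 < de by rewrite divr_gt0 // mulr_gt0.
have deY : de * Y = gap / 8 by rewrite /de; field; rewrite gt_eqF.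
have [l0 l00 hl0] := trunc_ln_ge C0 de0.
have [r r1 hr] := rect_unif_continuous hH cS gap8.
have eps2 : 0 < eps / 2 by rewrite divr_gt0.
have [lJ lJ0 hJ] := @atomic_approx _ _ _ _ _ _ mu S hab1 hab2 hH mu1 muHC cS k C
  (eps / 2) C0 eps2 lnC.
have [J0 [w [cj [w0 w1 Hcj _ [_ mw]]]]] := hJ lJ lJ0 (lexx _).
have [N1 HN1] := log_sublinear (tt + 3 * (C1 + 2 * s0 + ln 128)) (ler0n R 6) gap4.
(* For d >= Z the scale 1/d is below all the thresholds imposed on l and t. *)
pose Z := l0^-1 + (b1 - a1)^-1 + 2 / r + 8 * Mk / eps.
have i1 : 0 <= l0^-1 by rewrite invr_ge0 ltW.
have i2 : 0 <= (b1 - a1)^-1 by rewrite invr_ge0 subr_ge0 ltW.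
have i3 : 0 <= 2 / r by rewrite divr_ge0 // ltW.
have i4 : 0 <= 8 * Mk / eps by rewrite divr_ge0 ?mulr_ge0 // ltW.
have [d dN dJ] := freq (maxn N1 (Num.trunc Z).+1).
move: dN; rewrite geq_max => /andP[dN1 dZ].
have {}dZ : Z <= d%:R.
  by apply: ltW; apply: lt_le_trans (truncnS_gt _) _; rewrite ler_nat.
have d0 : (0 < d)%N.
  rewrite lt0n; apply/negP => /eqP dd; move: dZ; rewrite dd /Z.
  have : 0 < l0^-1 by rewrite invr_gt0.
  by move: i1 i2 i3 i4; drop_local_hyps; lra.
have dr : 0 < d%:R :> R by rewrite ltr0n.
have d1 : 1 <= d%:R :> R by rewrite ler1n.
have {HN1} hN1 := HN1 d dN1.
have [lam lG lam_gt] := J_gt_exists tt0 ttE dJ.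
have [lH [_ lmom]] := lG.
have wne : cmod (wVDM phi lam) != 0.
  by apply/eqP => w00; move: lam_gt; rewrite w00 expr0n /= ltNge expR_ge0.
pose t : R := d%:R^-1.
have t0 : 0 < t by rewrite invr_gt0.
have t1 : t <= 1 by rewrite invf_le1.
have tE x : 0 < x -> x^-1 <= d%:R -> t <= x.
  by move=> x0 h; rewrite -[x]invrK lef_pV2 // posrE invr_gt0.
pose l : R := t ^+ 2.
have l_gt0 : 0 < l by rewrite exprn_gt0.
have lt : l <= t by rewrite /l expr2 ler_piMl // ltW.
have [z1 z2 z3 z4] : [/\ l0^-1 <= d%:R, (b1 - a1)^-1 <= d%:R, 2 / r <= d%:R &
    8 * Mk / eps <= d%:R].
  by rewrite /Z in dZ; move: dZ i1 i2 i3 i4; drop_local_hyps; move=> dZ i1 i2 i3 i4; split; lra.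
have ll0 : l <= l0 by apply: (le_trans lt); exact: tE.
have lb : l <= b1 - a1.
  by apply: (le_trans lt); apply: tE; rewrite ?subr_gt0.
have lr : 2 * l <= r.
  suff : t <= r / 2 by move: lt; drop_local_hyps; lra.
  by apply: tE; rewrite ?divr_gt0 // invf_div.
have lM : 8 * Mk * t <= eps.
  by move: z4; rewrite ler_pdivrMr // => h; rewrite /t ler_pdivrMr // [leRHS]mulrC.
have l1 : l <= 1 by apply: le_trans t1.
pose c (x : 'I_d + J0) := match x with inl i => tnth lam i | inr j => cj j end.
have Hc x : H (c x) by case: x => [i|j]; [exact: lH | exact: Hcj].
pose m := mixture_weight t w : 'I_d + J0 -> R.
have m0 x : 0 <= m x.
  by case: x => [i|j] /=; rewrite ?divr_ge0 ?mulr_ge0 ?subr_ge0 // ltW.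
have sumR (F : 'I_d + J0 -> R) : \sum_x m x * F x =
    (1 - t) * (d%:R^-1 * \sum_(i < d) F (inl i)) + t * \sum_j w j * F (inr j).
  rewrite big_sumType /= !mulr_sumr; congr (_ + _).
    by apply: eq_bigr => i _; rewrite mulrA.
  by apply: eq_bigr => i _; rewrite mulrA.
have m1 : \sum_x m x = 1.
  have := sumR (fun=> 1); rewrite sumr_const card_ord mulVf ?gt_eqF //.
  under eq_bigr do rewrite mulr1.
  by under [X in _ = _ + _ * X]eq_bigr do rewrite mulr1; rewrite w1 => ->; ring.
pose B := C1 + 2 * s0 - ln (l / 128).
have WB x y : trunc_cost S C1 l (c x) (c y) <= B by apply: trunc_cost_le; rewrite ?hs0.
have W0 x y : 0 <= trunc_cost S C1 l (c x) (c y).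
  by apply: trunc_cost_ge0; rewrite ?hs0 //; exact: lnC.
have cost := mixture_cost d0 (ltW t0) t1 w0 w1 W0 WB.
have BE : B = C1 + 2 * s0 + ln 128 + 2 * ln d%:R.
  rewrite /B ln_div ?posrE // /l lnXn // /t lnV ?posrE // -[_ *+ 2]mulr_natl; ring.
have hX : \sum_(i < d) \sum_(j < d | j != i)
    trunc_cost S C1 l (c (inl i)) (c (inl j)) <=
    d%:R ^+ 2 * (de + (1 + de) * (C1 - A + tt / d%:R)).
  apply: (le_trans (sum_trunc_cost_le C0 de0 s00 lH hs0 _ wne)).
    move=> z y Hz Hy zy; apply: hl0 => //; rewrite ?cdistxx ?(ltW l_gt0) //.
    exact: lnC.
  rewrite -/C1 [leRHS]mulrDr lerD2l [leRHS]mulrCA ler_wpM2l //; first by rewrite addr_ge0 // ltW.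
  have : d%:R ^+ 2 * A - d%:R * tt <= ln (cmod (wVDM phi lam) ^+ 2).
    by rewrite -[leLHS]expRK ler_ln ?posrE ?expR_gt0 ?(ltW lam_gt) //;
       apply: lt_trans lam_gt; exact: expR_gt0.
  have -> : d%:R ^+ 2 * (C1 - A + tt / d%:R) = d%:R ^+ 2 * C1 - (d%:R ^+ 2 * A - d%:R * tt).
    by field; rewrite gt_eqF.
  by drop_local_hyps; lra.
have {}cost := cost _ hX.
apply: (@eventually_ge_J _ _ _ _ _ H mu phi tau T r0 hH hphi0 htau hT hr0 hdisc
  _ m c C1 l (gap / 8) Mk (eps / 4 * t) A' k eps) => //.
- by move=> z y Hz Hy zy; apply: hr => //; apply: (le_trans zy).
- by move=> n1 n2 z y nk Hz Hy; have [] := hMk n1 n2 z y nk Hz Hy.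
- by rewrite mulr_gt0 // divr_gt0.
- move=> n1 n2 nk; rewrite sumR /=.
  have := lmom n1 n2 nk.
  rewrite (Rintegral_kappa mH (measurable_monomial n1 n2) lH) => /ltW h1.
  have h2 := mw n1 n2 nk; move: h1 h2.
  rewrite -/(monomial n1 n2).
  set X := \int[mu]_(x in H) _; set P := _ * \sum_(i < d) _; set Q := \sum_j _ => h1 h2.
  have -> : X - ((1 - t) * P + t * Q) = (1 - t) * (X - P) + t * (X - Q) by ring.
  have h3 : `|(1 - t) * (X - P) + t * (X - Q)| <= (1 - t) * eps + t * (eps / 2).
    apply: (le_trans (ler_normD _ _)); rewrite !normrM (ger0_norm (ltW t0)).
    rewrite (@ger0_norm _ (1 - t)) ?subr_ge0 //.
    by apply: lerD; rewrite ler_wpM2l // ?subr_ge0 // ltW.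
  have h4 : 8 * Mk * t * t <= eps * t by rewrite ler_wpM2r // ltW.
  by rewrite /l expr2; move: h3 h4; drop_local_hyps; lra.
rewrite -/C1.
set cc := \sum_i \sum_j _ in cost *.
have h1 : (d%:R^-1 + 2 * t) * B + (1 + de) * (tt / d%:R) <= gap / 4 + de * tt.
  have e1 : (d%:R^-1 + 2 * t) * B + tt / d%:R <= gap / 4.
    rewrite -/t.
    have -> : (t + 2 * t) * B + tt * t = t * (tt + 3 * B) by ring.
    rewrite /t ler_pdivrMl // BE mulrC; move: hN1; drop_local_hyps; lra.
  have e2 : de * (tt / d%:R) <= de * tt.
    by rewrite ler_wpM2l ?(ltW de0) // ler_pdivrMr // ler_peMr.
  by move: e1 e2; drop_local_hyps; lra.
have h2 : de * (C1 - A) <= de * `|C1 - A| by rewrite ler_wpM2l ?(ltW de0) // ler_norm.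
rewrite /Y in deY.
have AE : A' = A - gap by rewrite /gap; ring.
by move: cost h1 h2 deY AE gap0; drop_local_hyps; lra.
Qed.
End lower_bounds.

Unset Implicit Arguments.

Theorem theorem3p1 (R : realType) (a1 b1 a2 b2 : R) (H : set (R * R))
  (mu : {measure set (R * R) -> \bar R}) (phi : R * R -> R)
  (tau : {finite_measure set (R * R)%type -> \bar R}) (T r0 : R)
  (hab1 : a1 < b1) (hab2 : a2 < b2)
  (hH : H = `[a1, b1] `*` `[a2, b2])
  (hmu : prob_on H mu)
  (hphi : {within H, continuous phi})
  (hphi0 : forall z, H z -> 0 < phi z)
  (htau : tau (~` H) = 0%E)
  (hT : 0 < T) (hr0 : 0 < r0)
  (hdisc : forall z0 r, H z0 -> 0 < r -> r <= r0 ->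
     ((r `^ T)%:E <= tau (disc z0 r))%E) :
  let S z := - ln (phi z) in
  let u k eps (d : nat) :=
    (((d%:R ^+ 2)^-1)%:E * lne (J H mu phi tau d k eps))%E in
  (forall (k : nat) (eps : R), 0 < eps -> cvgn (u k eps)) /\
  ereal_inf [set l | exists (k : nat) (eps : R),
                       0 < eps /\ l = limn (u k eps)]
  = (free_entropy mu - 2%:E * \int[mu]_(z in H) (S z)%:E)%E.
Proof.
move=> S u; have [mu1 muHC] := hmu.
have J0 k eps d : (0 <= J H mu phi tau d k eps)%E.
  by apply: integral_ge0 => lam _; rewrite lee_fin exprn_ge0 // cmod_ge0.
have sq d : (0 < d)%N -> 0 < d%:R ^+ 2 :> R by move=> d0; rewrite exprn_gt0 // ltr0n.
have leu k eps d (A : R) : (0 < d)%N ->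
    (A%:E <= u k eps d)%E = ((expR (d%:R ^+ 2 * A))%:E <= J H mu phi tau d k eps)%E.
  by move=> d0; exact: (le_scaled_lne A (sq d d0) (J0 k eps d)).
have ltu k eps d (A : R) : (0 < d)%N ->
    (A%:E < u k eps d)%E = ((expR (d%:R ^+ 2 * A))%:E < J H mu phi tau d k eps)%E.
  by move=> d0; exact: (lt_scaled_lne A (sq d d0) (J0 k eps d)).
have cu k eps : 0 < eps -> cvgn (u k eps).
  move=> eps0; apply: cvgn_of_frequently_eventually => A' A AA freq.
  have [N|N0 hN0] := @J_frequently_eventually _ _ _ _ _ H mu phi tau T r0 hab1 hab2 hH
    mu1 muHC hphi hphi0 htau hT hr0 hdisc A' A k eps eps0 AA _.
    have [n Nn hn] := freq (maxn N 1); move: Nn; rewrite geq_max => /andP[Nn n0].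
    by exists n => //; rewrite -ltu.
  exists (maxn N0 1) => n; rewrite geq_max => /andP[nN n0].
  by rewrite leu //; exact: hN0.
split => //; apply/eqP; rewrite eq_le; apply/andP; split.
  apply: lee_of_lt_real => A hA.
  rewrite leNgt; apply/negP => /exists_real_between[A' VA A'A].
  have [k [eps [eps0 [N0 hN0]]]] := @eventually_le_J _ _ _ _ _ H mu phi tau hab1 hab2 hH
    mu1 muHC hphi hphi0 A' VA.
  have : (A%:E < limn (u k eps))%E.
    by apply: (lt_le_trans hA); apply: ereal_inf_lbound; exists k, eps.
  apply/negP; rewrite -leNgt; apply: lime_le; first exact: cu.
  near=> n.
  have nN : (N0 <= n)%N by near: n; exact: nbhs_infty_ge.
  have n0 : (0 < n)%N by near: n; exact: nbhs_infty_ge.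
  apply: (@le_trans _ _ A'%:E); last exact: ltW.
  by rewrite leNgt ltu // -leNgt; exact: hN0.
apply: le_ereal_inf_tmp => _ [k [eps [eps0 ->]]].
apply: lee_of_lt_real => A hA.
have [N0 hN0] := @eventually_ge_J_of_lt_free_entropy _ _ _ _ _ H mu phi tau T r0 hab1 hab2
  hH mu1 muHC hphi hphi0 htau hT hr0 hdisc A k eps eps0 hA.
apply: lime_ge; first exact: cu.
near=> n.
have nN : (N0 <= n)%N by near: n; exact: nbhs_infty_ge.
have n0 : (0 < n)%N by near: n; exact: nbhs_infty_ge.
by rewrite leu //; exact: hN0.
Unshelve. all: by end_near. Qed.
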